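(* Let $\mathbf M=(S,\mathcal I)$ be a matroid given by an independence oracle and $G=(S,E)$ a graph such that $(\mathbf M,G)$ is tractable. Then there is a linear incremental-time, polynomial-space algorithm that enumerates all maximal matchings of $(\mathbf M,G)$ in non-increasing order of cardinality.
   Context: $n=|S|$; oracle calls take $Q$ time and $\hat Q$ space. For $F\subseteq E$ let $V(F)=\bigcup_{e\in F}e$. A matching of $(\mathbf M,G)$ is a matching $M$ of $G$ with $V(M)\in\mathcal I$; it is maximal if no $f\in E\setminus M$ gives a matching $M\cup\{f\}$ of $(\mathbf M,G)$. Restriction $\mathbf M|X$: independent sets of $\mathcal I$ inside $X$; deletion $\mathbf M\setminus X=\mathbf M|(S\setminus X)$; contraction $\mathbf M/X$: matroid on $S\setminus X$ where $Y$ is independent iff $\mathbf M|X$ has a base $B$ with $Y\cup B\in\mathcal I$. $(\mathbf M,G)$ is tractable if for all $X\subseteq S$, spanning subgraphs $H$ of $G[X]$ and $H'$ of $G[S\setminus X]$, maximum matchings of $(\mathbf M|X,H)$, $(\mathbf M\setminus X,H')$, $(\mathbf M/X,H')$ can be found in time polynomial in $n+Q$ and space polynomial in $n+\hat Q$. Linear incremental-time: for every $i$ at most the number of solutions, at least $i$ solutions are output within $O(i\cdot\mathrm{poly}(n+Q))$ time; polynomial space means space polynomial in $n+\hat Q$. *)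

(* Defs.v *)
From mathcomp Require Import all_boot ssralg poly.

Set Implicit Arguments.
Unset Strict Implicit.
Unset Printing Implicit Defensive.

Record matroid (S : finType) := Matroid {
  indep : {set {set S}};
  indep0 : set0 \in indep;
  indep_sub : forall A B : {set S}, A \subset B -> B \in indep -> A \in indep;
  indep_aug : forall A B : {set S}, A \in indep -> B \in indep -> #|A| < #|B| ->
    exists2 x, x \in B :\: A & x |: A \in indep
}.

Record graph (S : finType) := Graph {
  edges : {set {set S}};
  edges2 : forall e, e \in edges -> #|e| = 2
}.

Section Matchings.
Variable S : finType.
Implicit Types (I E F : {set {set S}}) (X Y B M : {set S}).

(* A minor is given by its family of independent sets, as a family of subsets
   of S; its ground set (X, ~: X and ~: X respectively) is not recorded. *)
Definition restrict I X : {set {set S}} := [set Y in I | Y \subset X].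

Definition delete I X : {set {set S}} := restrict I (~: X).

Definition contract I X : {set {set S}} :=
  [set Y : {set S} | (Y \subset ~: X) &&
     [exists B : {set S}, maxset [in restrict I X] B && (Y :|: B \in I)]].

Definition induced E X : {set {set S}} := [set e in E | e \subset X].

(* [cover F] is V(F); [trivIset F] says that the members of F are pairwise
   disjoint. *)
Definition matching I E F : bool :=
  [&& F \subset E, trivIset F & cover F \in I].

Definition maximal_matching I E F : bool :=
  matching I E F && [forall f in E :\: F, ~~ matching I E (f |: F)].

Definition maximum_matching I E F : bool :=
  matching I E F && [forall F', matching I E F' ==> (#|F'| <= #|F|)].

End Matchings.

(* Programs are WHILE programs over binary trees (in the style of N. Jones),
   with an oracle, an output instruction and calls of non-recursive
   procedures.  This model is polynomially equivalent to oracle Turing machines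
   with a write-only output tape, for time and space simultaneously. *)

Inductive tree := Leaf | Node of tree & tree.

Fixpoint tsize (t : tree) : nat :=
  if t is Node l r then (tsize l + tsize r).+1 else 1.

Inductive expr :=
  | Var of nat
  | ENil
  | ECons of expr & expr
  | EHd of expr
  | ETl of expr.

(* A store lists the values of variables 0, 1, ...; further ones are Leaf. *)
Definition store := seq tree.

Definition get (s : store) (x : nat) : tree := nth Leaf s x.
Definition set_var (s : store) (x : nat) (v : tree) : store := set_nth Leaf s x v.
Definition ssize (s : store) : nat := sumn (map tsize s).

Fixpoint eval (s : store) (e : expr) : tree :=
  match e with
  | Var x => get s x
  | ENil => Leaf
  | ECons e1 e2 => Node (eval s e1) (eval s e2)
  | EHd e1 => if eval s e1 is Node l _ then l else Leaf
  | ETl e1 => if eval s e1 is Node _ r then r else Leaf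
  end.

(* One time unit per operation: trees are immutable and can be shared. *)
Fixpoint etime (e : expr) : nat :=
  match e with
  | Var _ | ENil => 1
  | ECons e1 e2 => (etime e1 + etime e2).+1
  | EHd e1 | ETl e1 => (etime e1).+1
  end.

(* Space is measured without sharing. *)
Definition espace (s : store) (e : expr) : nat := ssize s + tsize (eval s e).

(* In conditions, Leaf is false and every other tree is true.
   [Call x c e] runs c in a fresh store whose variable 0 holds the value of e,
   and assigns to x the final value of variable 0 of that store. *)
Inductive cmd :=
  | Assign of nat & expr
  | Seq of cmd & cmd
  | If of expr & cmd & cmd
  | While of expr & cmd
  | Query of nat & expr
  | Call of nat & cmd & expr
  | Output of expr.

(* Every call takes [otime] time (Q) and [ospace] space (\hat Q). *)
Record oracle := Oracle {
  answer :> tree -> tree;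
  otime : nat;
  ospace : nat
}.

(* Outputs are paired with the times at which they are completed. *)
Definition trace := seq (nat * tree).

Definition delay (t : nat) (o : trace) : trace :=
  [seq (t + p.1, p.2) | p <- o].

(* [exec O c s s' t m o]: with oracle O, the program c started in store s halts
   in store s' after t time units, using at most m space, with outputs o.
   Writing an output takes time proportional to its size, but no space. *)
Inductive exec (O : oracle) :
    cmd -> store -> store -> nat -> nat -> trace -> Prop :=
  | ExecAssign x e s :
      let s' := set_var s x (eval s e) in
      exec O (Assign x e) s s' (etime e).+1 (maxn (espace s e) (ssize s')) [::]
  | ExecSeq c1 c2 s s1 s2 t1 t2 m1 m2 o1 o2 :
      exec O c1 s s1 t1 m1 o1 -> exec O c2 s1 s2 t2 m2 o2 ->
      exec O (Seq c1 c2) s s2 (t1 + t2) (maxn m1 m2) (o1 ++ delay t1 o2)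
  | ExecIfTrue e c1 c2 s s' t m o :
      eval s e <> Leaf -> exec O c1 s s' t m o ->
      exec O (If e c1 c2) s s' ((etime e).+1 + t) (maxn (espace s e) m)
        (delay (etime e).+1 o)
  | ExecIfFalse e c1 c2 s s' t m o :
      eval s e = Leaf -> exec O c2 s s' t m o ->
      exec O (If e c1 c2) s s' ((etime e).+1 + t) (maxn (espace s e) m)
        (delay (etime e).+1 o)
  | ExecWhileTrue e c s s1 s2 t1 t2 m1 m2 o1 o2 :
      eval s e <> Leaf ->
      exec O c s s1 t1 m1 o1 -> exec O (While e c) s1 s2 t2 m2 o2 ->
      exec O (While e c) s s2 ((etime e).+1 + (t1 + t2))
        (maxn (espace s e) (maxn m1 m2))
        (delay (etime e).+1 (o1 ++ delay t1 o2))
  | ExecWhileFalse e c s :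
      eval s e = Leaf ->
      exec O (While e c) s s (etime e).+1 (espace s e) [::]
  | ExecQuery x e s :
      let v := O (eval s e) in
      let s' := set_var s x v in
      exec O (Query x e) s s' ((etime e).+1 + otime O)
        (maxn (espace s e + ospace O + tsize v) (ssize s')) [::]
  | ExecCall x c e s s1 t m o :
      exec O c [:: eval s e] s1 t m o ->
      let s' := set_var s x (get s1 0) in
      exec O (Call x c e) s s' ((etime e).+1 + t)
        (maxn (ssize s + m) (ssize s')) (delay (etime e).+1 o)
  | ExecOutput e s :
      let t := (etime e).+1 + tsize (eval s e) in
      exec O (Output e) s s t (espace s e) [:: (t, eval s e)].

Definition enc_bool (b : bool) : tree := if b then Node Leaf Leaf else Leaf.

(* Unary, so that encoding sizes are polynomial in the size of the ground set. *)
Definition enc_nat (k : nat) : tree := iter k (Node Leaf) Leaf.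

Definition enc_seq (T : Type) (enc : T -> tree) (s : seq T) : tree :=
  foldr (fun x => Node (enc x)) Leaf s.

Definition enc_elts n (s : seq 'I_n) : tree :=
  enc_seq (fun i => enc_nat (nat_of_ord i)) s.

Definition enc_edges n (s : seq ('I_n * 'I_n)) : tree :=
  enc_seq (fun p : 'I_n * 'I_n => Node (enc_nat p.1) (enc_nat p.2)) s.

(* Sets are represented by lists without repetition, in any order, and edges by
   either of their two orderings. *)
Definition lists_elts (S : finType) (s : seq S) (X : {set S}) : bool :=
  uniq s && ([set x in s] == X).

Definition edge_of (S : finType) (p : S * S) : {set S} := [set p.1; p.2].

Definition lists_edges (S : finType) (s : seq (S * S)) (F : {set {set S}}) :
    bool :=
  uniq (map (@edge_of S) s) && ([set e in map (@edge_of S) s] == F).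

(* The ground set is labelled 0, ..., n-1.  Answers to queries that do not
   encode a set of elements are unconstrained. *)
Record instance := Instance {
  gsize : nat;
  mat : matroid 'I_gsize;
  gra : graph 'I_gsize;
  orc : oracle;
  orcP : forall s : seq 'I_gsize,
    orc (enc_elts s) = enc_bool ([set x in s] \in indep mat)
}.

Definition nQtime (J : instance) : nat := gsize J + otime (orc J).
Definition nQspace (J : instance) : nat := gsize J + ospace (orc J).

Definition peval (p : {poly nat}) (k : nat) : nat := (p.[k])%R.

(* One program with one pair of polynomial bounds must work for every instance
   in the class C: for a single finite instance, "polynomial" has no content. *)
Definition solvable (C : instance -> Prop)
    (minor : forall S : finType, {set {set S}} -> {set S} -> {set {set S}})
    (region : forall S : finType, {set S} -> {set S}) : Prop :=
  exists (c : cmd) (tp sp : {poly nat}), forall J : instance, C J ->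
  forall (X : {set 'I_(gsize J)}) (H : {set {set 'I_(gsize J)}}),
    H \subset induced (edges (gra J)) (region _ X) ->
  forall (Es Hs : seq ('I_(gsize J) * 'I_(gsize J))) (Xs : seq 'I_(gsize J)),
    lists_edges Es (edges (gra J)) -> lists_elts Xs X -> lists_edges Hs H ->
  let input := Node (enc_nat (gsize J)) (Node (enc_edges Es)
                 (Node (enc_elts Xs) (enc_edges Hs))) in
  exists s t m,
    [/\ exec (orc J) c [:: input] s t m [::],
        exists M Ms, [/\ maximum_matching (minor _ (indep (mat J)) X) H M,
          lists_edges Ms M & get s 0 = enc_edges Ms],
        t <= peval tp (nQtime J)
      & m <= peval sp (nQspace J)].

Definition tractable (C : instance -> Prop) : Prop :=
  [/\ solvable C restrict (fun _ X => X),
      solvable C delete (fun _ X => ~: X)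
    & solvable C contract (fun _ X => ~: X)].

Definition solutions (J : instance) : {set {set {set 'I_(gsize J)}}} :=
  [set M | maximal_matching (indep (mat J)) (edges (gra J)) M].

Definition outputs_solutions_in_order (J : instance) (o : trace) : Prop :=
  exists (Ms : seq {set {set 'I_(gsize J)}})
         (L : seq (seq ('I_(gsize J) * 'I_(gsize J)))),
    [/\ uniq Ms, Ms =i solutions J,
        sorted (fun A B : {set {set 'I_(gsize J)}} => #|B| <= #|A|) Ms,
        all2 (@lists_edges _) L Ms
      & [seq p.2 | p <- o] = [seq enc_edges l | l <- L]].

Definition linear_incremental (o : trace) (N b : nat) : Prop :=
  forall i, i <= N -> i <= count (fun p => p.1 <= i * b) o.

(* Main.v *)
(** Fix a maximum matching R.  From a maximal matching M with fewer edges than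
    R, exchanging an edge of M outside R for an edge of R and, if the result is
    not maximal, adding one more edge gives a maximal matching that is larger, or
    as large with more edges in R.  Choosing one such matching as the parent of M
    organizes the maximal matchings into trees rooted at the maximum ones.  Parent
    and child differ in at most three edges, so children are found by inspection.
    The maximum matchings themselves are explored by Lawler's partition: the ones
    agreeing with a given one on decided edges are split according to the first
    undecided edge on which they differ, and contracting the vertices of the edges
    already taken tells whether a part is empty.

    A depth-first search with an explicit worklist visits one new maximal
    matching per step, and its worklist stays polynomial because depth and
    branching are.  The search is repeated for k = |R|, ..., 0, pruned at size k
    and printing only the matchings of size k.  The larger matchings visited along
    the way have been printed before, so the i-th output comes within i visits of
    each of the at most |R| + 1 searches. *)

From mathcomp Require Import all_boot ssralg poly zify.
From Stdlib Require Import IndefiniteDescription.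
Require Import Defs.

Set Implicit Arguments.
Unset Strict Implicit.
Unset Printing Implicit Defensive.

(** * Polynomially bounded programs *)

(** Repeating the search for each k replaces a record of the matchings already printed, which would
    take exponential space. One tree serves for every k: sizes never decrease towards the root, so
    pruning at size k removes whole subtrees and keeps all ancestors of a matching of size at least
    k. The depth is polynomial because size and overlap with R, read as two digits in base |E| + 1,
    increase from a matching to its parent. That each matching is visited exactly once is shown by
    counting: its multiplicity in the preorder of a subtree and the indicator [reg] satisfy the same
    recursion, which comes from [anc_kids] inside the trees and from [lawler_agree] among their
    roots. On the machine side the obstacle is that iterating a polynomial-time step can build
    exponentially large data. Programs are therefore composed from operations that carry a bound on
    the size of the result, and a loop needs a bound on all its intermediate values. The whole
    search is not a polynomial computation, so only its single step is obtained in this way; the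
    outer loops are explicit, and their trace is followed visit by visit. *)

Definition polyb (f : nat -> nat) : Prop :=
  {homo f : x y / x <= y} /\ exists d, forall k, f k <= (k + 2) ^ d.

(** The base [k + 2] is at least 2, so [c < 2 ^ c] absorbs a constant into the exponent even at
    [k = 0]. *)
Lemma polyb_const c : polyb (fun=> c).
Proof.
split=> //; exists c => k.
have [->//|c0] := posnP c.
by apply: leq_trans (ltnW (ltn_expl c (ltnSn 1))) _; rewrite leq_exp2r //; lia.
Qed.

Lemma polyb_id : polyb (fun k => k).
Proof. by split=> //; exists 1 => k; rewrite expn1; lia. Qed.

Lemma polyb_add f g : polyb f -> polyb g -> polyb (fun k => f k + g k).
Proof.
move=> [mf [a ha]] [mg [b hb]]; split=> [x y xy|]; first exact: leq_add (mf _ _ xy) (mg _ _ xy).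
exists (a + b).+1 => k; rewrite expnS expnD.
have := ha k; have := hb k.
have : 0 < (k + 2) ^ a by rewrite expn_gt0; lia.
have : 0 < (k + 2) ^ b by rewrite expn_gt0; lia.
nia.
Qed.

Lemma polyb_mul f g : polyb f -> polyb g -> polyb (fun k => f k * g k).
Proof.
move=> [mf [a ha]] [mg [b hb]]; split=> [x y xy|]; first exact: leq_mul (mf _ _ xy) (mg _ _ xy).
by exists (a + b) => k; rewrite expnD leq_mul.
Qed.

Lemma polyb_comp f g : polyb f -> polyb g -> polyb (fun k => f (g k)).
Proof.
move=> [mf [a ha]] [mg [b hb]]; split=> [x y xy|]; first exact: mf (mg _ _ xy).
(* The exponent comes from [g k + 2 <= (k + 2) ^ b.+2]. *)
exists (b.+2 * a) => k; apply: leq_trans (ha _) _.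
rewrite expnM; have [->//|a0] := posnP a.
rewrite leq_exp2r //; have := hb k; rewrite !expnS.
have : 0 < (k + 2) ^ b by rewrite expn_gt0; lia.
nia.
Qed.

Lemma polyb_le f x y : polyb f -> x <= y -> f x <= f y.
Proof. by case=> mf _; exact: mf. Qed.

Ltac polyb :=
  repeat first
    [ assumption | exact: polyb_const | exact: polyb_id
    | apply: polyb_add | apply: polyb_mul
    | match goal with H : polyb ?f |- polyb (fun k => ?f _) => apply: (polyb_comp H) end ].

Lemma polyb_peval (p : {poly nat}) : polyb (peval p).
Proof.
rewrite /peval; elim/poly_ind: p => [|p c [mp [d hd]]].
  by split=> [x y _|]; [|exists 0 => k]; rewrite !horner0.
have h k : ((p * 'X + c%:P).[k])%R = p.[k]%R * k + c by rewrite hornerMXaddC.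
suff [m [e he]] : polyb (fun k => p.[k]%R * k + c).
  by split=> [x y xy|]; [|exists e => k]; rewrite !h; [exact: m|exact: he].
have hp : polyb (fun k => p.[k]%R) by split=> //; exists d.
by polyb.
Qed.

Lemma polyb_poly f : polyb f -> exists p : {poly nat}, forall k, f k <= peval p k.
Proof.
case=> _ [d hd]; exists (('X + 2%:P) ^+ d)%R => k; apply: leq_trans (hd k) _.
rewrite /peval; elim: d {hd} => [|d IH]; first by rewrite expn0 GRing.expr0 hornerC.
by rewrite GRing.exprS hornerM hornerD hornerX hornerC expnS leq_mul2l IH orbT.
Qed.

(** * Costs of silent procedure calls *)

Arguments tsize : simpl never.

Lemma tsizeN l r : tsize (Node l r) = (tsize l + tsize r).+1.
Proof. by []. Qed.

Lemma exec_call0 O x c e s s1 v t m :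
  exec O c [:: eval s e] s1 t m [::] -> get s1 0 = v ->
  exec O (Call x c e) s (set_var s x v) ((etime e).+1 + t)
    (maxn (ssize s + m) (ssize (set_var s x v))) [::].
Proof. by move=> h <-; exact: (ExecCall x h). Qed.

Lemma exec_seq0 O c1 c2 s s1 s2 t1 t2 m1 m2 :
  exec O c1 s s1 t1 m1 [::] -> exec O c2 s1 s2 t2 m2 [::] ->
  exec O (Seq c1 c2) s s2 (t1 + t2) (maxn m1 m2) [::].
Proof. exact: ExecSeq. Qed.

Lemma exec_assign0 O x e s :
  exec O (Assign x e) s (set_var s x (eval s e)) (etime e).+1
    (maxn (espace s e) (ssize (set_var s x (eval s e)))) [::].
Proof. exact: ExecAssign. Qed.

(** A silent run in the one-variable store that [Call] creates, with upper bounds in place of exact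
    costs. *)
Definition runs O c x y T S : Prop :=
  exists s t m,
    [/\ exec O c [:: x] s t m [::], get s 0 = y, t <= T & m <= S].

Lemma runs_expr O e x :
  runs O (Assign 0 e) x (eval [:: x] e) (etime e + 1)
    (tsize x + tsize (eval [:: x] e)).
Proof.
do 3 eexists; split; first exact: exec_assign0; rewrite ?addn1 //.
rewrite /espace /ssize /=; lia.
Qed.

Lemma runs_comp O c1 c2 i x y z T1 S1 T2 S2 :
  runs O c1 (Node i x) y T1 S1 -> runs O c2 (Node i y) z T2 S2 ->
  runs O (Seq (Call 1 c1 (Var 0)) (Call 0 c2 (ECons (EHd (Var 0)) (Var 1))))
    (Node i x) z (T1 + T2 + 10)
    (tsize i + tsize x + tsize y + tsize z + S1 + S2 + 10).
Proof.
move=> [s1 [t1 [m1 [e1 v1 b1 d1]]]] [s2 [t2 [m2 [e2 v2 b2 d2]]]].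
do 3 eexists; split.
- apply: exec_seq0; first by apply: exec_call0; [exact: e1|exact: v1].
  by apply: exec_call0; [exact: e2|exact: v2].
- by [].
- rewrite /=; lia.
- rewrite /ssize /set_var /= ?tsizeN; lia.
Qed.

Lemma runs_pair O c1 c2 x y z T1 S1 T2 S2 :
  runs O c1 x y T1 S1 -> runs O c2 x z T2 S2 ->
  runs O (Seq (Call 1 c1 (Var 0))
    (Seq (Call 2 c2 (Var 0)) (Assign 0 (ECons (Var 1) (Var 2)))))
    x (Node y z) (T1 + T2 + 20)
    (tsize x + 2 * (tsize y + tsize z) + S1 + S2 + 10).
Proof.
move=> [s1 [t1 [m1 [e1 v1 b1 d1]]]] [s2 [t2 [m2 [e2 v2 b2 d2]]]].
do 3 eexists; split.
- apply: exec_seq0; first by apply: exec_call0; [exact: e1|exact: v1].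
  apply: exec_seq0; first by apply: exec_call0; [exact: e2|exact: v2].
  exact: exec_assign0.
- by [].
- rewrite /=; lia.
- rewrite /espace /ssize /set_var /= ?tsizeN; lia.
Qed.

Lemma runs_case_nil O cs cf ch x y T1 S1 T2 S2 :
  runs O cs x Leaf T1 S1 -> runs O cf x y T2 S2 ->
  runs O (Seq (Call 1 cs (Var 0)) (If (Var 1)
    (Call 0 ch (ECons (EHd (Var 0)) (ECons (ETl (Var 0)) (Var 1)))) (Call 0 cf (Var 0))))
    x y (T1 + T2 + 10) (tsize x + tsize y + S1 + S2 + 10).
Proof.
move=> [s1 [t1 [m1 [e1 v1 b1 d1]]]] [s2 [t2 [m2 [e2 v2 b2 d2]]]].
do 3 eexists; split.
- apply: exec_seq0; first by apply: exec_call0; [exact: e1|exact: v1].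
  apply: (@ExecIfFalse _ _ _ _ _ _ _ _ [::]); first by [].
  by apply: exec_call0; [exact: e2|exact: v2].
- by [].
- rewrite /=; lia.
- rewrite /espace /ssize /set_var /= ?tsizeN; change (tsize Leaf) with 1; lia.
Qed.

Lemma runs_case_cons O cs cf ch i x l r y T1 S1 T2 S2 :
  runs O cs (Node i x) (Node l r) T1 S1 ->
  runs O ch (Node i (Node x (Node l r))) y T2 S2 ->
  runs O (Seq (Call 1 cs (Var 0)) (If (Var 1)
    (Call 0 ch (ECons (EHd (Var 0)) (ECons (ETl (Var 0)) (Var 1)))) (Call 0 cf (Var 0))))
    (Node i x) y (T1 + T2 + 20)
    (tsize i + tsize x + tsize y + 3 * (tsize l + tsize r) + S1 + S2 + 10).
Proof.
move=> [s1 [t1 [m1 [e1 v1 b1 d1]]]] [s2 [t2 [m2 [e2 v2 b2 d2]]]].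
do 3 eexists; split.
- apply: exec_seq0; first by apply: exec_call0; [exact: e1|exact: v1].
  apply: (@ExecIfTrue _ _ _ _ _ _ _ _ [::]); first by [].
  by apply: exec_call0; [exact: e2|exact: v2].
- by [].
- rewrite /=; lia.
- rewrite /espace /ssize /set_var /= ?tsizeN; lia.
Qed.

Lemma runs_le O c x y T S T' S' :
  runs O c x y T S -> T <= T' -> S <= S' -> runs O c x y T' S'.
Proof.
move=> [s [t [m [e v b d]]]] hT hS; exists s, t, m; split=> //.
  exact: leq_trans hT.
exact: leq_trans hS.
Qed.

(** Variable 0 holds the instance and the context, variable 1 the accumulator, variable 2 the rest
    of the list. *)
Definition fold_body ch : cmd :=
  Seq (Call 1 ch (ECons (EHd (Var 0))
        (ECons (ECons (ETl (Var 0)) (Var 1)) (EHd (Var 2)))))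
    (Assign 2 (ETl (Var 2))).

(** The cost of the body is assumed only at accumulators that arise from a prefix of [s]; over
    arbitrary accumulators there need not be a uniform bound. *)
Lemma exec_fold (A B : Type) (ea : A -> tree) (eb : B -> tree) (h : A -> B -> A)
    O ch i g a s T S Z :
  (forall s1 x s2, s = s1 ++ x :: s2 ->
    runs O ch (Node i (Node (Node g (ea (foldl h a s1))) (eb x)))
      (ea (foldl h a (rcons s1 x))) T S) ->
  (forall s1 s2, s = s1 ++ s2 -> tsize (ea (foldl h a s1)) <= Z) ->
  exists t m,
    [/\ exec O (While (Var 2) (fold_body ch))
          [:: Node i g; ea a; enc_seq eb s]
          [:: Node i g; ea (foldl h a s); Leaf] t m [::],
        t <= size s * (T + 20) + 2
      & m <= tsize i + tsize g + 2 * Z + 3 * tsize (enc_seq eb s) + S + 10].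
Proof.
elim: s a => [|x s IH] a hr hZ.
  exists 2, (tsize i + tsize g + tsize (ea a) + 3); split; [|by rewrite mul0n|].
    have := @ExecWhileFalse O (Var 2) (fold_body ch) [:: Node i g; ea a; Leaf] erefl.
    congr exec; rewrite /espace /ssize /= tsizeN; change (tsize Leaf) with 1; lia.
  by have /= := hZ [::] [::] erefl; lia.
have [s1 [t1 [m1 [e1 v1 b1 d1]]]] := hr [::] x s erefl.
have [||t2 [m2 [e2 b2 d2]]] := IH (h a x).
- by move=> s2 y s3 e; apply: (hr (x :: s2) y s3); rewrite e.
- by move=> s2 s3 e; apply: (hZ (x :: s2) s3); rewrite e.
have z0 := hZ [::] (x :: s) erefl.
have z1 := hZ [:: x] s erefl.
do 2 eexists; split.
- apply: (@ExecWhileTrue _ _ _ _ _ _ _ _ _ _ [::] [::]); first by [].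
    apply: exec_seq0; first by apply: exec_call0; [exact: e1|exact: v1].
    exact: exec_assign0.
  exact: e2.
- rewrite /=; lia.
- rewrite /espace /ssize /set_var /= ?tsizeN in z0 z1 d2 *; lia.
Qed.

Lemma runs_fold (A B : Type) (ea : A -> tree) (eb : B -> tree) (h : A -> B -> A)
    O ca cs ch i g a s T1 S1 T2 S2 T3 S3 Z :
  runs O ca (Node i g) (ea a) T1 S1 ->
  runs O cs (Node i g) (enc_seq eb s) T2 S2 ->
  (forall s1 x s2, s = s1 ++ x :: s2 ->
    runs O ch (Node i (Node (Node g (ea (foldl h a s1))) (eb x)))
      (ea (foldl h a (rcons s1 x))) T3 S3) ->
  (forall s1 s2, s = s1 ++ s2 -> tsize (ea (foldl h a s1)) <= Z) ->
  runs O (Seq (Call 1 ca (Var 0)) (Seq (Call 2 cs (Var 0))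
    (Seq (While (Var 2) (fold_body ch)) (Assign 0 (Var 1)))))
    (Node i g) (ea (foldl h a s))
    (T1 + T2 + size s * (T3 + 20) + 20)
    (2 * (tsize i + tsize g) + 4 * Z + 4 * tsize (enc_seq eb s) + S1 + S2 + S3 + 20).
Proof.
move=> [s1 [t1 [m1 [e1 v1 b1 d1]]]] [s2 [t2 [m2 [e2 v2 b2 d2]]]] hr hZ.
have [t3 [m3 [e3 b3 d3]]] := exec_fold hr hZ.
have z0 := hZ [::] s erefl; have z1 := hZ s [::] (esym (cats0 s)).
do 3 eexists; split.
- apply: exec_seq0; first by apply: exec_call0; [exact: e1|exact: v1].
  apply: exec_seq0; first by apply: exec_call0; [exact: e2|exact: v2].
  apply: exec_seq0; first exact: e3.
  exact: exec_assign0.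
- by [].
- rewrite /=; lia.
- rewrite /espace /ssize /set_var /= ?tsizeN in z0 z1 *; change (tsize Leaf) with 1; lia.
Qed.

Lemma runs_query O cs x q T S :
  runs O cs x q T S ->
  runs O (Seq (Call 1 cs (Var 0)) (Query 0 (Var 1))) x (O q)
    (T + otime O + 10) (tsize x + 2 * tsize q + 2 * tsize (O q) + S + ospace O + 10).
Proof.
move=> [s1 [t1 [m1 [e1 v1 b1 d1]]]].
do 3 eexists; split.
- apply: exec_seq0; first by apply: exec_call0; [exact: e1|exact: v1].
  exact: ExecQuery.
- by [].
- rewrite /=; lia.
- rewrite /espace /ssize /set_var /=; lia.
Qed.

Lemma size_enc_seq (T : Type) (e : T -> tree) s : size s < tsize (enc_seq e s).
Proof. by elim: s => //= x s IH; rewrite tsizeN; lia. Qed.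

(** * Programs that are uniform in the instance *)

Section Comp.
Variable C : instance -> Prop.

Record world := World {
  winst :> instance;
  wC : C winst;
  wedges : seq ('I_(gsize winst) * 'I_(gsize winst));
  wedgesP : lists_edges wedges (edges (gra winst))
}.

(* [enc] identifies [x :: s] with [(x, s)], a boolean [b] with [nseq b false] and
   a vertex [i] with [nseq i false]; see [comp_cast]. *)
Inductive ty := tB | tV | tP of ty & ty | tL of ty.

Fixpoint El (w : world) (a : ty) : eqType :=
  match a with
  | tB => bool
  | tV => 'I_(gsize w)
  | tP b c => (El w b * El w c)%type
  | tL b => seq (El w b)
  end.

Fixpoint enc (w : world) (a : ty) : El w a -> tree :=
  match a with
  | tB => enc_bool
  | tV => fun i => enc_nat (nat_of_ord i)
  | tP b c => fun p => Node (enc p.1) (enc p.2)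
  | tL b => enc_seq (@enc w b)
  end.

Definition inp (w : world) : tree :=
  Node (enc_nat (gsize w)) (enc_edges (wedges w)).

Definition ein (w : world) (a : ty) (g : El w a) : tree := Node (inp w) (enc g).

Lemma tsize_ein w a g : tsize (@ein w a g) = (tsize (inp w) + tsize (enc g)).+1.
Proof. by []. Qed.

(* Programs receive the instance together with their argument.  P bounds the
   time, the space and the size of the result. *)
Definition comp (a b : ty) (f : forall w, El w a -> El w b) : Prop :=
  exists c P, polyb P /\ forall (w : world) (g : El w a),
    [/\ runs (orc w) c (ein g) (enc (f w g))
          (P (tsize (ein g) + otime (orc w)))
          (P (tsize (ein g) + ospace (orc w)))
      & tsize (enc (f w g)) <= P (tsize (ein g))].

Lemma comp_expr (a b : ty) (f : forall w, El w a -> El w b) e P :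
  polyb P -> (forall w g, eval [:: ein g] e = enc (f w g)) ->
  (forall w g, tsize (enc (f w g)) <= P (tsize (@ein w a g))) -> comp f.
Proof.
move=> hP he hs.
exists (Assign 0 e), (fun k => etime e + 1 + k + P k + P k); split; first by polyb.
move=> w g; have := hs w g => hg; split; last by lia.
rewrite -he; apply: runs_le (runs_expr _ _ _) _ _; rewrite ?he; first by lia.
have := polyb_le hP (leq_addr (ospace (orc w)) (tsize (ein g))); lia.
Qed.

Lemma comp_comp (a b c : ty) (f : forall w, El w a -> El w b) (h : forall w, El w b -> El w c) :
  comp f -> comp h -> comp (fun w g => h w (f w g)).
Proof.
move=> [cf [Pf [hPf hf]]] [ch [Ph [hPh hh]]].
exists (Seq (Call 1 cf (Var 0)) (Call 0 ch (ECons (EHd (Var 0)) (Var 1)))).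
exists (fun k => 20 + k + 2 * Pf k + 2 * Ph (k + Pf k)); split; first by polyb.
move=> w g; have [r1 o1] := hf w g; have [r2 o2] := hh w (f w g).
move: (tsize_ein g) (tsize_ein (f w g)) => zg zf.
have Hb Q : Ph (tsize (ein (f w g)) + Q) <= Ph (tsize (ein g) + Q + Pf (tsize (ein g) + Q)).
  by apply: (polyb_le hPh); have := polyb_le hPf (leq_addr Q (tsize (ein g))); lia.
split; last by have := Hb 0; rewrite !addn0; lia.
apply: runs_le (runs_comp r1 r2) _ _; first by have := Hb (otime (orc w)); lia.
have := polyb_le hPf (leq_addr (ospace (orc w)) (tsize (ein g))).
have := polyb_le hPh (leq_addr (ospace (orc w)) (tsize (ein (f w g)))).
have := Hb (ospace (orc w)); lia.
Qed.

Lemma comp_pair (a b c : ty) (f : forall w, El w a -> El w b) (h : forall w, El w a -> El w c) :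
  comp f -> comp h -> @comp a (tP b c) (fun w g => (f w g, h w g)).
Proof.
move=> [cf [Pf [hPf hf]]] [ch [Ph [hPh hh]]].
do 2 eexists; last (split; last (move=> w g; have [r1 o1] := hf w g; have [r2 o2] := hh w g;
  split; first (apply: runs_le (runs_pair r1 r2) _ _))).
- instantiate (1 := fun k => 20 + k + 3 * Pf k + 3 * Ph k); by polyb.
- lia.
- have := polyb_le hPf (leq_addr (ospace (orc w)) (tsize (ein g))).
  have := polyb_le hPh (leq_addr (ospace (orc w)) (tsize (ein g))); lia.
- by rewrite [enc _]/= tsizeN; lia.
Qed.

Lemma tsize_enc_pair w (a b : ty) (p : El w (tP a b)) :
  tsize (enc p) = (tsize (enc p.1) + tsize (enc p.2)).+1.
Proof. by []. Qed.

Lemma tsize_enc_cons w (a : ty) x (s : El w (tL a)) :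
  tsize (enc (x :: s : El w (tL a))) = (tsize (enc x) + tsize (enc s)).+1.
Proof. by []. Qed.

(** A program sees only codes, so it also serves for every other type whose values have the same
    codes. *)
Lemma comp_cast (a a' b b' : ty) (f : forall w, El w a -> El w b)
    (f' : forall w, El w a' -> El w b') (i : forall w, El w a' -> El w a) :
  (forall w g, enc (i w g) = enc g) -> (forall w g, enc (f' w g) = enc (f w (i w g))) ->
  comp f -> comp f'.
Proof.
move=> hi ho [c [P [hP h]]]; exists c, P; split=> // w g.
by move: (h w (i w g)); rewrite /ein hi -ho.
Qed.

Lemma comp_ext (a b : ty) (f f' : forall w, El w a -> El w b) :
  (forall w g, f' w g = f w g) -> comp f -> comp f'.
Proof. by move=> e; apply: (@comp_cast _ _ _ _ _ _ (fun=> id)) => // w g; rewrite e. Qed.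

Lemma comp_id (a : ty) : @comp a a (fun w g => g).
Proof. by apply: (@comp_expr _ _ _ (ETl (Var 0)) id polyb_id) => // w g; rewrite tsize_ein ?tsize_enc_pair; lia. Qed.

Lemma comp_fst (a b c : ty) (f : forall w, El w a -> El w (tP b c)) :
  comp f -> @comp a b (fun w g => (f w g).1).
Proof.
move=> hf; apply: (comp_comp (h := fun w (p : El w (tP b c)) => p.1) hf).
by apply: (@comp_expr _ _ _ (EHd (ETl (Var 0))) id polyb_id) => // w g; rewrite tsize_ein ?tsize_enc_pair; lia.
Qed.

Lemma comp_snd (a b c : ty) (f : forall w, El w a -> El w (tP b c)) :
  comp f -> @comp a c (fun w g => (f w g).2).
Proof.
move=> hf; apply: (comp_comp (h := fun w (p : El w (tP b c)) => p.2) hf).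
by apply: (@comp_expr _ _ _ (ETl (ETl (Var 0))) id polyb_id) => // w g; rewrite tsize_ein ?tsize_enc_pair; lia.
Qed.

Lemma comp_bool (a : ty) (v : bool) : @comp a tB (fun w g => v).
Proof.
apply: (@comp_expr _ _ _ (if v then ECons ENil ENil else ENil) (fun=> 3) (polyb_const 3)).
  by case: v.
by case: v.
Qed.

Lemma comp_nil (a b : ty) : @comp a (tL b) (fun w g => [::]).
Proof. exact: (@comp_expr _ _ _ ENil (fun=> 3) (polyb_const 3)). Qed.

Definition tE := tP tV tV.
Definition tM := tL tE.

Lemma comp_edges (a : ty) : @comp a tM (fun w g => wedges w).
Proof.
apply: (@comp_expr _ _ _ (ETl (EHd (Var 0))) id polyb_id) => // w g.
have e : tsize (inp w) =
  (tsize (enc_nat (gsize w)) + tsize (enc (wedges w : El w tM))).+1 by [].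
rewrite tsize_ein e /=; lia.
Qed.

Lemma comp_cons (a b : ty) (f : forall w, El w a -> El w b) (h : forall w, El w a -> El w (tL b)) :
  comp f -> comp h -> @comp a (tL b) (fun w g => f w g :: h w g).
Proof. by move=> hf hh; apply: (@comp_cast _ _ _ _ _ _ (fun=> id)) (comp_pair hf hh). Qed.

Lemma comp_case (a b c : ty) (s : forall w, El w a -> seq (El w b))
    (f : forall w, El w a -> El w c) (h : forall w, El w a -> El w b -> seq (El w b) -> El w c) :
  @comp a (tL b) s -> comp f ->
  @comp (tP a (tP b (tL b))) c (fun w p => h w p.1 p.2.1 p.2.2) ->
  comp (fun w g => match s w g with [::] => f w g | x :: s' => h w g x s' end).
Proof.
move=> [cs [Ps [hPs hs]]] [cf [Pf [hPf hf]]] [ch [Ph [hPh hh]]].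
exists (Seq (Call 1 cs (Var 0)) (If (Var 1)
  (Call 0 ch (ECons (EHd (Var 0)) (ECons (ETl (Var 0)) (Var 1)))) (Call 0 cf (Var 0)))).
(* The [+ 1] in the argument of [Ph] is the [Node] that joins the context to the cell of the
   list. *)
exists (fun k => 20 + k + 4 * Ps k + 2 * Pf k + 2 * Ph (k + Ps k + 1)).
split; first by polyb.
move=> w g; have [r1 o1] := hs w g.
have Hs := polyb_le hPs (leq_addr (ospace (orc w)) (tsize (ein g))).
case E: (s w g) => [|x s'] in r1 o1 *.
  have [r2 o2] := hf w g; split; last by lia.
  apply: runs_le (runs_case_nil _ r1 r2) _ _; first by lia.
  have := polyb_le hPf (leq_addr (ospace (orc w)) (tsize (ein g))); lia.
pose q : El w (tP a (tP b (tL b))) := (g, (x, s')).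
have [r2 o2'] := hh w q.
have o2 : tsize (enc (h w g x s')) <= Ph (tsize (ein q)) := o2'.
have zs : tsize (enc (x :: s' : El w (tL b))) = (tsize (enc x) + tsize (enc (s' : El w (tL b)))).+1 by [].
have zq : tsize (enc q) = (tsize (enc g) + tsize (enc (x :: s' : El w (tL b)))).+1 by [].
move: (tsize_ein g) (tsize_ein q) => zg zf.
have Hb Q : Ph (tsize (ein q) + Q) <= Ph (tsize (ein g) + Q + Ps (tsize (ein g) + Q) + 1).
  by apply: (polyb_le hPh); have := polyb_le hPs (leq_addr Q (tsize (ein g))); lia.
split; last by have := Hb 0; rewrite !addn0; lia.
apply: runs_le (@runs_case_cons _ _ cf _ (inp w) (enc g) (enc x)
  (enc (s' : El w (tL b))) (enc (h w g x s')) _ _ _ _ r1 r2) _ _; first by have := Hb (otime (orc w)); lia.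
have := polyb_le hPh (leq_addr (ospace (orc w)) (tsize (ein q))).
have := Hb (ospace (orc w)); lia.
Qed.

(** The bound [Z] on all partial folds cannot come from the bound on [h]: iterating a step that
    doubles the accumulator is exponential. *)
Lemma comp_foldl (a b c : ty) (f : forall w, El w a -> El w b)
    (s : forall w, El w a -> seq (El w c)) (h : forall w, El w a -> El w b -> El w c -> El w b) :
  comp f -> @comp a (tL c) s ->
  @comp (tP (tP a b) c) b (fun w p => h w p.1.1 p.1.2 p.2) ->
  (exists2 Z, polyb Z & forall w g s1 s2, s w g = s1 ++ s2 ->
     tsize (enc (foldl (h w g) (f w g) s1)) <= Z (tsize (ein g))) ->
  comp (fun w g => foldl (h w g) (f w g) (s w g)).
Proof.
move=> [cf [Pf [hPf hf]]] [cs [Ps [hPs hs]]] [ch [Ph [hPh hh]]] [Z hPZ hZ].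
exists (Seq (Call 1 cf (Var 0)) (Seq (Call 2 cs (Var 0))
    (Seq (While (Var 2) (fold_body ch)) (Assign 0 (Var 1))))).
exists (fun k => 20 + 2 * k + 5 * Z k + Pf k + 5 * Ps k
  + (Ps k + 1) * (Ph (k + Z k + Ps k + 2) + 20)).
split; first by polyb.
move=> w g; have [r1 o1] := hf w g; have [r2 o2] := hs w g.
have hx s1 x s2 : s w g = s1 ++ x :: s2 -> tsize (enc x) <= tsize (enc (s w g : El w (tL c))).
  move=> ->; elim: s1 => [|y s1 IH]; first by rewrite tsize_enc_cons; lia.
  by rewrite [_ ++ _]/= tsize_enc_cons; lia.
set M := tsize (ein g) + Z (tsize (ein g)) + Ps (tsize (ein g)) + 2.
have hr s1 x s2 : s w g = s1 ++ x :: s2 ->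
  runs (orc w) ch (Node (inp w) (Node (Node (enc g)
      (enc (foldl (h w g) (f w g) s1))) (enc x)))
    (enc (foldl (h w g) (f w g) (rcons s1 x)))
    (Ph (M + otime (orc w))) (Ph (M + ospace (orc w))).
  move=> e; pose q : El w (tP (tP a b) c) := ((g, foldl (h w g) (f w g) s1), x).
  have [r3 _] := hh w q; rewrite foldl_rcons.
  have zq : tsize (ein q) <= M.
    rewrite tsize_ein !tsize_enc_pair.
    have := hZ _ _ _ _ e; have := hx _ _ _ e; move: o2 (tsize_ein g).
    by rewrite /M /q /=; lia.
  by apply: runs_le r3 _ _; apply: (polyb_le hPh); lia.
have Hz := hZ w g (s w g) [::] (esym (cats0 _)).
split; last by lia.
have hM Q : Ph (M + Q) <= Ph (tsize (ein g) + Q + Z (tsize (ein g) + Q) + Ps (tsize (ein g) + Q) + 2).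
  apply: (polyb_le hPh); have := polyb_le hPZ (leq_addr Q (tsize (ein g))).
  by have := polyb_le hPs (leq_addr Q (tsize (ein g))); rewrite /M; lia.
have zs := size_enc_seq (@enc w c) (s w g).
have o2' : tsize (enc_seq (@enc w c) (s w g)) <= Ps (tsize (ein g)) := o2.
have := runs_fold (ea := @enc w b) (eb := @enc w c) r1 r2 hr (fun s1 s2 e => hZ w g s1 s2 e).
move=> r; apply: runs_le r _ _.
  have := hM (otime (orc w)).
  have hs' := polyb_le hPs (leq_addr (otime (orc w)) (tsize (ein g))).
  move=> hM'; have : size (s w g) <= Ps (tsize (ein g) + otime (orc w)) + 1 by lia.
  move/leq_mul => /(_ _ _ (leq_add hM' (leqnn 20))); lia.
have hM' := hM (ospace (orc w)); move: (tsize_ein g).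
have := leq_mul (leq_addl (Ps (tsize (ein g) + ospace (orc w))) 1) (leq_add hM' (leqnn 20)).
have := polyb_le hPs (leq_addr (ospace (orc w)) (tsize (ein g))).
have := polyb_le hPZ (leq_addr (ospace (orc w)) (tsize (ein g))).
lia.
Qed.

Lemma comp_query (a : ty) (f : forall w, El w a -> seq 'I_(gsize w)) :
  @comp a (tL tV) f ->
  @comp a tB (fun w g => [set x in f w g] \in indep (mat w)).
Proof.
move=> [c [P [hP hf]]].
exists (Seq (Call 1 c (Var 0)) (Query 0 (Var 1))), (fun k => 20 + 2 * k + 4 * P k).
split; first by polyb.
move=> w g; have [r o] := hf w g.
have e : enc_bool ([set x in f w g] \in indep (mat w)) =
  orc w (enc (f w g : El w (tL tV))) by rewrite orcP.
have z b : tsize (enc_bool b) <= 3 by case: b.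
have := z ([set x in f w g] \in indep (mat w)).
rewrite [enc _]/= e => {}z; split; last by lia.
apply: runs_le (runs_query r) _ _; first by lia.
have := polyb_le hP (leq_addr (ospace (orc w)) (tsize (ein g))); lia.
Qed.

End Comp.

(** * Programs on lists *)

Section Closure.
Variable C : instance -> Prop.
Notation world := (world C).
Implicit Types a b c : ty.

Lemma comp_app a b c d (h : forall w : world, El w a -> El w b -> El w c)
    (f : forall w, El w d -> El w a) (f' : forall w, El w d -> El w b) :
  @comp C (tP a b) c (fun w p => h w p.1 p.2) -> comp f -> comp f' ->
  comp (fun w g => h w (f w g) (f' w g)).
Proof. by move=> hh hf hf'; apply: (comp_comp (comp_pair hf hf') hh). Qed.

Lemma comp_out a b (f : forall w : world, El w a -> El w b) : comp f ->
  exists2 P, polyb P & forall w g, tsize (enc (f w g)) <= P (tsize (ein g)).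
Proof. by move=> [c [P [hP h]]]; exists P => // w g; case: (h w g). Qed.

Lemma tsize_mem (w : world) a (s : El w (tL a)) x :
  x \in s -> tsize (enc x) < tsize (enc s).
Proof.
elim: s => //= y s IH; rewrite inE tsizeN => /orP[/eqP ->|/IH]; first by lia.
by move=> {}IH; apply: leq_trans IH _; rewrite /=; lia.
Qed.

(** If each step adds to the accumulator an amount bounded in terms of the input alone, the number
    of steps times this amount bounds all partial folds. *)
Lemma comp_foldl_growth a b c (f : forall w : world, El w a -> El w b)
    (s : forall w, El w a -> seq (El w c)) (h : forall w, El w a -> El w b -> El w c -> El w b) :
  comp f -> @comp C a (tL c) s ->
  @comp C (tP (tP a b) c) b (fun w p => h w p.1.1 p.1.2 p.2) ->
  (exists2 G, polyb G & forall w g u x, x \in s w g ->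
     tsize (enc (h w g u x)) <= tsize (enc u) + G (tsize (ein g))) ->
  comp (fun w g => foldl (h w g) (f w g) (s w g)).
Proof.
move=> hf hs hh [G hG hg]; apply: comp_foldl => //.
have [Pf pf of_] := comp_out hf; have [Ps ps os] := comp_out hs.
exists (fun k => Pf k + Ps k * G k); first by polyb.
move=> w g s1 s2 e.
have zs : size s1 <= Ps (tsize (ein g)).
  have := os w g; have := size_enc_seq (@enc C w c) (s w g).
  by rewrite /= {1}e size_cat; lia.
suff : tsize (enc (foldl (h w g) (f w g) s1)) <=
    tsize (enc (f w g)) + size s1 * G (tsize (ein g)).
  by have := of_ w g; have := leq_mul zs (leqnn (G (tsize (ein g)))); lia.
have sub : {subset s1 <= s w g} by move=> x; rewrite e mem_cat => ->.
elim/last_ind: s1 sub {e zs} => [|s1 x IH] sub; first by rewrite /=; lia.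
rewrite foldl_rcons size_rcons mulSn.
have := hg w g (foldl (h w g) (f w g) s1) x (sub x _).
rewrite mem_rcons inE eqxx => /(_ isT).
have sub' : {subset s1 <= s w g} by move=> y hy; apply: sub; rewrite mem_rcons inE hy orbT.
have := IH sub'; lia.
Qed.

(** A boolean has the code of a list of length 0 or 1, so a conditional is a case analysis on
    lists. *)
Lemma comp_if a b (p : forall w : world, El w a -> bool) (f h : forall w, El w a -> El w b) :
  @comp C a tB p -> comp f -> comp h -> comp (fun w g => if p w g then f w g else h w g).
Proof.
move=> hp hf hh.
have hp' : @comp C a (tL tB) (fun w g => nseq (p w g) false).
  by apply: (@comp_cast C _ _ _ _ _ _ (fun=> id)) hp => // w g; case: (p w g).
apply: comp_ext (@comp_case C a tB b _ h (fun w g _ _ => f w g) hp' hh _).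
  by move=> w g; case: (p w g).
exact: comp_comp (comp_fst (comp_id C _)) hf.
Qed.

Lemma comp_and a (p q : forall w : world, El w a -> bool) :
  @comp C a tB p -> @comp C a tB q -> @comp C a tB (fun w g => p w g && q w g).
Proof.
by move=> hp hq; apply: comp_ext (comp_if hp hq (comp_bool C a false)) => w g; case: (p w g).
Qed.

Lemma comp_neg a (p : forall w : world, El w a -> bool) :
  @comp C a tB p -> @comp C a tB (fun w g => ~~ p w g).
Proof.
by move=> hp; apply: comp_ext (comp_if hp (comp_bool C a false) (comp_bool C a true)) => w g; case: (p w g).
Qed.

Lemma comp_or a (p q : forall w : world, El w a -> bool) :
  @comp C a tB p -> @comp C a tB q -> @comp C a tB (fun w g => p w g || q w g).
Proof.
by move=> hp hq; apply: comp_ext (comp_if hp (comp_bool C a true) hq) => w g; case: (p w g).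
Qed.

Lemma comp_xor a (p q : forall w : world, El w a -> bool) :
  @comp C a tB p -> @comp C a tB q -> @comp C a tB (fun w g => p w g (+) q w g).
Proof.
by move=> hp hq; apply: comp_ext (comp_if hp (comp_neg hq) hq) => w g; case: (p w g).
Qed.

Lemma comp_catrev a b (s t : forall w : world, El w a -> seq (El w b)) :
  @comp C a (tL b) s -> @comp C a (tL b) t ->
  @comp C a (tL b) (fun w g => catrev (s w g) (t w g)).
Proof.
move=> hs ht.
apply: (@comp_ext C a (tL b) (fun w g => foldl (fun u x => x :: u) (t w g) (s w g))).
  by move=> w g; elim: (s w g) (t w g) => //= x r IH u; rewrite IH.
apply: (@comp_foldl_growth a (tL b) b t s (fun w g u x => x :: u) ht hs).
  by apply: comp_cons; [exact: comp_snd (comp_id _ _)|exact: comp_snd (comp_fst (comp_id _ _))].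
have [P hP h] := comp_out hs; exists P => // w g u x /tsize_mem.
by have := h w g; rewrite tsize_enc_cons; lia.
Qed.

Lemma comp_rev a b (s : forall w : world, El w a -> seq (El w b)) :
  @comp C a (tL b) s -> @comp C a (tL b) (fun w g => rev (s w g)).
Proof. by move=> hs; apply: comp_catrev => //; exact: comp_nil. Qed.

Lemma comp_cat a b (s t : forall w : world, El w a -> seq (El w b)) :
  @comp C a (tL b) s -> @comp C a (tL b) t ->
  @comp C a (tL b) (fun w g => s w g ++ t w g).
Proof.
move=> hs ht; apply: comp_ext (comp_catrev (comp_rev hs) ht) => w g.
by rewrite catrevE revK.
Qed.

Lemma comp_map a b c (s : forall w : world, El w a -> seq (El w b))
    (h : forall w, El w a -> El w b -> El w c) :
  @comp C a (tL b) s -> @comp C (tP a b) c (fun w p => h w p.1 p.2) ->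
  @comp C a (tL c) (fun w g => [seq h w g x | x <- s w g]).
Proof.
move=> hs hh.
apply: (@comp_ext C a (tL c) (fun w g => rev (foldl (fun u x => h w g x :: u) [::] (s w g)))).
  move=> w g; elim/last_ind: (s w g) => // r x IH.
  by rewrite map_rcons foldl_rcons rev_cons -IH.
apply: comp_rev.
apply: (@comp_foldl_growth a (tL c) b (fun w g => [::]) s (fun w g u x => h w g x :: u) _ hs).
- exact: comp_nil.
- apply: comp_cons; last exact: comp_snd (comp_fst (comp_id _ _)).
  apply: (comp_app hh); first exact: comp_fst (comp_fst (comp_id _ _)).
  exact: comp_snd (comp_id _ _).
have [P hP hp] := comp_out hs; have [Q hQ hq] := comp_out hh.
exists (fun k => Q (k + P k + 1) + 1); first by polyb.
move=> w g u x /tsize_mem; have := hp w g; rewrite tsize_enc_cons.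
have := hq w (g, x); rewrite !tsize_ein tsize_enc_pair /= => h1 h2 h3.
suff: Q (tsize (inp w) + (tsize (enc g) + tsize (enc x)).+1).+1 <=
  Q ((tsize (inp w) + tsize (enc g)).+1 + P (tsize (inp w) + tsize (enc g)).+1 + 1) by lia.
by apply: (polyb_le hQ); rewrite /= in h3; lia.
Qed.

Lemma comp_filter a b (s : forall w : world, El w a -> seq (El w b))
    (p : forall w, El w a -> El w b -> bool) :
  @comp C a (tL b) s -> @comp C (tP a b) tB (fun w q => p w q.1 q.2) ->
  @comp C a (tL b) (fun w g => [seq x <- s w g | p w g x]).
Proof.
move=> hs hh.
apply: (@comp_ext C a (tL b) (fun w g =>
  rev (foldl (fun u x => if p w g x then x :: u else u) [::] (s w g)))).
  move=> w g; elim/last_ind: (s w g) => // r x IH.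
  by rewrite filter_rcons foldl_rcons; case: (p w g x) => //; rewrite rev_cons -IH.
apply: comp_rev.
apply: (@comp_foldl_growth a (tL b) b (fun w g => [::]) s (fun w g u x => if p w g x then x :: u else u) _ hs).
- exact: comp_nil.
- apply: (@comp_if (tP (tP a (tL b)) b) (tL b) (fun w q => p w q.1.1 q.2) (fun w q => q.2 :: q.1.2) (fun w q => q.1.2)).
  + apply: (comp_app hh); first exact: comp_fst (comp_fst (comp_id _ _)).
    exact: comp_snd (comp_id _ _).
  + by apply: comp_cons; [exact: comp_snd (comp_id _ _)|exact: comp_snd (comp_fst (comp_id _ _))].
  + exact: comp_snd (comp_fst (comp_id _ _)).
have [P hP hp] := comp_out hs.
exists P => // w g u x /tsize_mem; have := hp w g.
by case: ifP => _; rewrite ?tsize_enc_cons; lia.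
Qed.

Lemma comp_flatten a b (s : forall w : world, El w a -> seq (seq (El w b))) :
  @comp C a (tL (tL b)) s -> @comp C a (tL b) (fun w g => flatten (s w g)).
Proof.
move=> hs.
apply: (@comp_ext C a (tL b) (fun w g => foldl cat [::] (s w g))).
  move=> w g; elim/last_ind: (s w g) => // r x IH.
  by rewrite flatten_rcons foldl_rcons IH.
apply: (@comp_foldl_growth a (tL b) (tL b) (fun w g => [::]) s (fun w g u x => u ++ x) _ hs).
- exact: comp_nil.
- by apply: comp_cat; [exact: comp_snd (comp_fst (comp_id _ _))|exact: comp_snd (comp_id _ _)].
have [P hP hp] := comp_out hs.
exists P => // w g u x /(@tsize_mem w (tL b) (s w g)); have := hp w g.
suff: tsize (enc (u ++ x : El w (tL b))) <= tsize (enc u) + tsize (enc x) by lia.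
elim: u => [|y u IH]; first by rewrite /=; lia.
by rewrite cat_cons !tsize_enc_cons; lia.
Qed.

Lemma comp_all a b (s : forall w : world, El w a -> seq (El w b))
    (p : forall w, El w a -> El w b -> bool) :
  @comp C a (tL b) s -> @comp C (tP a b) tB (fun w q => p w q.1 q.2) ->
  @comp C a tB (fun w g => all (p w g) (s w g)).
Proof.
move=> hs hh.
apply: (@comp_ext C a tB (fun w g => foldl (fun u x => u && p w g x) true (s w g))).
  move=> w g; elim/last_ind: (s w g) => // r x IH.
  by rewrite all_rcons foldl_rcons andbC IH.
apply: (@comp_foldl_growth a tB b (fun w g => true) s (fun w g (u : bool) x => u && p w g x) _ hs).
- exact: comp_bool.
- apply: (@comp_and (tP (tP a tB) b) (fun w q => q.1.2)); first exact: comp_snd (comp_fst (comp_id _ _)).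
  apply: (comp_app hh); first exact: comp_fst (comp_fst (comp_id _ _)).
  exact: comp_snd (comp_id _ _).
exists (fun=> 3); first by polyb.
by move=> w g u x _; case: (_ && _); rewrite /= addnC.
Qed.

Lemma comp_has a b (s : forall w : world, El w a -> seq (El w b))
    (p : forall w, El w a -> El w b -> bool) :
  @comp C a (tL b) s -> @comp C (tP a b) tB (fun w q => p w q.1 q.2) ->
  @comp C a tB (fun w g => has (p w g) (s w g)).
Proof.
move=> hs hh; apply: comp_ext (comp_neg (comp_all (p := fun w g x => ~~ p w g x) hs (comp_neg hh))) => w g.
by elim: (s w g) => //= x r ->; rewrite negb_and negbK.
Qed.

(** Lengths are compared without numbers: one element of [s] is dropped for each element of [t], and
    the rest is tested for emptiness. *)
Lemma comp_size_leq a b c (s : forall w : world, El w a -> seq (El w b))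
    (t : forall w : world, El w a -> seq (El w c)) :
  @comp C a (tL b) s -> @comp C a (tL c) t ->
  @comp C a tB (fun w g => size (s w g) <= size (t w g)).
Proof.
move=> hs ht.
pose f (w : world) g : seq (El w b) := foldl (fun u _ => behead u) (s w g) (t w g).
have ef w g : f w g = drop (size (t w g)) (s w g).
  rewrite /f; elim/last_ind: (t w g) => [|r x IH]; first by rewrite drop0.
  by rewrite foldl_rcons IH size_rcons -drop1 drop_drop.
have hf : @comp C a (tL b) f.
  apply: (@comp_foldl_growth a (tL b) c s t (fun w g u _ => behead u) hs ht).
    apply: (@comp_ext C (tP (tP a (tL b)) c) (tL b) (fun w q => if q.1.2 is _ :: r then r else [::])); first by move=> w [[? [|? ?]] ?].
    apply: (@comp_case C (tP (tP a (tL b)) c) b (tL b) (fun w q => q.1.2) (fun w q => [::]) (fun w q x r => r)).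
    - exact: comp_snd (comp_fst (comp_id _ _)).
    - exact: comp_nil.
    - exact: comp_snd (comp_snd (comp_id _ _)).
  exists (fun=> 0); first by polyb.
  by move=> w g [|y u] x _; rewrite ?tsize_enc_cons /=; lia.
apply: (@comp_ext C a tB (fun w g => if f w g is x :: r then false else true)).
  by move=> w g; rewrite -subn_eq0 -size_drop -ef; case: (f w g).
exact: (@comp_case C a b tB f (fun w g => true) (fun w g x r => false) hf (comp_bool _ _ _) (comp_bool _ _ _)).
Qed.

(** Induction on the type. A vertex is coded in unary, hence like a list of its length, and two
    length comparisons decide equality; two lists are traversed in parallel by a fold over the
    first. *)
Lemma comp_eq a b (f h : forall w : world, El w a -> El w b) :
  comp f -> comp h -> @comp C a tB (fun w g => f w g == h w g).
Proof.
move=> hf hh; apply: (@comp_app b b tB a (fun w x y => x == y) f h _ hf hh).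
have p1 c d : @comp C (tP c d) c (fun w p => p.1) := comp_fst (comp_id _ _).
have p2 c d : @comp C (tP c d) d (fun w p => p.2) := comp_snd (comp_id _ _).
elim: b {f h hf hh} => [||b IHb c IHc|b IHb].
- apply: comp_ext (comp_neg (comp_xor (p1 tB tB) (p2 tB tB))) => w [[] []] //.
- have cv (f : forall w : world, El w (tP tV tV) -> El w tV) : comp f ->
      @comp C (tP tV tV) (tL tB) (fun w g => nseq (f w g : 'I__) false).
    apply: (@comp_cast C _ _ _ _ _ _ (fun=> id)) => // w g.
    by rewrite /= /enc_nat; elim: (nat_of_ord _) => //= k ->.
  have h1 := cv _ (p1 tV tV); have h2 := cv _ (p2 tV tV).
  apply: comp_ext (comp_and (comp_size_leq h1 h2) (comp_size_leq h2 h1)) => w [x y].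
  by rewrite !size_nseq -eqn_leq.
- apply: comp_ext (comp_and (comp_app IHb (comp_fst (p1 _ _)) (comp_fst (p2 _ _)))
    (comp_app IHc (comp_snd (p1 _ _)) (comp_snd (p2 _ _)))) => w [[x y] [x' y']] //.
(* the accumulator is (equal so far, remaining part of the second list) *)
pose step (w : world) (g : El w (tP (tL b) (tL b))) (u : El w (tP tB (tL b))) (x : El w b) :
    El w (tP tB (tL b)) :=
  match u.2 with [::] => (false, [::]) | y :: r => (u.1 && (x == y), r) end.
pose f (w : world) (g : El w (tP (tL b) (tL b))) := foldl (step w g) (true, g.2) g.1.
have hf : @comp C (tP (tL b) (tL b)) (tP tB (tL b)) f.
  apply: (@comp_foldl_growth (tP (tL b) (tL b)) (tP tB (tL b)) b (fun w g => (true, g.2)) (fun w g => g.1) step).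
  - by apply: (comp_pair (c := tL b)); [exact: comp_bool|exact: p2].
  - exact: (p1 (tL b) (tL b)).
  - apply: (@comp_case C (tP (tP (tP (tL b) (tL b)) (tP tB (tL b))) b) b (tP tB (tL b)) (fun w q => q.1.2.2) (fun w q => (false, [::]))
      (fun w q y r => (q.1.2.1 && (q.2 == y), r))).
    + exact: comp_snd (comp_snd (p1 _ _)).
    + by apply: (comp_pair (c := tL b)); [exact: comp_bool|exact: comp_nil].
    + apply: (comp_pair (c := tL b)); last exact: comp_snd (p2 _ _).
      apply: (@comp_and (tP (tP (tP (tP (tL b) (tL b)) (tP tB (tL b))) b) (tP b (tL b))) (fun w q => q.1.1.2.1)); first exact: comp_fst (comp_snd (comp_fst (p1 _ _))).
      apply: (@comp_app b b tB (tP (tP (tP (tP (tL b) (tL b)) (tP tB (tL b))) b) (tP b (tL b))) (fun w x y => x == y) (fun w q => q.1.2) (fun w q => q.2.1) IHb).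
        exact: comp_snd (p1 _ _).
      exact: comp_fst (p2 _ _).
  exists (fun=> 3); first by polyb.
  move=> w g [u [|y r]] x _; rewrite /step /= !tsizeN.
    by change (tsize Leaf) with 1; lia.
  by case: (_ && _); rewrite /= ?tsizeN; change (tsize Leaf) with 1; lia.
have hr : @comp C (tP (tL b) (tL b)) tB (fun w g => if (f w g).2 is x :: r then false else (f w g).1).
  apply: (@comp_case C _ b tB (fun w g => (f w g).2) (fun w g => (f w g).1) (fun w g x r => false)).
  - exact: comp_snd hf.
  - exact: comp_fst hf.
  - exact: comp_bool.
apply: comp_ext hr => w g; rewrite /f.
suff h e s r : (if (foldl (step w g) (e, r) s).2 is _ :: _ then false
    else (foldl (step w g) (e, r) s).1) = e && (s == r) by rewrite h.
elim: s e r => [|x s IH] e [|y r] /=; rewrite ?andbT ?andbF //.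
  by rewrite /step /= IH.
by rewrite /step /= IH eqseq_cons andbA.
Qed.

Lemma comp_mem a b (f : forall w : world, El w a -> El w b) s :
  comp f -> @comp C a (tL b) s -> @comp C a tB (fun w g => f w g \in s w g).
Proof.
move=> hf hs.
apply: (@comp_ext C a tB (fun w g => has (fun x => x == f w g) (s w g))).
  by move=> w g; rewrite has_pred1.
apply: comp_has => //; apply: comp_eq; first exact: comp_snd (comp_id _ _).
exact: comp_comp (comp_fst (comp_id _ _)) hf.
Qed.

End Closure.

(** Written as a left fold so that [comp_foldl_growth] applies. *)
Definition dedup (T : eqType) (s : seq T) : seq T :=
  foldl (fun u x => if x \in u then u else x :: u) [::] s.

Lemma mem_dedup (T : eqType) (s : seq T) : dedup s =i s.
Proof.
move=> y; rewrite /dedup; elim/last_ind: s => // s x IH.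
rewrite foldl_rcons mem_rcons inE -IH; case: ifP => // hx.
by case: eqP => // ->; rewrite hx.
Qed.

Lemma dedup_uniq (T : eqType) (s : seq T) : uniq (dedup s).
Proof.
rewrite /dedup; elim/last_ind: s => // s x IH.
by rewrite foldl_rcons; case: ifP => //= ->.
Qed.

Lemma comp_dedup C a b (s : forall w : world C, El w a -> seq (El w b)) :
  @comp C a (tL b) s -> @comp C a (tL b) (fun w g => dedup (s w g)).
Proof.
move=> hs.
apply: (@comp_foldl_growth C a (tL b) b (fun w g => [::]) s (fun w g u x => if x \in u then u else x :: u) _ hs).
- exact: comp_nil.
- have h1 : @comp C (tP (tP a (tL b)) b) (tL b) (fun w q => q.1.2).
    exact: comp_snd (comp_fst (comp_id _ _)).
  have h2 : @comp C (tP (tP a (tL b)) b) b (fun w q => q.2) by exact: comp_snd (comp_id _ _).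
  exact: (@comp_if C (tP (tP a (tL b)) b) (tL b) (fun w q => q.2 \in q.1.2) (fun w q => q.1.2)
    (fun w q => q.2 :: q.1.2) (comp_mem h2 h1) h1 (comp_cons h2 h1)).
have [P hP hp] := comp_out hs.
exists P => // w g u x /tsize_mem; have := hp w g.
by case: ifP => _; rewrite ?tsize_enc_cons; lia.
Qed.

(** * The given solver as a uniform program *)

Lemma lists_edges_card (S : finType) (s : seq (S * S)) F :
  lists_edges s F -> size s = #|F|.
Proof.
case/andP=> u /eqP <-; rewrite -(size_map (@edge_of S)) -(card_uniqP u).
by apply: eq_card => e; rewrite inE.
Qed.

Lemma tsize_enc_nat k : tsize (enc_nat k) = 2 * k + 1.
Proof. by elim: k => //= k; rewrite tsizeN; change (tsize Leaf) with 1; lia. Qed.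

Lemma tsize_enc_edges n (s : seq ('I_n * 'I_n)) :
  tsize (enc_edges s) <= size s * (4 * n + 4) + 1.
Proof.
elim: s => [|[x y] s IH]; first by change (tsize (enc_edges [::])) with 1.
rewrite /= !tsizeN !tsize_enc_nat; have := ltn_ord x; have := ltn_ord y.
nia.
Qed.

(** The solver reads its input nested to the right, whereas [inp] groups the first two components;
    the call regroups them. *)
Lemma runs_inp_call O cp c i1 i2 x y z T1 S1 T2 S2 :
  runs O cp (Node (Node i1 i2) x) y T1 S1 ->
  runs O c (Node i1 (Node i2 y)) z T2 S2 ->
  runs O (Seq (Call 1 cp (Var 0)) (Call 0 c
    (ECons (EHd (EHd (Var 0))) (ECons (ETl (EHd (Var 0))) (Var 1)))))
    (Node (Node i1 i2) x) z (T1 + T2 + 20)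
    (tsize i1 + tsize i2 + tsize x + tsize y + tsize z + S1 + S2 + 10).
Proof.
move=> [s1 [t1 [m1 [e1 v1 b1 d1]]]] [s2 [t2 [m2 [e2 v2 b2 d2]]]].
do 3 eexists; split.
- apply: exec_seq0; first by apply: exec_call0; [exact: e1|exact: v1].
  by apply: exec_call0; [exact: e2|exact: v2].
- by [].
- rewrite /=; lia.
- rewrite /espace /ssize /set_var /= ?tsizeN; lia.
Qed.

(* Filtering the list of all edges makes the calls of the solver legal for
   arbitrary X and H. *)
Definition avoid (V : eqType) (Es : seq (V * V)) (X : seq V) (H : seq (V * V)) : seq (V * V) :=
  [seq e <- Es | [&& e \in H, e.1 \notin X & e.2 \notin X]].

Section Solver.
Variable C : instance -> Prop.
Hypothesis solv : solvable C contract (fun _ X => ~: X).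
Notation world := (world C).

Lemma comp_avoid a (X : forall w : world, El w a -> seq 'I_(gsize w))
    (H : forall w : world, El w a -> seq ('I_(gsize w) * 'I_(gsize w))) :
  @comp C a (tL tV) X -> @comp C a tM H ->
  @comp C a tM (fun w g => avoid (wedges w) (X w g) (H w g)).
Proof.
move=> hX hH; apply: (@comp_filter C a tE); first exact: comp_edges.
have hX' := comp_comp (comp_fst (comp_id C (tP a tE))) hX.
have hH' := comp_comp (comp_fst (comp_id C (tP a tE))) hH.
have he := comp_snd (comp_id C (tP a tE)).
apply: comp_and; first exact: (comp_mem (b := tE)).
apply: comp_and; apply: comp_neg.
  exact: (comp_mem (b := tV) (comp_fst he)).
exact: (comp_mem (b := tV) (comp_snd he)).
Qed.

Lemma avoid_lists (w : world) X H :
  lists_edges (avoid (wedges w) X H) [set edge_of e | e in avoid (wedges w) X H].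
Proof.
have /andP[u _] := wedgesP w.
apply/andP; split; first exact: subseq_uniq (map_subseq _ (filter_subseq _ _)) u.
apply/eqP/setP=> e; rewrite inE; apply/mapP/imsetP => -[p ? ->]; by exists p.
Qed.

(** Tractability gives a result only existentially, for each input. Choosing it together with the
    run that produces it turns the solver into a function that a program computes. *)
Lemma solver_exists : exists solve : forall w : world,
    seq 'I_(gsize w) -> seq ('I_(gsize w) * 'I_(gsize w)) -> seq ('I_(gsize w) * 'I_(gsize w)),
  (forall (w : world) X H, exists2 M,
     maximum_matching (contract (indep (mat w)) [set x in X])
       [set edge_of e | e in avoid (wedges w) X H] M
     & lists_edges (solve w X H) M) /\
  (forall a X H, @comp C a (tL tV) X -> @comp C a tM H ->
     @comp C a tM (fun w g => solve w (X w g) (H w g))).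
Proof.
have [c [tp [sp hc]]] := solv.
pose P k := peval tp k + peval sp k.
have hP : polyb P by apply: polyb_add; exact: polyb_peval.
pose tin (w : world) X H := Node (enc_nat (gsize w)) (Node (enc_edges (wedges w))
  (Node (enc_elts (dedup X)) (enc_edges (avoid (wedges w) X H)))).
have ex (w : world) X H : exists Ms : seq ('I_(gsize w) * 'I_(gsize w)),
    (exists2 M, maximum_matching (contract (indep (mat w)) [set x in X])
       [set edge_of e | e in avoid (wedges w) X H] M & lists_edges Ms M) /\
    runs (orc w) c (tin w X H) (enc_edges Ms) (P (gsize w + otime (orc w)))
      (P (gsize w + ospace (orc w))).
  have sH : [set edge_of e | e in avoid (wedges w) X H] \subset
      induced (edges (gra w)) (~: [set x in X]).
    apply/subsetP=> _ /imsetP[p + ->]; rewrite mem_filter !inE.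
    case/andP=> /and3P[_ n1 n2] pE.
    have /andP[_ /eqP <-] := wedgesP w; rewrite inE map_f //=.
    by apply/subsetP=> x; rewrite !inE => /orP[] /eqP ->.
  have lX : lists_elts (dedup X) [set x in X].
    by rewrite /lists_elts dedup_uniq; apply/eqP/setP => x; rewrite !inE mem_dedup.
  have [s [t [m [e [M [Ms [hM lM g]]] ht hm]]]] :=
    hc w (wC w) _ _ sH _ _ _ (wedgesP w) lX (avoid_lists X H).
  exists Ms; split; first by exists M.
  exists s, t, m; split=> //; first by apply: leq_trans ht _; exact: leq_addr.
  by apply: leq_trans hm _; exact: leq_addl.
pose solve w X H := proj1_sig (constructive_indefinite_description _ (ex w X H)).
have hs w X H := proj2_sig (constructive_indefinite_description _ (ex w X H)).
exists solve; split=> [w X H|a X H hX hH]; first by case: (hs w X H).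
have hin := comp_pair (comp_dedup hX) (comp_avoid hX hH).
have [Q pQ oQ] := comp_out (comp_avoid hX hH).
case: hin => cp [Pp [hPp hp]].
exists (Seq (Call 1 cp (Var 0)) (Call 0 c
    (ECons (EHd (EHd (Var 0))) (ECons (ETl (EHd (Var 0))) (Var 1))))).
exists (fun k => 20 + k + 2 * Pp k + P k + (Q k * (4 * k + 4) + 1)).
split; first by polyb.
move=> w g; have [r1 o1] := hp w g.
have [[M hM lM] r2] := hs w (X w g) (H w g).
(* The number of vertices is coded in unary, so a bound polynomial in it is also polynomial in the
   size of the input. *)
have zn : gsize w <= tsize (ein g).
  by rewrite tsize_ein /inp tsizeN tsize_enc_nat; lia.
have zo : tsize (enc_edges (solve w (X w g) (H w g))) <=
    Q (tsize (ein g)) * (4 * tsize (ein g) + 4) + 1.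
  apply: leq_trans (tsize_enc_edges _) _.
  rewrite leq_add2r leq_mul //; last by lia.
  rewrite (lists_edges_card lM).
  have /andP[/and3P[sM _ _] _] := hM.
  apply: leq_trans (subset_leq_card sM) _.
  rewrite -(lists_edges_card (@avoid_lists w (X w g) (H w g))).
  have := oQ w g; have := size_enc_seq (@enc C w tE) (avoid (wedges w) (X w g) (H w g)).
  rewrite /=; lia.
split; last by apply: leq_trans zo _; lia.
apply: runs_le (@runs_inp_call _ _ _ _ _ _ _ (enc_edges (solve w (X w g) (H w g))) _ _ _ _ r1 r2) _ _.
  have := polyb_le hP (leq_add zn (leqnn (otime (orc w)))); lia.
have := polyb_le hP (leq_add zn (leqnn (ospace (orc w)))).
have := polyb_le hPp (leq_addr (ospace (orc w)) (tsize (ein g))).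
have := polyb_le pQ (leq_addr (ospace (orc w)) (tsize (ein g))).
move=> hQ; have : Q (tsize (ein g)) * (4 * tsize (ein g) + 4) <=
  Q (tsize (ein g) + ospace (orc w)) * (4 * (tsize (ein g) + ospace (orc w)) + 4).
  by apply: leq_mul => //; lia.
have := tsize_ein g; rewrite {1}/inp tsizeN; lia.
Qed.

End Solver.

(** * The search *)

Section Algorithm.
Variables (V : eqType) (Es : seq (V * V)) (ind : pred (seq V)).
Variable solve : seq V -> seq (V * V) -> seq (V * V).
Local Notation E := (V * V)%type.
Implicit Types (e f h : E) (M N F R K D : seq E).

Definition verts M : seq V := flatten [seq [:: e.1; e.2] | e <- M].

Definition disj e f : bool :=
  [&& e.1 != f.1, e.1 != f.2, e.2 != f.1 & e.2 != f.2].

(** The test [e == f] compares oriented pairs. Inside [Es] this is equality of edges, each edge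
    being listed with one orientation. *)
Definition ok M : bool :=
  all (fun e => all (fun f => (e == f) || disj e f) M) M && ind (verts M).

Definition mxl M : bool :=
  ok M && all (fun e => (e \in M) || ~~ ok (e :: M)) Es.

(** A symmetric difference, hence an involution, which makes the neighbour relation symmetric. The
    three edges may coincide, so one or two changes are included. Filtering [Es] keeps the result in
    a canonical order. *)
Definition flip M e f h : seq E :=
  [seq x <- Es | (x \in M) (+) [|| x == e, x == f | x == h]].

Definition nbrs M : seq (seq E) :=
  flatten [seq flatten [seq [seq flip M e f h | h <- Es] | f <- Es] | e <- Es].

Definition common R M : seq E := [seq x <- M | x \in R].

Definition better R M N : bool :=
  mxl N && (~~ (size N <= size M) ||
    (size M <= size N) && ~~ (size (common R N) <= size (common R M))).

(** The default is not reached at a maximal matching smaller than [R], by [better_exists]. *)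
Definition parent R M : seq E :=
  if [seq N <- nbrs M | better R M N] is N :: _ then N else [::].

(** A parent is a neighbour and being neighbours is symmetric, so all children of [M] are found
    here. Duplicates are removed because different triples of edges can give the same neighbour. *)
Definition kids R K M : seq (seq E) :=
  dedup [seq N <- nbrs M |
    [&& mxl N, size K <= size N, ~~ (size R <= size N) & parent R N == M]].

Definition same_edge e f : bool :=
  (e == f) || (e.1 == f.2) && (e.2 == f.1).

(** The solver may answer in any order and with either orientation of an edge; filtering [Es]
    restores the canonical listing. *)
Definition extend F D : seq E :=
  [seq x <- Es | (x \in F) || has (same_edge x) (solve (verts F) D)].

(* [toggle M e D] is M off e and D, with e switched; the maximum matchings that
   extend it by edges of D are those that agree with M before e and not at e. *)
Definition toggle M e D : seq E :=
  (if e \in M then [::] else [:: e]) ++ [seq x <- M | (x != e) && (x \notin D)].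

Definition branch R M e D : seq (seq E * seq E) :=
  if ok (toggle M e D) && (size R <= size (extend (toggle M e D) D))
  then [:: (extend (toggle M e D) D, D)] else [::].

(** A left fold for the sake of [comp_foldl_growth]: restarting the accumulator at [e] discards what
    comes before. *)
Definition after e D : seq E :=
  rev (foldl (fun u x => if x == e then [::] else x :: u) [::] D).

Definition lawler R M D : seq (seq E * seq E) :=
  flatten [seq branch R M e (after e D) | e <- D].

(** In a node [(M, D)] the edges of [D] are the undecided ones. Nodes below the maximum matchings
    carry the empty list, for which [lawler] returns nothing, so one formula covers both kinds of
    nodes. *)
Definition children R K (x : seq E * seq E) : seq (seq E * seq E) :=
  lawler R x.1 x.2 ++ [seq (N, [::]) | N <- kids R K x.1].

Definition step R K (W : seq (seq E * seq E)) : seq (seq E * seq E) :=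
  if W is x :: W' then children R K x ++ W' else [::].

(* K only serves to represent the number [size K]. *)
Definition hit K (W : seq (seq E * seq E)) : bool :=
  if W is x :: _ then (size K <= size x.1) && (size x.1 <= size K) else false.

End Algorithm.

(** * The operations of the search are polynomial programs *)

Definition indl (S : finType) (A : matroid S) (s : seq S) : bool :=
  [set x in s] \in indep A.

Section AlgorithmComp.
Variable C : instance -> Prop.
Notation world := (world C).
Variable solve : forall w : world,
    seq 'I_(gsize w) -> seq ('I_(gsize w) * 'I_(gsize w)) -> seq ('I_(gsize w) * 'I_(gsize w)).
Hypothesis comp_solve : forall a X H, @comp C a (tL tV) X -> @comp C a tM H ->
     @comp C a tM (fun w g => solve (X w g) (H w g)).

Local Notation V w := 'I_(gsize w).
Local Notation E w := ('I_(gsize w) * 'I_(gsize w))%type.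
Definition tN := tP tM tM.

Lemma comp_verts a (M : forall w : world, El w a -> seq (E w)) :
  @comp C a tM M -> @comp C a (tL tV) (fun w g => verts (M w g)).
Proof.
move=> hM; apply: comp_flatten; apply: (@comp_map C a tE (tL tV)) => //.
apply: comp_cons; first by apply: (@comp_fst C _ tV tV); exact: (comp_snd (comp_id _ _)).
apply: comp_cons; first by apply: (@comp_snd C _ tV tV); exact: (comp_snd (comp_id _ _)).
exact: (comp_nil).
Qed.

Lemma comp_disj a (e f : forall w : world, El w a -> E w) :
  @comp C a tE e -> @comp C a tE f -> @comp C a tB (fun w g => disj (e w g) (f w g)).
Proof.
move=> he hf.
have e1 := comp_fst he; have e2 := comp_snd he.
have f1 := comp_fst hf; have f2 := comp_snd hf.
apply: comp_and; first exact: (comp_neg (comp_eq e1 f1)).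
apply: comp_and; first exact: (comp_neg (comp_eq e1 f2)).
apply: comp_and; first exact: (comp_neg (comp_eq e2 f1)).
exact: (comp_neg (comp_eq e2 f2)).
Qed.

(** The bodies of nested list operations live in a context of nested pairs: this is weakening, and
    [comp_v] reads the innermost variable. *)
Lemma comp_w a b c (f : forall w : world, El w a -> El w c) :
  comp f -> @comp C (tP a b) c (fun w q => f w q.1).
Proof. exact: (comp_comp (comp_fst (comp_id _ _))). Qed.

Lemma comp_v a b : @comp C (tP a b) b (fun w q => q.2).
Proof. exact: (comp_snd (comp_id _ _)). Qed.

Lemma comp_ok a (M : forall w : world, El w a -> seq (E w)) :
  @comp C a tM M -> @comp C a tB (fun w g => ok (indl (mat w)) (M w g)).
Proof.
move=> hM; apply: comp_and; last exact: (comp_query (comp_verts hM)).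
apply: (@comp_all C a tE) => //; apply: (@comp_all C (tP a tE) tE); first exact: (comp_w tE hM).
have h1 := comp_w tE (comp_v a tE); have h2 := comp_v (tP a tE) tE.
by apply: comp_or; [exact: (comp_eq h1 h2)|exact: (comp_disj h1 h2)].
Qed.

Lemma comp_mxl a (M : forall w : world, El w a -> seq (E w)) :
  @comp C a tM M -> @comp C a tB (fun w g => mxl (wedges w) (indl (mat w)) (M w g)).
Proof.
move=> hM; apply: comp_and; first exact: (comp_ok).
apply: (@comp_all C a tE); first exact: (comp_edges).
have hM' := comp_w tE hM; have he := comp_v a tE.
apply: comp_or; first exact: (@comp_mem C _ tE _ _ he hM').
by apply: comp_neg; apply: comp_ok; exact: (@comp_cons C _ tE _ _ he hM').
Qed.

Lemma comp_flip a (M : forall w : world, El w a -> seq (E w)) (e f h : forall w : world, El w a -> E w) :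
  @comp C a tM M -> @comp C a tE e -> @comp C a tE f -> @comp C a tE h ->
  @comp C a tM (fun w g => flip (wedges w) (M w g) (e w g) (f w g) (h w g)).
Proof.
move=> hM he hf hh; apply: (@comp_filter C a tE); first exact: (comp_edges).
have hx := comp_v a tE.
apply: comp_xor; first exact: (@comp_mem C _ tE _ _ hx (comp_w tE hM)).
apply: comp_or; first exact: (comp_eq hx (comp_w tE he)).
apply: comp_or; first exact: (comp_eq hx (comp_w tE hf)).
exact: (comp_eq hx (comp_w tE hh)).
Qed.

Lemma comp_nbrs a (M : forall w : world, El w a -> seq (E w)) :
  @comp C a tM M -> @comp C a (tL tM) (fun w g => nbrs (wedges w) (M w g)).
Proof.
move=> hM; apply: (@comp_flatten C a tM).
apply: (@comp_map C a tE (tL tM)); first exact: (comp_edges).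
apply: (@comp_flatten C _ tM).
apply: (@comp_map C (tP a tE) tE (tL tM)); first exact: (comp_edges).
apply: (@comp_map C (tP (tP a tE) tE) tE tM); first exact: (comp_edges).
apply: comp_flip.
- exact: (comp_w tE (comp_w tE (comp_w tE hM))).
- exact: (comp_w tE (comp_w tE (comp_v a tE))).
- exact: (comp_w tE (comp_v (tP a tE) tE)).
- exact: (comp_v).
Qed.

Lemma comp_common a (R M : forall w : world, El w a -> seq (E w)) :
  @comp C a tM R -> @comp C a tM M -> @comp C a tM (fun w g => common (R w g) (M w g)).
Proof.
move=> hR hM; apply: (@comp_filter C a tE) => //.
exact: (@comp_mem C _ tE _ _ (comp_v a tE) (comp_w tE hR)).
Qed.

Lemma comp_better a (R M N : forall w : world, El w a -> seq (E w)) :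
  @comp C a tM R -> @comp C a tM M -> @comp C a tM N ->
  @comp C a tB (fun w g => better (wedges w) (indl (mat w)) (R w g) (M w g) (N w g)).
Proof.
move=> hR hM hN; apply: comp_and; first exact: (comp_mxl).
have hle := @comp_size_leq C a tE tE.
apply: comp_or; first exact: (comp_neg (hle _ _ hN hM)).
apply: comp_and; first exact: hle hM hN.
exact: (comp_neg (hle _ _ (comp_common hR hN) (comp_common hR hM))).
Qed.

Lemma comp_parent a (R M : forall w : world, El w a -> seq (E w)) :
  @comp C a tM R -> @comp C a tM M ->
  @comp C a tM (fun w g => parent (wedges w) (indl (mat w)) (R w g) (M w g)).
Proof.
move=> hR hM.
apply: (@comp_case C a tM tM
  (fun w g => [seq N <- nbrs (wedges w) (M w g) | better (wedges w) (indl (mat w)) (R w g) (M w g) N])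
  (fun w g => [::]) (fun w g N _ => N)).
- apply: (@comp_filter C a tM); first exact: (comp_nbrs).
  by apply: comp_better; [exact: (comp_w tM hR)|exact: (comp_w tM hM)|exact: (comp_v)].
- exact: (comp_nil).
- exact: (comp_fst (comp_v _ _)).
Qed.

Lemma comp_kids a (R K M : forall w : world, El w a -> seq (E w)) :
  @comp C a tM R -> @comp C a tM K -> @comp C a tM M ->
  @comp C a (tL tM) (fun w g => kids (wedges w) (indl (mat w)) (R w g) (K w g) (M w g)).
Proof.
move=> hR hK hM; apply: (@comp_dedup C a tM); apply: (@comp_filter C a tM); first exact: (comp_nbrs).
have hN := comp_v a tM; have hR' := comp_w tM hR.
have hle := @comp_size_leq C (tP a tM) tE tE.
apply: comp_and; first exact: (comp_mxl).
apply: comp_and; first exact: hle (comp_w tM hK) hN.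
apply: comp_and; first exact: (comp_neg (hle _ _ hR' hN)).
exact: (comp_eq (comp_parent hR' hN) (comp_w tM hM)).
Qed.

Lemma comp_extend a (F D : forall w : world, El w a -> seq (E w)) :
  @comp C a tM F -> @comp C a tM D ->
  @comp C a tM (fun w g => extend (wedges w) (@solve w) (F w g) (D w g)).
Proof.
move=> hF hD; apply: (@comp_filter C a tE); first exact: (comp_edges).
apply: comp_or; first exact: (@comp_mem C _ tE _ _ (comp_v a tE) (comp_w tE hF)).
apply: (@comp_has C (tP a tE) tE).
  exact: (comp_w tE (comp_solve (comp_verts hF) hD)).
have hx := comp_w tE (comp_v a tE); have hy := comp_v (tP a tE) tE.
apply: comp_or; first exact: (comp_eq hx hy).
apply: comp_and; first exact: (comp_eq (comp_fst hx) (comp_snd hy)).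
exact: (comp_eq (comp_snd hx) (comp_fst hy)).
Qed.

Lemma comp_toggle a (e : forall w : world, El w a -> E w) (M D : forall w : world, El w a -> seq (E w)) :
  @comp C a tM M -> @comp C a tE e -> @comp C a tM D ->
  @comp C a tM (fun w g => toggle (M w g) (e w g) (D w g)).
Proof.
move=> hM he hD; apply: (@comp_cat C a tE).
  apply: (@comp_if C a tM (fun w g => e w g \in M w g) (fun w g => [::]) (fun w g => [:: e w g])).
  - exact: (@comp_mem C a tE).
  - exact: (comp_nil).
  - by apply: (@comp_cons C a tE) => //; exact: (comp_nil).
apply: (@comp_filter C a tE) => //; have hx := comp_v a tE.
apply: comp_and; first exact: (comp_neg (comp_eq hx (comp_w tE he))).
exact: (comp_neg (@comp_mem C _ tE _ _ hx (comp_w tE hD))).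
Qed.

Lemma comp_branch a (e : forall w : world, El w a -> E w) (R M D : forall w : world, El w a -> seq (E w)) :
  @comp C a tM R -> @comp C a tM M -> @comp C a tE e -> @comp C a tM D ->
  @comp C a (tL tN) (fun w g =>
    branch (wedges w) (indl (mat w)) (@solve w) (R w g) (M w g) (e w g) (D w g)).
Proof.
move=> hR hM he hD.
have ht := comp_toggle hM he hD; have hx := comp_extend ht hD.
apply: (@comp_if C a (tL tN)
  (fun w g => ok (indl (mat w)) (toggle (M w g) (e w g) (D w g)) &&
     (size (R w g) <= size (extend (wedges w) (@solve w) (toggle (M w g) (e w g) (D w g)) (D w g))))
  (fun w g => [:: (extend (wedges w) (@solve w) (toggle (M w g) (e w g) (D w g)) (D w g), D w g)])
  (fun w g => [::])).
- by apply: comp_and; [exact: (comp_ok)|exact: (@comp_size_leq C a tE tE)].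
- apply: (@comp_cons C a tN); last exact: (comp_nil).
  exact: (comp_pair hx hD).
- exact: (comp_nil).
Qed.

Lemma comp_after a (e : forall w : world, El w a -> E w) (D : forall w : world, El w a -> seq (E w)) :
  @comp C a tE e -> @comp C a tM D -> @comp C a tM (fun w g => after (e w g) (D w g)).
Proof.
move=> he hD; apply: (@comp_rev C a tE).
apply: (@comp_foldl_growth C a tM tE (fun w g => [::]) D
  (fun w g u x => if x == e w g then [::] else x :: u)) => //.
- exact: (comp_nil).
- have hx := comp_v (tP a tM) tE.
  apply: (@comp_if C (tP (tP a tM) tE) tM (fun w q => q.2 == e w q.1.1)
    (fun w q => [::]) (fun w q => q.2 :: q.1.2)).
  + exact: (comp_eq hx (comp_w tE (comp_w tM he))).
  + exact: (comp_nil).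
  + exact: (comp_cons hx (comp_w tE (comp_v a tM))).
have [P hP hp] := comp_out hD.
exists P => // w g u x /(@tsize_mem C w tE (D w g)); have := hp w g.
move=> h1 h2; have := leq_trans h2 h1.
case: ifP => _; first by move=> _; apply: leq_trans (leq_addr _ _); case: (@enc C w tM u).
by rewrite (@tsize_enc_cons C w tE) addnC -addnS leq_add2l.
Qed.

Lemma comp_lawler a (R M D : forall w : world, El w a -> seq (E w)) :
  @comp C a tM R -> @comp C a tM M -> @comp C a tM D ->
  @comp C a (tL tN) (fun w g =>
    lawler (wedges w) (indl (mat w)) (@solve w) (R w g) (M w g) (D w g)).
Proof.
move=> hR hM hD; apply: (@comp_flatten C a tN); apply: (@comp_map C a tE (tL tN)) => //.
have hx := comp_v a tE; have hD' := comp_w tE hD.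
apply: comp_branch => //; [exact: (comp_w tE hR)|exact: (comp_w tE hM)|].
exact: (comp_after).
Qed.

Lemma comp_children a (R K : forall w : world, El w a -> seq (E w))
    (x : forall w : world, El w a -> (seq (E w) * seq (E w))) :
  @comp C a tM R -> @comp C a tM K -> @comp C a tN x ->
  @comp C a (tL tN) (fun w g =>
    children (wedges w) (indl (mat w)) (@solve w) (R w g) (K w g) (x w g)).
Proof.
move=> hR hK hx; apply: (@comp_cat C a tN).
  exact: (comp_lawler hR (comp_fst hx) (comp_snd hx)).
apply: (@comp_map C a tM tN); first exact: (comp_kids hR hK (comp_fst hx)).
exact: (comp_pair (comp_v a tM) (comp_nil C (tP a tM) tE)).
Qed.

Definition tS := tP (tP tM tM) (tL tN).

Lemma comp_step : @comp C tS (tL tN) (fun w q =>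
  step (wedges w) (indl (mat w)) (@solve w) q.1.1 q.1.2 q.2).
Proof.
have h1 : @comp C tS tM (fun w q => q.1.1) := comp_fst (comp_fst (comp_id _ _)).
have h2 : @comp C tS tM (fun w q => q.1.2) := comp_snd (comp_fst (comp_id _ _)).
apply: (@comp_case C tS tN (tL tN) (fun w q => q.2) (fun w q => [::]) (fun w q x W' =>
  children (wedges w) (indl (mat w)) (@solve w) q.1.1 q.1.2 x ++ W')).
- exact: (comp_v).
- exact: (comp_nil).
- have hx := comp_v tS (tP tN (tL tN)).
  apply: (@comp_cat C _ tN); last exact: (comp_snd hx).
  exact: (comp_children (comp_w _ h1) (comp_w _ h2) (comp_fst hx)).
Qed.

Lemma comp_hit : @comp C tS tB (fun w q => hit q.1.2 q.2).
Proof.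
have h2 := comp_w (tP tN (tL tN)) (comp_snd (comp_fst (comp_id C tS))).
apply: (@comp_case C tS tN tB (fun w q => q.2) (fun w q => false) (fun w q x W' =>
  (size q.1.2 <= size x.1) && (size x.1 <= size q.1.2))).
- exact: (comp_v).
- exact: (comp_bool).
- have hx := comp_fst (comp_fst (comp_v tS (tP tN (tL tN)))).
  apply: comp_and; [exact: (@comp_size_leq C _ tE tE _ _ h2 hx)|].
  exact: (@comp_size_leq C _ tE tE _ _ hx h2).
Qed.

(** The type [tB] stands in for a unit type; the main program passes [false], whose code is
    [Leaf]. *)
Lemma comp_root : @comp C tB tM (fun w _ => extend (wedges w) (@solve w) [::] (wedges w)).
Proof. apply: comp_extend; [exact: (comp_nil)|exact: (comp_edges)]. Qed.

End AlgorithmComp.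

(** * Exchanges in matroid matchings *)

(* lia splits on every boolean hypothesis that it finds *)
Ltac nlia :=
  repeat match goal with
  | H : is_true ?b |- _ => lazymatch b with leq _ _ => fail | _ => clear H end
  | H : forall _, _ |- _ => clear H
  end; lia.

Lemma disjoint_set2 (S : finType) (x y : S) (X : {set S}) :
  [disjoint [set x; y] & X] = (x \notin X) && (y \notin X).
Proof. by rewrite -!disjoints1 -!setI_eq0 setIUl setU_eq0. Qed.

Section MatroidMatching.
Variables (S : finType) (A : matroid S) (G : graph S).
Local Notation I := (indep A).
Local Notation EG := (edges G).
Implicit Types (X Y Z : {set S}) (F R : {set {set S}}).

Lemma indep_extend X Y : X \in I -> Y \in I -> #|X| <= #|Y| ->
  exists Z, [/\ X \subset Z, Z \subset X :|: Y, Z \in I & #|Z| = #|Y|].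
Proof.
move=> hX hY; move: {2}(#|Y| - #|X|) (erefl (#|Y| - #|X|)) => k.
elim: k X hX => [|k IH] X hX hk le.
  by exists X; split=> //; [exact: subsetUl|nlia].
have [|x /setDP[xY xX] hx] := indep_aug hX hY; first by nlia.
have cx : #|x |: X| = #|X|.+1 by rewrite cardsU1 xX.
have [||Z [h1 h2 h3 h4]] := IH _ hx; rewrite ?cx; try nlia.
exists Z; split=> //; first exact: subset_trans (subsetUr _ _) h1.
apply: subset_trans h2 _; rewrite !subUset sub1set inE xY orbT subsetUl /=.
exact: subsetUr.
Qed.

Lemma card_cover_matching F : matching I EG F -> #|cover F| = 2 * #|F|.
Proof.
case/and3P=> sF /eqP <- _; rewrite mulnC -sum_nat_const.
by apply: eq_bigr => e eF; rewrite (edges2 (subsetP sF e eF)).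
Qed.

Lemma coverS F R : F \subset R -> cover F \subset cover R.
Proof. by move=> sF; apply/bigcupsP => e eF; apply: bigcup_sup; exact: (subsetP sF). Qed.

Lemma matchingS F R : matching I EG R -> F \subset R -> matching I EG F.
Proof.
case/and3P=> sR tR iR sF; apply/and3P; split.
- exact: subset_trans sF sR.
- exact: trivIsetS sF tR.
- exact: indep_sub (coverS sF) iR.
Qed.

Lemma coverU1 e F : cover (e |: F) = e :|: cover F.
Proof. by rewrite /cover bigcup_setU big_set1. Qed.

Lemma trivIsetU1' (e : {set S}) F : trivIset F -> [disjoint e & cover F] -> trivIset (e |: F).
Proof.
move=> tF d; have d' B : B \in F -> [disjoint e & B].
  move=> BF; apply: disjointWr d; exact: bigcup_sup.
apply/trivIsetP=> X Y /setU1P[->|XF] /setU1P[->|YF] ne; rewrite ?eqxx // in ne *.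
- exact: d'.
- by rewrite disjoint_sym; exact: d'.
- exact: (trivIsetP tF).
Qed.

Lemma matchingU1 (e : {set S}) F : matching I EG F -> e \in EG -> [disjoint e & cover F] ->
  e :|: cover F \in I -> matching I EG (e |: F).
Proof.
case/and3P=> sF tF _ eE d iX; apply/and3P; split.
- by rewrite subUset sub1set eE.
- exact: trivIsetU1'.
- by rewrite coverU1.
Qed.

Lemma disjoint_matching (e : {set S}) F : matching I EG F -> e \in F -> [disjoint e & cover (F :\ e)].
Proof.
case/and3P=> _ tF _ eF; apply/bigcup_disjointP => B /setD1P[ne BF].
by rewrite disjoint_sym; apply: (trivIsetP tF) => //; rewrite eq_sym.
Qed.

(* If y is not covered by F, then V(F :&: R) plus the two ends of f is inside
   V(R), hence independent, and extends to all of V(F) :|: f but one vertex z;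
   the edge of F at z is the one that f replaces. *)
Lemma exchange F R : maximal_matching I EG F -> matching I EG R -> #|F| < #|R| ->
  exists e f, [/\ e \in F :\: R, f \in R :\: F & matching I EG (f |: (F :\ e))].
Proof.
move=> /andP[hF /forall_inP mF] hR lt.
have /and3P[sF tF iF] := hF; have /and3P[sR tR iR] := hR.
have cF := card_cover_matching hF; have cR := card_cover_matching hR.
have [|x /setDP[xR xF] ix] := indep_aug iF iR; first by nlia.
have [f fR xf] := bigcupP xR.
have fF : f \notin F by apply: contra xF => fF; apply/bigcupP; exists f.
have fE := subsetP sR f fR.
have cf := edges2 fE.
have [y yx def_f] : exists2 y, y != x & f = [set x; y].
  have /eqP/cards1P[y fy] : #|f :\ x| = 1 by move: cf; rewrite (cardsD1 x f) xf => -[].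
  exists y; last by rewrite -(setD1K xf) fy.
  by have := set11 y; rewrite -fy => /setD1P[].
suff [e [eF eR d ie]] : exists e : {set S}, [/\ e \in F, e \notin R,
    [disjoint f & cover (F :\ e)] & f :|: cover (F :\ e) \in I].
  exists e, f; rewrite !inE eF eR fR fF; split=> //.
  by apply: matchingU1 => //; apply: matchingS hF (subD1set _ _).
have sD (e : {set S}) : cover (F :\ e) \subset cover F := coverS (subD1set F e).
(* If [y] is covered, the edge of [F] at [y] is the one to remove: it meets [f] without being [f],
   so it is not in [R], and what remains lies inside [x |: cover F]. *)
have [yF|yF] := boolP (y \in cover F).
  have [e eF ye] := bigcupP yF; have de := disjoint_matching hF eF.
  exists e; split=> //.
  - apply/negP=> eR; have ef : e != f by apply: contraNneq fF => <-.
    have := trivIsetP tR _ _ eR fR ef => /disjoint_setI0/setP/(_ y).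
    by rewrite !inE ye def_f !inE eqxx orbT.
  - rewrite def_f disjoint_set2 (contra (subsetP (sD e) x) xF) /=.
    by rewrite (disjointFr de ye).
  - apply: indep_sub ix; rewrite def_f !subUset !sub1set !inE eqxx yF orbT /=.
    exact: subset_trans (sD e) (subsetUr _ _).
have df : [disjoint f & cover F].
  by rewrite def_f disjoint_set2 xF.
have [X defX] : exists X, X = cover (F :&: R) :|: f by eexists.
have sX : X \subset cover R.
  by rewrite defX subUset coverS ?subsetIr //=; exact: bigcup_sup.
have iX := indep_sub sX iR.
have ci : f :|: cover F \notin I.
  have := mF f; rewrite inE fF fE => /(_ isT); apply: contra.
  exact: matchingU1.
have cU : #|f :|: cover F| = 2 * #|F| + 2.
  by rewrite cardsU (disjoint_setI0 df) cards0 cf cF subn0 addnC.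
have sXU : X \subset f :|: cover F.
  by rewrite defX subUset subsetUl andbT (subset_trans _ (subsetUr _ _)) // coverS // subsetIl.
(* By maximality of [F] the set [f :|: cover F] is dependent, whereas [X] is independent; so the
   inclusion is strict and [X] can be extended to size [2 * #|F| + 1]. *)
have cX : #|X| < 2 * #|F| + 2.
  rewrite -cU ltn_neqAle subset_leq_card // andbT; apply: contra ci => /eqP e.
  by have /eqP <- : X == f :|: cover F; rewrite // eqEcard sXU e leqnn.
have cx : #|x |: cover F| = 2 * #|F| + 1 by rewrite cardsU1 xF cF; nlia.
have [|Z [h1 h2 h3 h4]] := indep_extend iX ix; first by rewrite cx; nlia.
have sZ : Z \subset f :|: cover F.
  apply: subset_trans h2 _; rewrite subUset sXU /=.
  by apply: setSU; rewrite sub1set.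
have /cards1P[z hz] : #|(f :|: cover F) :\: Z| == 1.
  by rewrite cardsD (setIidPr sZ) cU h4 cx; nlia.
have : z \in (f :|: cover F) :\: Z by rewrite hz set11.
rewrite inE => /andP[zZ]; rewrite inE.
have zX : z \notin X by apply: contra zZ; exact: (subsetP h1).
rewrite defX inE negb_or in zX; have /andP[zR zf] := zX; rewrite (negPf zf) /= => zF.
have [e eF ze] := bigcupP zF; exists e; split=> //.
- by apply: contra zR => eR; apply/bigcupP; exists e; rewrite // inE eF.
- exact: disjointWr (sD e) df.
- apply: indep_sub h3; apply/subsetP => u hu.
  have : u \notin (f :|: cover F) :\: Z.
    rewrite hz inE; apply: contraTneq hu => ->; rewrite inE (negPf zf) /=.
    by rewrite (disjointFr (disjoint_matching hF eF) ze).
  have : u \in f :|: cover F by apply: subsetP hu; apply: setUS.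
  by move=> hU; rewrite inE hU andbT negbK.
Qed.

(* Of the six ends of f, g, h at least four would extend V(F) independently, so
   both ends of one of these edges would. *)
Lemma two_more F e f g h : maximal_matching I EG F -> e \in F ->
  matching I EG (h |: (g |: (f |: (F :\ e)))) ->
  f \notin F :\ e -> g \notin f |: (F :\ e) -> h \notin g |: (f |: (F :\ e)) -> False.
Proof.
move=> /andP[hF /forall_inP mF] eF hH nf ng nh.
have cF := card_cover_matching hF; have cH := card_cover_matching hH.
have /and3P[sF tF iF] := hF; have /and3P[sH tH iH] := hH.
have c1 : #|h |: (g |: (f |: (F :\ e)))| = #|F| + 2.
  by rewrite !cardsU1 nh ng nf (cardsD1 e F) eF; nlia.
have [|Z [h1 h2 h3 h4]] := indep_extend iF iH; first by rewrite cF cH c1; nlia.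
have notboth b : b \in EG -> ~~ (b \subset Z :\: cover F).
  move=> bE; apply/negP=> sb.
  have db : [disjoint b & cover F].
    by apply: disjointWl sb _; rewrite -setI_eq0 setIDAC setDIl setDv setI0.
  have bF : b \notin F.
    apply/negP=> bF; have /setIidPl e0 : b \subset cover F := bigcup_sup b bF.
    by have := edges2 bE; rewrite -e0 (disjoint_setI0 db) cards0.
  have := mF b; rewrite inE bF bE => /(_ isT)/negP; apply.
  apply: matchingU1 => //; apply: indep_sub h3; rewrite subUset h1 andbT.
  exact: subset_trans sb (subsetDl _ _).
have few b : b \in EG -> #|b :&: (Z :\: cover F)| <= 1.
  move=> bE; have := subset_leq_card (subsetIl b (Z :\: cover F)).
  rewrite (edges2 bE) leq_eqVlt => /orP[/eqP c|//].
  have /negP[] := notboth b bE; apply/setIidPl/eqP; rewrite eqEcard subsetIl.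
  by rewrite c (edges2 bE).
have [fE gE hE] : [/\ f \in EG, g \in EG & h \in EG].
  by split; apply: (subsetP sH); rewrite !inE eqxx ?orbT.
have : Z :\: cover F \subset (f :&: (Z :\: cover F)) :|: (g :&: (Z :\: cover F))
    :|: (h :&: (Z :\: cover F)).
  apply/subsetP=> u hu; have /setDP[uZ uF] := hu.
  have := subsetP h2 u uZ; rewrite inE (negPf uF) /= !coverU1.
  rewrite -!setIUl in_setI hu andbT !in_setU.
  have -> : u \in cover (F :\ e) = false.
    by apply: contraNF uF; apply: subsetP; exact: coverS (subD1set _ _).
  by rewrite orbF => /or3P[] ->; rewrite ?orbT.
(* The left side has four elements, while each of the three edges contributes at most one. *)
move/subset_leq_card; rewrite cardsD (setIidPr h1) h4 cF cH c1.
have := few f fE; have := few g gE; have := few h hE.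
rewrite !cardsU; nlia.
Qed.

(** If the exchanged matching is already maximal, the gain is [f] in [R] in place of [e] outside
    [R]. Otherwise one more edge gives a larger matching, which is maximal by [two_more]. The choice
    [g = f] stands for adding nothing. *)
Lemma parent_step F R : maximal_matching I EG F -> matching I EG R -> #|F| < #|R| ->
  exists e f g, let F' := g |: (f |: (F :\ e)) in
  [/\ [/\ e \in F, f \in EG :\: F, g \in EG & g = f \/ g \notin f |: F],
      maximal_matching I EG F'
    & #|F| < #|F'| \/ #|F'| = #|F| /\ #|F :&: R| < #|F' :&: R|].
Proof.
move=> mF hR lt; have [e [f [/setDP[eF eR] /setDP[fR fF] hM]]] := exchange mF hR lt.
have /and3P[sR _ _] := hR; have fE := subsetP sR f fR.
have hF : matching I EG F by case/andP: mF.
set M := f |: (F :\ e) in hM.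
have fF' : f \notin F :\ e by rewrite inE (negPf fF) andbF.
have cM : #|M| = #|F| by rewrite cardsU1 fF' (cardsD1 e F) eF.
have [mM|] := boolP (maximal_matching I EG M).
  exists e, f, f; have -> : f |: M = M by rewrite setUA setUid.
  split=> //; first by split; rewrite ?inE ?fF //; left.
  right; split=> //.
  have -> : M :&: R = f |: (F :&: R).
    apply/setP=> u; rewrite /M !inE; case: (u =P f) => [->|_]; first by rewrite fR.
    by case: (u =P e) => [->|//]; rewrite (negPf eR) !andbF.
  by rewrite cardsU1 !inE (negPf fF).
rewrite /maximal_matching hM /= negb_forall_in => /exists_inP[g /setDP[gE gM]].
rewrite negbK => hg; exists e, f, g.
(* The added edge is not the removed one: otherwise [f |: F] would be a matching, against the
   maximality of [F]. *)
have gF : g \notin f |: F.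
  apply/negP; rewrite !inE => /orP[/eqP gf|gF]; first by rewrite gf !inE eqxx in gM.
  have ge : g = e by apply/eqP; apply: contraNT gM => ne; rewrite !inE ne gF orbT.
  have : f |: F \subset g |: M.
    by rewrite ge /M setUCA setD1K.
  move/(matchingS hg); have /andP[_ /forall_inP/(_ f)] := mF.
  by rewrite inE fF fE => /(_ isT)/negP.
split=> //; first by split=> //; [rewrite inE fF|right].
- rewrite /maximal_matching hg /=; apply/forall_inP => h /setDP[hE hn]; apply/negP => hh.
  exact: two_more mF eF hh fF' gM hn.
- by left; rewrite cardsU1 gM cM.
Qed.

(** An independent [X] is its own only base, so the existential in [contract] reduces to this
    base. *)
Lemma matching_contract X (D : {set {set S}}) F : X \in I ->
  matching (contract I X) D F =
  [&& F \subset D, trivIset F, cover F \subset ~: X & cover F :|: X \in I].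
Proof.
move=> iX; rewrite /matching inE; congr [&& _, _, _ & _].
apply/existsP/idP=> [[B /andP[/maxsetP[hB mB] iB]]|h]; last first.
  exists X; rewrite h andbT; apply/maxsetP; rewrite !inE iX subxx; split=> // B.
  by rewrite !inE => /andP[_ s1] s2; apply/eqP; rewrite eqEsubset s1.
move: hB; rewrite !inE => /andP[_ sB].
by rewrite (mB X) // !inE iX subxx.
Qed.

End MatroidMatching.

(** * The search tree *)

Lemma edge_of_eq (S : finType) (x y : S * S) :
  (edge_of x == edge_of y) = same_edge x y.
Proof.
case: x y => [a b] [c d]; rewrite /same_edge /edge_of /= xpair_eqE.
apply/eqP/idP => [/setP e|/orP[] /andP[/eqP-> /eqP->] //]; last by rewrite setUC.
have := e a; have := e b; have := e c; have := e d.
rewrite !inE !eqxx ?orbT /= [d == a]eq_sym [d == b]eq_sym [c == a]eq_sym [c == b]eq_sym.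
by do 4 case: (_ == _).
Qed.

Section Enumeration.
Variables (S : finType) (A : matroid S) (G : graph S) (Es : seq (S * S)).
Hypothesis hEs : lists_edges Es (edges G).
Local Notation I := (indep A).
Local Notation EG := (edges G).
Local Notation E := (S * S)%type.
Local Notation ind := (indl A).
Implicit Types (e f : E) (M N F D K Z : seq E).

Definition Mset M : {set {set S}} := [set edge_of e | e in M].

Lemma Es_uniq : uniq Es.
Proof. by case/andP: hEs => /map_uniq. Qed.

Lemma Es_edge e : e \in Es -> edge_of e \in EG.
Proof. by case/andP: hEs => _ /eqP <- eE; rewrite inE map_f. Qed.

Lemma edge_Es X : X \in EG -> exists2 e, e \in Es & X = edge_of e.
Proof. by case/andP: hEs => _ /eqP <-; rewrite inE => /mapP. Qed.

Lemma edge_of_inj : {in Es &, injective (@edge_of S)}.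
Proof.
case/andP: hEs => u _ e f eE fE ef.
have l := eq_irrelevance; move/(uniqP set0): u => u.
have := u (index e Es) (index f Es); rewrite !inE size_map !index_mem => /(_ eE fE).
rewrite !(nth_map e) ?index_mem // !nth_index // => /(_ ef) h.
by rewrite -(nth_index e eE) -(nth_index e fE) h.
Qed.

Lemma mem_Mset M e : {subset M <= Es} -> e \in Es -> (edge_of e \in Mset M) = (e \in M).
Proof.
move=> sM eE; apply/imsetP/idP => [[f fM ef]|]; last by exists e.
by rewrite (edge_of_inj eE (sM _ fM) ef).
Qed.

Lemma Mset_cons e M : Mset (e :: M) = edge_of e |: Mset M.
Proof.
apply/setP=> X; rewrite !inE; apply/imsetP/orP=> [[f]|[/eqP->|/imsetP[f fM ->]]].
- by rewrite inE => /predU1P[-> ->|fM ->]; [left|right; apply: imset_f].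
- by exists e; rewrite ?mem_head.
- by exists f; rewrite // inE fM orbT.
Qed.

Lemma cover_Mset M : cover (Mset M) = [set x in verts M].
Proof.
elim: M => [|e M IH].
  by apply/setP=> x; rewrite !inE; apply/bigcupP => -[X /imsetP[e]].
rewrite Mset_cons coverU1 IH /verts /=; apply/setP=> x.
by rewrite !inE orbA.
Qed.

(** Sublists of [Es] in the order of [Es] represent each set of edges once, so matchings can be
    compared as lists. *)
Definition canon M : bool := M == [seq x <- Es | x \in M].

Lemma canon_filter (p : pred E) : canon [seq x <- Es | p x].
Proof. by apply/eqP/eq_in_filter => x xE; rewrite mem_filter xE andbT. Qed.

Lemma canon_sub M : canon M -> {subset M <= Es}.
Proof. by move/eqP-> => x; rewrite mem_filter => /andP[]. Qed.

Lemma canon_uniq M : canon M -> uniq M.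
Proof. by move/eqP->; rewrite filter_uniq // Es_uniq. Qed.

Lemma canon_eq M N : canon M -> canon N -> {in Es, M =i N} -> M = N.
Proof. by move=> /eqP cM /eqP cN h; rewrite cM cN; apply/eq_in_filter. Qed.

Lemma size_Mset M : {subset M <= Es} -> uniq M -> #|Mset M| = size M.
Proof.
move=> sM uM; rewrite card_in_imset; first exact/card_uniqP.
by move=> e f /sM eE /sM fE; exact: edge_of_inj.
Qed.

Lemma disj_edge e f : disj e f = [disjoint edge_of e & edge_of f].
Proof.
by rewrite /edge_of disjoint_set2 !inE !negb_or -!andbA /disj; do 4 case: (_ == _).
Qed.

Lemma ok_matching M : {subset M <= Es} -> ok ind M = matching I EG (Mset M).
Proof.
move=> sM; rewrite /ok /matching cover_Mset -/(ind _) andbA; congr (_ && _).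
have -> : Mset M \subset EG by apply/subsetP=> _ /imsetP[e /sM /Es_edge eE ->].
apply/allP/trivIsetP => [h _ _ /imsetP[e eM ->] /imsetP[f fM ->] ne|h e eM].
  have /allP/(_ f fM) := h e eM; rewrite disj_edge => /orP[/eqP ef|//].
  by rewrite ef eqxx in ne.
apply/allP=> f fM; case: eqVneq => //= ne; rewrite disj_edge.
apply: h; try exact: imset_f.
by apply: contra ne => /eqP ef; rewrite (edge_of_inj (sM _ eM) (sM _ fM) ef).
Qed.

Lemma mxl_maximal M : {subset M <= Es} -> mxl Es ind M = maximal_matching I EG (Mset M).
Proof.
move=> sM; rewrite /mxl ok_matching //; congr (_ && _).
apply/allP/forall_inP => [h X /setDP[XE XM]|h e eE].
  have [e eE Xe] := edge_Es XE; have := h e eE.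
  rewrite Xe (mem_Mset sM eE) in XM *; rewrite (negPf XM) /= ok_matching ?Mset_cons //.
  by move=> x; rewrite inE => /predU1P[->|/sM].
case: (boolP (e \in M)) => //= eM; rewrite ok_matching ?Mset_cons.
  by apply: h; rewrite inE mem_Mset // eM Es_edge.
by move=> x; rewrite inE => /predU1P[->|/sM].
Qed.

Lemma okS M N : {subset N <= Es} -> {subset M <= N} -> ok ind N -> ok ind M.
Proof.
move=> sN sM; rewrite !ok_matching //; last by move=> x /sM /sN.
by move/matchingS; apply; apply: imsetS; apply/subsetP.
Qed.

Lemma ok_nil : ok ind [::].
Proof. by rewrite /ok /= /indl /verts /= set_nil indep0. Qed.

Variable solve : seq S -> seq E -> seq E.
Hypothesis hsolve : forall X H, exists2 N,
  maximum_matching (contract I [set x in X]) [set edge_of e | e in avoid Es X H] N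
  & lists_edges (solve X H) N.

Local Notation extend := (extend Es solve).

(** Contracting the vertices of [F] makes the solver return what can be added to [F]. The result is
    largest because a competitor [Z] without the edges of [F] is again a matching of the
    contraction. *)
Lemma extend_spec F D : {subset F <= Es} -> {subset D <= Es} -> ok ind F ->
  [/\ canon (extend F D), ok ind (extend F D), {subset F <= extend F D},
      forall x, x \in extend F D -> (x \in F) || (x \in D)
    & forall Z, uniq Z -> {subset Z <= Es} -> ok ind Z -> {subset F <= Z} ->
        (forall x, x \in Z -> (x \in F) || (x \in D)) -> size Z <= size (extend F D)].
Proof.
move=> sF sD okF; have [N /andP[hN /forallP mN] lN] := hsolve (verts F) D.
have cN : canon (extend F D) := canon_filter _.
have sX := canon_sub cN.
have fN : {subset F <= extend F D}.
  by move=> x xF; rewrite mem_filter xF /= sF.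
have mF : matching I EG (Mset F) by rewrite -ok_matching.
have iF : [set x in verts F] \in I by rewrite -cover_Mset; case/and3P: mF.
have memN x : x \in Es -> (edge_of x \in N) = has (same_edge x) (solve (verts F) D).
  move=> _; have /andP[_ /eqP <-] := lN; rewrite inE; apply/mapP/hasP => -[y yN h]; exists y => //.
    by rewrite -edge_of_eq h.
  by apply/eqP; rewrite edge_of_eq.
rewrite matching_contract // in hN; have /and4P[sN tN dN iN] := hN.
have NE X : X \in N -> exists2 e, X = edge_of e & [/\ e \in Es, e \in D, e.1 \notin verts F & e.2 \notin verts F].
  move/(subsetP sN)/imsetP => [e]; rewrite mem_filter => /andP[/and3P[h1 h2 h3] h4] ->.
  by exists e.
have EN : Mset (extend F D) = Mset F :|: N.
  apply/setP=> X; rewrite in_setU; apply/imsetP/orP => [[x] xe ->|].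
    have xE := sX x xe; move: xe; rewrite mem_filter xE andbT => /orP[xF|h].
      by left; apply: imset_f.
    by right; rewrite memN.
  case=> [/imsetP[x xF ->]|XN]; first by exists x => //; exact: fN.
  have [e Xe [eE _ _ _]] := NE X XN; exists e => //.
  by rewrite mem_filter eE -memN // -Xe XN orbT.
have dFN : [disjoint cover (Mset F) & cover N].
  by rewrite cover_Mset disjoint_sym disjoints_subset.
have dFN' : Mset F :&: N = set0.
  apply/setP=> X; rewrite !inE; apply/negP=> /andP[XF XN].
  have [e Xe [eE _ /negP n1 _]] := NE X XN; apply: n1.
  have : e.1 \in cover (Mset F) by apply/bigcupP; exists X; rewrite // Xe !inE eqxx.
  by rewrite cover_Mset inE.
have okN : ok ind (extend F D).
  rewrite ok_matching // EN; have /and3P[s1 t1 i1] := mF.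
  apply/and3P; split.
  - rewrite subUset s1; apply/subsetP=> X /NE[e -> [eE _ _ _]]; exact: Es_edge.
  - exact: trivIsetU.
  - by rewrite /cover bigcup_setU -/(cover _) -/(cover _) cover_Mset setUC.
split=> // [x|Z uZ sZ okZ FZ ZFD].
  rewrite mem_filter => /andP[/orP[->//|h] xE].
  have [e xe [eE eD _ _]] : exists2 e, edge_of x = edge_of e & [/\ e \in Es, e \in D, e.1 \notin verts F & e.2 \notin verts F].
    by apply: NE; rewrite memN.
  by rewrite (edge_of_inj xE eE xe) eD orbT.
have mZ : matching I EG (Mset Z) by rewrite -ok_matching.
have sFZ : Mset F \subset Mset Z by apply: imsetS; apply/subsetP.
have mT : matching (contract I [set x in verts F]) [set edge_of e | e in avoid Es (verts F) D]
    (Mset Z :\: Mset F).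
  have /and3P[s1 t1 i1] := mZ.
  have d : cover (Mset Z :\: Mset F) \subset ~: [set x in verts F].
    rewrite -disjoints_subset -cover_Mset; apply/bigcup_disjointP => X XF.
    rewrite disjoint_sym; apply/bigcup_disjointP => Y /setDP[YZ YF].
    apply: (trivIsetP t1) => //; first exact: (subsetP sFZ).
    by apply: contraNneq YF => <-.
  rewrite matching_contract //; apply/and4P; split=> //.
  - apply/subsetP=> X XZF; have /setDP[/imsetP[e eZ Xe] XF] := XZF.
    have eF : e \notin F by apply: contra XF => eF; rewrite Xe imset_f.
    have av v : v \in X -> v \notin verts F.
      move=> vX; have : v \in cover (Mset Z :\: Mset F) by apply/bigcupP; exists X.
      by move/(subsetP d); rewrite !inE.
    rewrite Xe; apply: imset_f; rewrite mem_filter sZ // andbT.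
    have := ZFD e eZ; rewrite (negPf eF) /= => ->.
    by rewrite !av // Xe !inE eqxx ?orbT.
  - exact: trivIsetS (subsetDl _ _) t1.
  - apply: indep_sub i1; rewrite -cover_Mset subUset.
    by rewrite !coverS ?subsetDl.
have := mN (Mset Z :\: Mset F); rewrite mT implyTb cardsD (setIidPr sFZ) => le.
have cE := size_Mset sX (canon_uniq cN); rewrite EN cardsU dFN' cards0 subn0 in cE.
by rewrite -cE -(size_Mset sZ uZ) -leq_subLR.
Qed.

End Enumeration.

Lemma size_flatten_const (T U : Type) (F : T -> seq U) k s :
  (forall x, size (F x) = k) -> size (flatten [seq F x | x <- s]) = size s * k.
Proof. by move=> h; elim: s => //= x s IH; rewrite size_cat h IH. Qed.

(** Lexicographic order as order of two-digit numbers in base [m.+1]; only the low digit of the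
    smaller number has to be bounded. *)
Lemma lex_lt a b c d m :
  c <= m -> (a < b) || (a <= b) && (c < d) -> a * m.+1 + c < b * m.+1 + d.
Proof. by move=> cm /orP[|/andP[]]; nia. Qed.

(** * Parents, ancestors and the partition of the maximum matchings *)

Section Tree.
Variables (S : finType) (A : matroid S) (G : graph S) (Es : seq (S * S)).
Hypothesis hEs : lists_edges Es (edges G).
Variable solve : seq S -> seq (S * S) -> seq (S * S).
Hypothesis hsolve : forall X H, exists2 N,
  maximum_matching (contract (indep A) [set x in X]) [set edge_of e | e in avoid Es X H] N
  & lists_edges (solve X H) N.
Local Notation E := (S * S)%type.
Local Notation ind := (indl A).
Local Notation extend := (extend Es solve).
Implicit Types (e f : E) (M N F D K Z : seq E).

Definition Rt : seq E := extend [::] Es.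

Lemma Rt_spec : [/\ canon Es Rt, ok ind Rt &
  forall Z, uniq Z -> {subset Z <= Es} -> ok ind Z -> size Z <= size Rt].
Proof.
have s0 : {subset [::] <= Es} by [].
have s1 : {subset Es <= Es} by [].
have [h1 h2 _ _ h3] := extend_spec hEs hsolve s0 s1 (ok_nil A).
by split=> // Z u s o; apply: h3 => // x /s ->; rewrite ?orbT.
Qed.

Definition sol Z := canon Es Z && mxl Es ind Z.
Definition full Z := size Rt <= size Z.

Lemma full_mxl Z : canon Es Z -> ok ind Z -> full Z -> mxl Es ind Z.
Proof.
move=> cZ oZ fZ; rewrite /mxl oZ; apply/allP => e eE.
have [//|eZ] := boolP (e \in Z); apply/negP => o.
have [_ _ /(_ (e :: Z))] := Rt_spec; rewrite /= eZ (canon_uniq hEs cZ) o.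
have s : {subset e :: Z <= Es}.
  by move=> x; rewrite inE => /predU1P[->|/(canon_sub cZ)].
by move=> /(_ isT s isT); rewrite leqNgt /= ltnS -/(full Z) fZ.
Qed.

Lemma flip_canon M e f h : canon Es (flip Es M e f h).
Proof. exact: canon_filter. Qed.

Lemma mem_flip M e f h x : x \in Es ->
  (x \in flip Es M e f h) = (x \in M) (+) [|| x == e, x == f | x == h].
Proof. by move=> xE; rewrite mem_filter xE andbT. Qed.

Lemma nbrsP M N : reflect (exists e f h, [/\ e \in Es, f \in Es, h \in Es & N = flip Es M e f h])
  (N \in nbrs Es M).
Proof.
apply: (iffP flatten_mapP) => [[e eE /flatten_mapP[f fE /mapP[h hE ->]]]|[e [f [h [eE fE hE ->]]]]].
  by exists e, f, h.
by exists e => //; apply/flatten_mapP; exists f => //; apply: map_f.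
Qed.

Lemma nbrs_canon M N : N \in nbrs Es M -> canon Es N.
Proof. by move=> /nbrsP[e [f [h [_ _ _ ->]]]]; exact: flip_canon. Qed.

Lemma nbrs_sym M N : canon Es M -> N \in nbrs Es M -> M \in nbrs Es N.
Proof.
move=> cM /nbrsP[e [f [h [eE fE hE ->]]]]; apply/nbrsP; exists e, f, h; split=> //.
apply: canon_eq cM (flip_canon _ _ _ _) _ => x xE.
by rewrite !mem_flip // -addbA addbb addbF.
Qed.

Lemma size_nbrs M : size (nbrs Es M) = size Es * (size Es * size Es).
Proof.
rewrite /nbrs; do 2 (apply: size_flatten_const => ?).
by rewrite size_map.
Qed.

Lemma size_common M : canon Es M -> size (common Rt M) = #|Mset M :&: Mset Rt|.
Proof.
move=> cM; have sM := canon_sub cM; have [cR _ _] := Rt_spec.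
rewrite -(size_Mset hEs (M := common Rt M)).
- apply: eq_card => X; rewrite in_setI; apply/imsetP/andP.
    by case=> e; rewrite mem_filter => /andP[eR eM] ->; split; apply: imset_f.
  case=> /imsetP[e eM ->]; rewrite (mem_Mset hEs (canon_sub cR) (sM e eM)) => eR.
  by exists e; rewrite // mem_filter eR.
- by move=> x; rewrite mem_filter => /andP[_ /sM].
- by rewrite filter_uniq // (canon_uniq hEs cM).
Qed.

Lemma size_common_le M : canon Es M -> size (common Rt M) <= size Es.
Proof.
move=> cM; rewrite size_filter; apply: leq_trans (count_size _ _) _.
by apply: uniq_leq_size; [exact: (canon_uniq hEs cM)|exact: canon_sub].
Qed.

Lemma size_canon M : canon Es M -> size M <= size Es.
Proof. by move=> cM; apply: uniq_leq_size; [exact: (canon_uniq hEs cM)|exact: canon_sub]. Qed.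

(** On lists the exchange of [parent_step] is one [flip], since [e] is in [M] while [f] and [h] are
    not. If nothing is added then [h = f], which the disjunction in [flip] switches only once. *)
Lemma better_exists M : sol M -> ~~ full M -> exists2 N, N \in nbrs Es M & better Es ind Rt M N.
Proof.
case/andP=> cM mM nM; have [cR oR _] := Rt_spec.
have sM := canon_sub cM; have sR := canon_sub cR.
rewrite (mxl_maximal A hEs sM) in mM; rewrite (ok_matching A hEs sR) in oR.
have lt : #|Mset M| < #|Mset Rt|.
  by rewrite !(size_Mset hEs) // ?(canon_uniq hEs) // ltnNge.
have [X [Y [W [[XM YM WE YW] mx gt]]]] := parent_step mM oR lt.
have [e eM Xe] := imsetP XM; have eE := sM e eM.
have /setDP[/(edge_Es hEs)[f fE Yf] YM'] := YM.
have [h hE Wh] := edge_Es hEs WE.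
rewrite Yf (mem_Mset hEs sM fE) in YM'.
have hM : h \notin M.
  case: YW => [|]; rewrite Wh Yf; first by move/(edge_of_inj hEs hE fE) ->.
  by rewrite !inE negb_or (mem_Mset hEs sM hE) => /andP[].
have ef : (e == f) = false by apply: contraNF YM' => /eqP <-.
have eh : (e == h) = false by apply: contraNF hM => /eqP <-.
pose N := flip Es M e f h; have cN : canon Es N := flip_canon _ _ _ _.
have sN := canon_sub cN.
have EN : Mset N = W |: (Y |: (Mset M :\ X)).
  apply/setP=> Q; have [/(edge_Es hEs)[x xE ->]|QE] := boolP (Q \in edges G); last first.
    transitivity false.
      by apply: contraNF QE => /imsetP[x /sN xE ->]; exact: (Es_edge hEs).
    apply/esym; apply: contraNF QE; rewrite !inE => /or3P[/eqP->//|/eqP->|/andP[_]].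
      by rewrite Yf; exact: (Es_edge hEs).
    by case/imsetP=> x /sM xE ->; exact: (Es_edge hEs).
  have eqE y : y \in Es -> (edge_of x == edge_of y) = (x == y).
    by move=> yE; apply/eqP/eqP => [/(edge_of_inj hEs xE yE)|->].
  rewrite (mem_Mset hEs sN xE) mem_flip // Wh Yf Xe !inE !eqE // (mem_Mset hEs sM xE).
  case: (x =P e) => [->|_]; first by rewrite eM ef eh.
  case: (x =P h) => [->|_]; first by rewrite (negPf hM) !orbT.
  by case: (x =P f) => [->|_]; rewrite ?(negPf YM') ?addbF.
exists N; first by apply/nbrsP; exists e, f, h.
rewrite /better (mxl_maximal A hEs sN) EN mx /=.
have uN := canon_uniq hEs cN; have uM := canon_uniq hEs cM.
rewrite -EN !(size_Mset hEs) // -!size_common // in gt.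
by rewrite -!ltnNge; case: gt => [->|[-> ->]] //; rewrite leqnn orbT.
Qed.

Lemma parent_spec M : sol M -> ~~ full M ->
  parent Es ind Rt M \in nbrs Es M /\ better Es ind Rt M (parent Es ind Rt M).
Proof.
move=> sM fM; have [N N1 N2] := better_exists sM fM.
have : N \in [seq N <- nbrs Es M | better Es ind Rt M N] by rewrite mem_filter N2.
rewrite /parent; case E : [seq N <- nbrs Es M | better Es ind Rt M N] => [//|N' r] _.
have : N' \in [seq N <- nbrs Es M | better Es ind Rt M N] by rewrite E mem_head.
by rewrite mem_filter => /andP[].
Qed.

(** Size and overlap with [Rt] as two digits in base [(size Es).+1]: this number increases towards
    the parent and stays below [rank_bound], which therefore suffices as fuel. *)
Definition rank M := size M * (size Es).+1 + size (common Rt M).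

Definition rank_bound := (size Es).+1 * (size Es).+1.

Lemma rank_lt M : canon Es M -> rank M < rank_bound.
Proof. by move=> cM; have := size_canon cM; have := size_common_le cM; rewrite /rank /rank_bound; nia. Qed.

Lemma better_rank M N : canon Es M -> better Es ind Rt M N ->
  [/\ mxl Es ind N, size M <= size N & rank M < rank N].
Proof.
move=> cM /andP[mN]; rewrite -!ltnNge => h; split=> //.
  by case/orP: h => [/ltnW|/andP[]].
exact: lex_lt (size_common_le cM) h.
Qed.

Lemma kidsE K M N : (N \in kids Es ind Rt K M) =
  [&& N \in nbrs Es M, mxl Es ind N, size K <= size N, ~~ full N & parent Es ind Rt N == M].
Proof. by rewrite mem_dedup mem_filter andbC. Qed.


(* [anc k M Z] counts the occurrences of M among Z, its parent, its grandparent,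
   and so on; k is fuel. *)
Fixpoint anc k M Z : nat :=
  (M == Z) + (if full Z then 0 else if k is k'.+1 then anc k' M (parent Es ind Rt Z) else 0).

(** With enough fuel, the root of the tree that contains [Z]. *)
Fixpoint top k Z : seq E :=
  if full Z then Z else if k is k'.+1 then top k' (parent Es ind Rt Z) else Z.

Lemma parent_sol Z : sol Z -> ~~ full Z ->
  [/\ sol (parent Es ind Rt Z), size Z <= size (parent Es ind Rt Z),
      rank Z < rank (parent Es ind Rt Z) & Z \in nbrs Es (parent Es ind Rt Z)].
Proof.
move=> sZ fZ; have [nP /better_rank] := parent_spec sZ fZ.
have /andP[cZ mZ] := sZ => /(_ cZ) [mP lP rP]; split=> //; last exact: nbrs_sym.
by rewrite /sol (nbrs_canon nP).
Qed.

Lemma fuel_parent k Z : sol Z -> ~~ full Z -> rank_bound <= rank Z + k ->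
  exists2 k', k = k'.+1 & rank_bound <= rank (parent Es ind Rt Z) + k'.
Proof.
move=> sZ fZ; have [/andP[/rank_lt lt _] _ rP _] := parent_sol sZ fZ.
by case: k => [|k] h; [lia|exists k => //; lia].
Qed.

Lemma sum_kids_full k K M Z : full Z -> \sum_(N <- kids Es ind Rt K M) anc k N Z = 0.
Proof.
move=> fZ; rewrite big1_seq // => N /andP[_]; rewrite kidsE => /and5P[_ _ _ nf _].
by case: k => [|k] /=; rewrite fZ; case: eqP => // e; rewrite e fZ in nf.
Qed.

(** On the way from [Z] to its root, [M] is either [Z] or entered through exactly one of its
    children. No child on this way is pruned, since sizes do not decrease towards the root. *)
Lemma anc_kids k K M Z : sol Z -> size K <= size Z -> rank_bound <= rank Z + k ->
  anc k M Z = (M == Z) + \sum_(N <- kids Es ind Rt K M) anc k N Z.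
Proof.
elim: k Z => [|k IH] Z sZ KZ hk; have [fZ|fZ] := boolP (full Z).
- by rewrite (sum_kids_full _ _ _ fZ) /= fZ.
- by have [k] := fuel_parent sZ fZ hk.
- by rewrite (sum_kids_full _ _ _ fZ) /= fZ.
have [k' [<-] hk'] := fuel_parent sZ fZ hk.
have [sP lP rP nP] := parent_sol sZ fZ.
rewrite /= (negPf fZ) big_split /= (IH _ sP (leq_trans KZ lP) hk'); congr (_ + (_ + _)).
have /andP[cZ mZ] := sZ.
have : (Z \in kids Es ind Rt K M) = (M == parent Es ind Rt Z).
  by rewrite kidsE mZ KZ fZ [M == _]eq_sym /=; case: eqP => [<-|]; rewrite ?nP ?andbF.
(* The children are listed without repetition, so membership of [Z] is a sum of indicators over
   them. *)
move=> <-; rewrite -(count_uniq_mem Z (dedup_uniq _)) -sum1_count big_mkcond /=.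
by apply: eq_bigr => N _; rewrite /= eq_sym; case: eqP.
Qed.

Lemma top_spec k Z : sol Z -> rank_bound <= rank Z + k ->
  [/\ sol (top k Z), full (top k Z) & forall M, full M -> anc k M Z = (M == top k Z)].
Proof.
elim: k Z => [|k IH] Z sZ hk; have [fZ|fZ] := boolP (full Z).
- by rewrite /= fZ; split=> // M _; rewrite addn0.
- by have [k] := fuel_parent sZ fZ hk.
- by rewrite /= fZ; split=> // M _; rewrite addn0.
have [k' [<-] hk'] := fuel_parent sZ fZ hk.
have [sP _ _ _] := parent_sol sZ fZ; rewrite /= (negPf fZ).
have [h1 h2 h3] := IH _ sP hk'; split=> // M fM; rewrite h3 //.
by case: eqP => // e; rewrite -e fM in fZ.
Qed.

(** Membership of [Z] in the part of the partition that the node [(M, D)] represents. *)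
Definition agree D Z M : bool := all (fun x => (x \in D) || ((x \in Z) == (x \in M))) Es.

Lemma mem_toggle M e D x : x \notin D ->
  (x \in toggle M e D) = (if x == e then e \notin M else x \in M).
Proof.
move=> xD; rewrite /toggle mem_cat mem_filter xD andbT.
by case: ifP => eM; rewrite ?inE; case: eqP => //= ->.
Qed.

(** Deciding [e] splits the part of [(M, e :: D)]: agreement with [M] at [e] gives the part of
    [(M, D)], disagreement gives the branch. The matching stored in the branch may be any one of its
    part, because [agree] ignores the edges of [D]. *)
Lemma branch_agree M e D Z : canon Es M -> e \in Es -> {subset D <= Es} -> e \notin D ->
  sol Z -> full Z ->
  agree (e :: D) Z M =
  agree D Z M + \sum_(y <- branch Es ind solve Rt M e D) agree y.2 Z y.1 :> nat.
Proof.
move=> cM eE sD eD /andP[cZ /andP[oZ _]] fZ; have sM := canon_sub cM.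
set F := toggle M e D.
have F_D x : x \in D -> x \notin F.
  move=> xD; rewrite /F /toggle mem_cat mem_filter xD andbF orbF.
  by case: ifP => //; rewrite inE; case: eqP => // xe; rewrite -xe xD in eD.
have sF : {subset F <= Es}.
  move=> x; rewrite /F /toggle mem_cat mem_filter => /orP[|/andP[_ /sM] //].
  by case: ifP => //; rewrite inE => _ /eqP->.
have sZ := canon_sub cZ.
(* The half of the part in which [e] is switched; it remains to show that the branch represents
   it. *)
pose diff := agree (e :: D) Z M && ((e \in Z) != (e \in M)).
have -> : agree (e :: D) Z M = agree D Z M + diff :> nat.
  have [a|a] := boolP (agree D Z M).
    have -> : agree (e :: D) Z M.
      by apply/allP=> x xE; have := allP a x xE; rewrite inE; case: (x == e).
    have := allP a e eE; rewrite (negPf eD) /= => /eqP eq.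
    by rewrite /diff eq eqxx andbF.
  rewrite /diff; have [b|//] := boolP (agree (e :: D) Z M).
  suff -> : (e \in Z) != (e \in M) by [].
  apply: contra a => /eqP eq.
  apply/allP=> x xE; have := allP b x xE; rewrite inE -orbA => /orP[/eqP->|//].
  by rewrite eq eqxx orbT.
have diffE : diff = all (fun x => (x \in D) || ((x \in Z) == (x \in F))) Es.
  apply/andP/allP => [[a ne] x xE|h].
    have [//|xD /=] := boolP (x \in D); rewrite mem_toggle //.
    have := allP a x xE; rewrite inE (negPf xD) orbF.
    case: (x =P e) => [-> _|//]; by move: ne; case: (e \in Z); case: (e \in M).
  split.
    apply/allP=> x xE; have := h x xE; rewrite inE.
    have [//|xD /=] := boolP (x \in D); first by rewrite orbT.
    by rewrite mem_toggle //; case: (x =P e).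
  have := h e eE; rewrite (negPf eD) /= mem_toggle // eqxx => /eqP ->.
  by case: (e \in M).
congr (_ + _); rewrite /branch -/F.
(* Such a [Z] lies between [F] and [F] plus [D], so it competes in [extend_spec]; being of maximum
   size it shows that a discarded branch was empty. *)
have sub : diff -> {subset F <= Z} /\ forall x, x \in Z -> (x \in F) || (x \in D).
  rewrite diffE => /allP h; split=> x xX.
    have xE := sF x xX; have := h x xE; case: (boolP (x \in D)) => [/F_D|_ /= /eqP ->//].
    by rewrite xX.
  have := h x (sZ x xX); rewrite xX; case: (x \in D) => /=; first by rewrite orbT.
  by move/eqP=> <-.
have [okF|okF] /= := boolP (ok ind F); last first.
  rewrite big_nil; case: (boolP diff) => // /sub[FZ _].
  by rewrite (okS hEs sZ FZ oZ) in okF.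
have [cX oX FX XD mx] := extend_spec hEs hsolve sF sD okF.
case: ifP => [le|/negP nle]; last first.
  rewrite big_nil; case: (boolP diff) => // /sub[FZ ZD].
  case: nle; apply: leq_trans fZ _; apply: mx => //.
  exact: (canon_uniq hEs cZ).
rewrite big_seq1 /= diffE; congr (nat_of_bool _); apply: eq_in_all => x xE.
case: (boolP (x \in D)) => //= xD; congr (_ == _); apply/idP/idP=> [/FX //|/XD].
by rewrite (negPf xD) orbF.
Qed.

Lemma after_cat e D1 D2 : uniq (D1 ++ e :: D2) -> after e (D1 ++ e :: D2) = D2.
Proof.
rewrite cat_uniq /= => /and3P[_ _ /andP[n _]].
rewrite /after foldl_cat /= eqxx -[RHS]cats0.
elim/last_ind: D2 n => // D x IH; rewrite mem_rcons inE negb_or eq_sym => /andP[ne n].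
by rewrite foldl_rcons (negPf ne) rev_cons IH // !cats0.
Qed.

(** What follows an edge of [D] is the same in [D] and in [e :: D], so the branches of the tail do
    not change. *)
Lemma lawler_cons M e D : uniq (e :: D) ->
  lawler Es ind solve Rt M (e :: D) = branch Es ind solve Rt M e D ++ lawler Es ind solve Rt M D.
Proof.
move=> u; rewrite /lawler /= (after_cat (D1 := [::]) u); congr (_ ++ flatten _).
apply/eq_in_map => x xD; congr (branch _ _ _ _ _ _ _).
case/splitPr: xD u => D1 D2 u.
by rewrite (after_cat (D1 := e :: D1) u) after_cat //; case/andP: u.
Qed.

(** [branch_agree] telescopes along [D]; once no edge is undecided, agreement is equality. *)
Lemma lawler_agree M D Z : canon Es M -> {subset D <= Es} -> uniq D -> sol Z -> full Z ->
  agree D Z M = (M == Z) + \sum_(y <- lawler Es ind solve Rt M D) agree y.2 Z y.1 :> nat.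
Proof.
move=> cM sD uD sZ fZ; have /andP[cZ _] := sZ.
elim: D sD uD => [|e D IH] sD uD.
  rewrite big_nil addn0; congr (nat_of_bool _); apply/allP/eqP => [h|-> x _]; last by rewrite eqxx orbT.
  by apply/esym/(canon_eq cZ cM) => x /h /= /eqP.
have sD' : {subset D <= Es} by move=> x xD; apply: sD; rewrite inE xD orbT.
rewrite lawler_cons // big_cat /=; have /andP[eD uD'] := uD.
rewrite (branch_agree cM _ sD' eD sZ fZ) ?sD ?mem_head // (IH sD' uD').
by rewrite -addnA [X in _ + X]addnC.
Qed.

End Tree.

(** * Depth-first search and its worklist *)

Section Search.
Variables (S : finType) (A : matroid S) (G : graph S) (Es : seq (S * S)).
Hypothesis hEs : lists_edges Es (edges G).
Variable solve : seq S -> seq (S * S) -> seq (S * S).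
Hypothesis hsolve : forall X H, exists2 N,
  maximum_matching (contract (indep A) [set x in X]) [set edge_of e | e in avoid Es X H] N
  & lists_edges (solve X H) N.
Local Notation E := (S * S)%type.
Local Notation ind := (indl A).
Local Notation R := (Rt Es solve).
Local Notation fullR := (full Es solve).
Local Notation solA := (sol A Es).
Local Notation rankR := (rank Es solve).
Variable K : seq E.
Implicit Types (e f : E) (M N D Z : seq E) (x y : seq E * seq E).
Local Notation kidsK := (kids Es ind R K).
Local Notation lawlerR := (lawler Es ind solve R).
Local Notation childrenK := (children Es ind solve R K).

Definition valid x : bool :=
  [&& solA x.1, size K <= size x.1 &
    if fullR x.1 then uniq x.2 && all (fun e => e \in Es) x.2 else x.2 == [::]].

(** Decreases from a node to its children. Among maximum matchings the overlap with [R] is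
    arbitrary, so it is left out and the number of undecided edges takes its place; an overlap is at
    most [size Es], so smaller matchings still lie lower. *)
Definition height x : nat :=
  size x.2 + (if fullR x.1 then size x.1 * (size Es).+1 else rankR x.1).

Lemma lawlerP M D y : uniq D -> {subset D <= Es} -> canon Es M -> y \in lawlerR M D ->
  exists2 D1, size D1 < size D & [/\ y.2 = D1, solA y.1, fullR y.1, uniq D1 & {subset D1 <= Es}].
Proof.
move=> uD sD cM /flatten_mapP[e eD].
case/splitPr: eD uD sD => D1 D2 uD sD; rewrite (after_cat uD) /branch.
case: ifP => // /andP[oF le]; rewrite inE => /eqP->; exists D2.
  by rewrite size_cat /=; lia.
have s2 : {subset D2 <= Es} by move=> z zD; apply: sD; rewrite mem_cat inE zD !orbT.
have sF : {subset toggle M e D2 <= Es}.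
  move=> z; rewrite /toggle mem_cat mem_filter => /orP[|/andP[_ /(canon_sub cM)] //].
  by case: ifP => //; rewrite inE => _ /eqP->; apply: sD; rewrite mem_cat mem_head orbT.
have [cX oX _ _ _] := extend_spec hEs hsolve sF s2 oF.
split=> //; last by move: uD; rewrite cat_uniq /= => /and4P[].
by rewrite /sol cX /=; exact: (full_mxl hEs hsolve cX oX le).
Qed.

Lemma kidsP M N : N \in kidsK M ->
  [/\ solA N, size K <= size N, ~~ fullR N & rankR N < rankR M].
Proof.
rewrite kidsE => /and5P[nN mN KN fN /eqP pN].
have sN : solA N by rewrite /sol mN (nbrs_canon nN).
split=> //; have [_ _ + _] := parent_sol hEs hsolve sN fN.
by rewrite pN.
Qed.

Lemma children_valid x y : valid x -> y \in childrenK x -> valid y /\ height y < height x.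
Proof.
case: x => M D /and3P[/= sM KM vD]; have /andP[cM mM] := sM.
rewrite mem_cat => /orP[/=|/mapP[N /= /kidsP[sN KN fN rN] ->]]; last first.
  rewrite /valid /height /= (negPf fN) sN KN eqxx; split=> //.
  case: ifP vD => [fM _|fM /eqP->]; last by rewrite add0n.
  have /andP[cN _] := sN; apply: leq_trans _ (leq_addl _ _).
  rewrite -[X in _ < X]addn0 /rank.
  have := size_common_le hEs solve cN; move: fN fM; rewrite /full -ltnNge.
  by move=> h1 h2 h3; have := leq_trans h1 h2; move: h3; rewrite addn0; nia.
have [fM|fM] := boolP (fullR M); rewrite ?fM ?(negPf fM) in vD; last by rewrite (eqP vD).
have /andP[uD /allP sD] := vD.
case/(lawlerP uD sD cM) => D1 lt [yD sy fy u1 s1].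
rewrite /valid /height /= sy fy fM yD u1; split.
  rewrite (introT allP s1) andbT /= andbT.
  have [_ _ mx] := Rt_spec hEs hsolve.
  apply: leq_trans KM _; apply: leq_trans fy.
  by apply: mx; [exact: (canon_uniq hEs cM)|exact: canon_sub|case/andP: mM].
have /andP[cy /andP[oy _]] := sy.
have [_ _ mx] := Rt_spec hEs hsolve.
have := mx _ (canon_uniq hEs cy) (canon_sub cy) oy; move: fM; rewrite /full.
by move=> h1 h2; have := leq_trans h2 h1; nia.
Qed.

Lemma size_children x : valid x -> size (childrenK x) <= size Es + size Es * (size Es * size Es).
Proof.
case: x => M D /and3P[/= sM KM vD].
have lD : size D <= size Es.
  case: ifP vD => [_ /andP[u /allP s]|_ /eqP->//]; exact: uniq_leq_size.
rewrite size_cat size_map; apply: leq_add => /=.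
  apply: leq_trans lD; rewrite /lawler size_flatten /shape -map_comp sumnE big_map.
  rewrite -[X in _ <= X]muln1 -sum1_size big_distrl /=.
  by apply: leq_sum => e _; rewrite /branch; case: ifP.
rewrite -(size_nbrs Es M); apply: uniq_leq_size; first exact: dedup_uniq.
by move=> N; rewrite kidsE => /andP[].
Qed.

(* 1 if Z occurs in the subtree of x, and 0 otherwise *)
Definition reg x Z : nat :=
  if fullR x.1 then agree Es x.2 (top A Es solve (rank_bound Es) Z) x.1 : nat
  else anc A Es solve (rank_bound Es) x.1 Z.

(** A maximum matching is an ancestor of [Z] exactly when it is [top Z]. Hence [lawler_agree],
    applied to [top Z], leaves for [M] itself a term that [anc_kids] expands further. *)
Lemma reg_children x Z : valid x -> solA Z -> size K <= size Z ->
  reg x Z = (x.1 == Z) + \sum_(y <- childrenK x) reg y Z.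
Proof.
case: x => M D /and3P[/= sM KM vD] sZ KZ; have /andP[cM mM] := sM.
have hk : rank_bound Es <= rankR Z + rank_bound Es by exact: leq_addl.
have [sT fT aT] := top_spec hEs hsolve sZ hk.
rewrite big_cat big_map /=.
have -> : \sum_(N <- kidsK M) reg (N, [::]) Z =
    \sum_(N <- kidsK M) anc A Es solve (rank_bound Es) N Z.
  by apply: eq_big_seq => N /kidsP[_ _ fN _]; rewrite /reg /= (negPf fN).
have aK := anc_kids hEs hsolve M sZ KZ hk.
rewrite /reg /=; have [fM|fM] := boolP (fullR M); last first.
  by rewrite (negPf fM) in vD; rewrite (eqP vD) big_nil add0n.
rewrite fM in vD; have /andP[uD /allP sD] := vD.
rewrite (lawler_agree hEs hsolve cM sD uD sT fT) -(aT _ fM) aK -addnA; congr (_ + _).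
rewrite addnC; congr (_ + _); apply: eq_big_seq => y yL.
by have [D1 _ [_ _ fy _ _]] := lawlerP uD sD cM yL; rewrite fy.
Qed.

(** Preorder with fuel; by [pre_fuel] the height of a valid node is enough. *)
Fixpoint pre k x : seq (seq E * seq E) :=
  x :: (if k is k'.+1 then flatten [seq pre k' y | y <- childrenK x] else [::]).

Definition preW x := pre (height x) x.

Lemma pre_fuel k x : valid x -> height x <= k -> pre k x = preW x.
Proof.
rewrite /preW; elim: {k}_.+1 {-2}k x (ltnSn k) => // m IH k x lt vx hx.
have h j : height x <= j -> j <= k -> pre j x =
    x :: flatten [seq pre (height y) y | y <- childrenK x].
  case: j => [|j] hj jk /=; congr (_ :: _).
    case E : (childrenK x) => [//|y r].
    have [|_] := children_valid vx (y := y); first by rewrite E mem_head.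
    by move/leq_trans/(_ hj).
  congr flatten; apply/eq_in_map => y yx; have [vy hy] := children_valid vx yx.
  by apply: IH => //; [lia|exact: leq_trans hy hj].
by rewrite !h.
Qed.

Lemma preWE x : valid x -> preW x = x :: flatten [seq preW y | y <- childrenK x].
Proof.
move=> vx; have := pre_fuel vx (leqnSn _) => <- /=; congr (_ :: flatten _).
apply/eq_in_map => y yx; have [vy hy] := children_valid vx yx.
by apply: pre_fuel => //; exact: ltnW.
Qed.

Lemma preW_ind (P : seq E * seq E -> Prop) :
  (forall x, valid x -> (forall y, y \in childrenK x -> P y) -> P x) ->
  forall x, valid x -> P x.
Proof.
move=> h x; elim: {x}_.+1 {-2}x (ltnSn (height x)) => // m IH x lt vx.
apply: h => // y yx; have [vy hy] := children_valid vx yx.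
by apply: IH => //; exact: leq_trans hy lt.
Qed.

Lemma preW_valid x : valid x -> {in preW x, forall y, valid y}.
Proof.
move: x; apply: preW_ind => x vx IH y.
rewrite preWE // inE => /predU1P[-> //|/flatten_mapP[z zx]].
exact: IH.
Qed.

(** Both sides satisfy the recursion of [reg_children]. As [reg] is 1 at the root for each such [Z],
    this gives completeness and absence of repetition together. *)
Lemma preW_count x Z : valid x -> solA Z -> size K <= size Z ->
  count_mem Z [seq y.1 | y <- preW x] = reg x Z.
Proof.
move=> vx sZ KZ; move: x vx; apply: preW_ind => x vx IH.
rewrite preWE // /= reg_children //; congr (_ + _).
elim: (childrenK x) IH => [|y r IHr] IH /=; first by rewrite big_nil.
rewrite map_cat count_cat big_cons IH ?mem_head // IHr //.
by move=> z zr; apply: IH; rewrite inE zr orbT.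
Qed.

Definition root := (R, Es).
Definition level := [seq y.1 | y <- preW root].

Lemma root_valid : size K <= size R -> valid root.
Proof.
move=> KR; have [cR oR _] := Rt_spec hEs hsolve.
have fR : fullR R by exact: leqnn.
rewrite /valid /= KR fR (Es_uniq hEs) /sol cR (full_mxl hEs hsolve cR oR fR) /=.
exact/allP.
Qed.

Lemma level_mem Z : size K <= size R -> (Z \in level) = solA Z && (size K <= size Z).
Proof.
move=> KR; have vR := root_valid KR; apply/idP/andP => [|[sZ KZ]].
  by case/mapP=> y /(preW_valid vR) /and3P[h1 h2 _] ->.
rewrite -has_pred1 has_count (preW_count vR sZ KZ) /reg /=.
have fR : fullR R by exact: leqnn.
(* At the root all edges are undecided, so agreement holds vacuously. *)
by rewrite fR (_ : agree _ _ _ _) //; apply/allP => x ->.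
Qed.

Lemma level_uniq : size K <= size R -> uniq level.
Proof.
move=> KR; have vR := root_valid KR; apply: count_mem_uniq => Z.
have [ZL|/count_memPn //] := boolP (Z \in level).
have := ZL; rewrite level_mem // => /andP[sZ KZ].
rewrite (preW_count vR sZ KZ) /reg /=.
have fR : fullR R by exact: leqnn.
by rewrite fR (_ : agree _ _ _ _) //; apply/allP => x ->.
Qed.

Section WorkList.
Variables b H : nat.

(* Along the worklist, the number of nodes that are still waiting behind a node
   is controlled by the height at which that node hangs in the search tree. *)
Fixpoint winv (W : seq (seq E * seq E)) : bool :=
  if W is x :: W' then (size W' <= b * (H - height x)) && winv W' else true.

(** Behind a child [y] of [x] wait fewer than [b] siblings and at most [b * (H - height x)] older
    nodes, and the drop in height from [x] to [y] pays for the siblings. The bound [height x <= H]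
    keeps the subtraction exact. *)
Lemma winv_cat x W W' : height x <= H -> size W <= b ->
  {in W, forall y, height y < height x} ->
  winv (x :: W') -> winv (W ++ W').
Proof.
move=> hx sW hW /= /andP[s w]; elim: W sW hW => //= y W IH sW hW.
rewrite IH ?andbT //; last by move=> z zW; apply: hW; rewrite inE zW orbT.
  rewrite size_cat; have := hW y (mem_head _ _) => hy.
  apply: leq_trans (leq_add (ltnW sW) s) _.
  by rewrite -mulnS leq_mul2l; apply/orP; right; lia.
exact: ltnW.
Qed.

Lemma winv_size W : winv W -> size W <= b * H + 1.
Proof.
by case: W => //= x W /andP[s _]; rewrite addn1 ltnS (leq_trans s) // leq_mul2l leq_subr orbT.
Qed.
End WorkList.

End Search.

(** * The enumeration *)

Section Levels.
Variables (S : finType) (A : matroid S) (G : graph S) (Es : seq (S * S)).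
Hypothesis hEs : lists_edges Es (edges G).
Variable solve : seq S -> seq (S * S) -> seq (S * S).
Hypothesis hsolve : forall X H, exists2 N,
  maximum_matching (contract (indep A) [set x in X]) [set edge_of e | e in avoid Es X H] N
  & lists_edges (solve X H) N.
Local Notation E := (S * S)%type.
Local Notation R := (Rt Es solve).
Local Notation solA := (sol A Es).
Local Notation lev := (level A Es solve).

(** The list [K] is a unary counter: its successive tails stand for the smaller sizes. *)
Fixpoint outs (K : seq E) : seq (seq E) :=
  [seq Z <- lev K | size Z == size K] ++ (if K is _ :: K' then outs K' else [::]).

(** One entry per visit, over all searches in turn; true entries are the visits that print. *)
Fixpoint flags (K : seq E) : seq bool :=
  [seq size Z == size K | Z <- lev K] ++ (if K is _ :: K' then flags K' else [::]).

Lemma sol_le Z : solA Z -> size Z <= size R.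
Proof.
case/andP=> cZ /andP[oZ _]; have [_ _ mx] := Rt_spec hEs hsolve.
by apply: mx => //; [exact: (canon_uniq hEs cZ)|exact: canon_sub].
Qed.

Lemma outs_mem K Z : size K <= size R -> (Z \in outs K) = solA Z && (size Z <= size K).
Proof.
have lm K' : size K' <= size R ->
    (Z \in [seq Z <- lev K' | size Z == size K']) = solA Z && (size Z == size K').
  move=> KR; rewrite mem_filter (level_mem hEs hsolve Z KR) andbCA.
  by case: eqP => [->|]; rewrite ?leqnn ?andbF.
elim: K => [|e K IH] KR; rewrite /= mem_cat lm //.
  by rewrite in_nil orbF leqn0.
by rewrite (IH (ltnW KR)) -andb_orr [in RHS]leq_eqVlt ltnS.
Qed.

Lemma outs_uniq K : size K <= size R -> uniq (outs K).
Proof.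
elim: K => [|e K IH] KR; rewrite /= cat_uniq filter_uniq ?(level_uniq hEs hsolve KR) //=.
rewrite (IH (ltnW KR)) andbT; apply/hasPn => Z; rewrite (outs_mem _ (ltnW KR)) => /andP[_ le].
by rewrite mem_filter negb_and neq_ltn ltnS le.
Qed.

Lemma outs_pairwise K : size K <= size R ->
  pairwise (fun M N : seq E => size N <= size M) (outs K).
Proof.
have lp K' : pairwise (fun M N : seq E => size N <= size M) [seq Z <- lev K' | size Z == size K'].
  elim: (lev K') => //= Z s IH; case: ifP => //= /eqP ->; rewrite IH andbT.
  by apply/allP => N; rewrite mem_filter => /andP[/eqP -> _].
elim: K => [|e K IH] KR; rewrite /= pairwise_cat lp /=; first by rewrite allrel0r.
rewrite (IH (ltnW KR)) andbT; apply/allrelP => M N.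
rewrite mem_filter (outs_mem _ (ltnW KR)) => /andP[/eqP -> _] /andP[_ le]; exact: leqW.
Qed.

Lemma count_take_size (s : seq bool) i :
  minn i (size s) <= count id (take i s) + count negb s.
Proof.
have -> : minn i (size s) = size (take i s) by rewrite size_take_min.
rewrite -(count_predC id (take i s)) leq_add2l -{2}(cat_take_drop i s) count_cat.
exact: leq_addr.
Qed.

Lemma count_take_le (s : seq bool) i j : i <= j -> count id (take i s) <= count id (take j s).
Proof. by move=> h; rewrite -(subnKC h) takeD count_cat leq_addr. Qed.

Lemma count_take_cat (s t : seq bool) i j : i <= j ->
  count id (take i s) <= count id (take j (s ++ t)).
Proof.
move/count_take_le => /(_ s) /leq_trans; apply.
rewrite take_cat; case: ltnP => // h.
by rewrite take_oversize // count_cat leq_addr.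
Qed.

Lemma count_take_prefix (s : seq bool) a i :
  count negb s <= a -> i <= a + count id s -> i - a <= count id (take i s).
Proof.
have := count_take_size s i; rewrite -(count_predC id s).
by rewrite -[count (predC id) s]/(count negb s) minnE; lia.
Qed.

(* The solutions that a level visits without listing them were listed by the
   levels above. *)
Lemma level_skipped K acc : size K <= size R ->
  (forall Z, solA Z -> size K < size Z -> Z \in acc) ->
  count negb [seq size Z == size K | Z <- lev K] <= size acc.
Proof.
move=> KR hacc; rewrite count_map -size_filter; apply: uniq_leq_size.
  by rewrite filter_uniq // (level_uniq hEs hsolve).
move=> Z; rewrite mem_filter (level_mem hEs hsolve) // => /andP[h /andP[sZ le]].
by apply: hacc; rewrite // ltn_neqAle le eq_sym andbT.
Qed.

(** Here [acc] plays the role of the solutions printed by earlier levels, which bounds the silent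
    visits of this one. Either its first [i] visits already print enough, or the level ends within
    [i] visits and the induction goes on with its outputs added to [acc]. *)
Lemma flags_count K acc i : size K <= size R ->
  (forall Z, solA Z -> size K < size Z -> Z \in acc) ->
  size acc <= i -> i <= size acc + size (outs K) ->
  i - size acc <= count id (take (i * (size K).+1) (flags K)).
Proof.
elim: K acc => [|e K IH] acc KR hacc ai io; have neg := level_skipped KR hacc.
  have h := leq_pmulr i (ltn0Sn (size (Nil E))).
  apply: leq_trans (count_take_cat _ _ h); apply: count_take_prefix => //.
  by move: io; rewrite /= cats0 size_filter count_map.
set K1 := e :: K in KR hacc neg *; set F := [seq size Z == size K1 | Z <- lev K1] in neg.
have eF : flags K1 = F ++ flags K by [].
have so : size (outs K1) = count id F + size (outs K).
  by rewrite -[outs K1]/([seq Z <- lev K1 | size Z == size K1] ++ outs K) size_cat size_filter /F count_map.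
rewrite eF; have [le|lt] := leqP i (size acc + count id F).
  apply: leq_trans (count_take_cat _ _ (leq_pmulr i (ltn0Sn (size K1)))).
  exact: count_take_prefix.
pose acc' := acc ++ [seq Z <- lev K1 | size Z == size K1].
have sacc' : size acc' = size acc + count id F by rewrite size_cat size_filter /F count_map.
have sF : size F = count id F + count negb F by rewrite -(count_predC id F).
have hacc' Z : solA Z -> size K < size Z -> Z \in acc'.
  rewrite mem_cat mem_filter => sZ; rewrite leq_eqVlt => /orP[/eqP eqZ|/(hacc Z sZ)->//].
  have e1 : size Z = size K1 by rewrite -eqZ.
  by rewrite e1 eqxx (level_mem hEs hsolve Z KR) sZ e1 leqnn orbT.
have := IH acc' (ltnW KR) hacc'; rewrite sacc' => /(_ (ltnW lt)) h.
have {}h : i - (size acc + count id F) <= count id (take (i * (size K).+1) (flags K)).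
  by apply: h; move: io; rewrite so addnA.
(* The level makes at most [count id F + size acc] visits, which is less than [i]; thus each level
   consumes one summand [i]. *)
have big : size F + i * (size K).+1 <= i * (size K1).+1.
  by rewrite [i * (size K1).+1]mulnS leq_add2r sF; move: neg lt; clear; lia.
rewrite take_cat ltnNge (leq_trans (leq_addr _ _) big) /= count_cat.
rewrite leq_subLR in big *; apply: leq_trans (_ : _ <= size acc + (count id F +
  count id (take (i * (size K).+1) (flags K)))) _.
  by rewrite addnA -leq_subLR.
rewrite !leq_add2l; apply: count_take_le.
by rewrite leq_subRL // (leq_trans (leq_addr _ _) big).
Qed.

End Levels.

(* The booleans tell which of the successive visits produce an output. *)
Definition tracks (P : nat) (fl : seq bool) (o : trace) : Prop :=
  forall j, count id (take j fl) <= count (fun p => p.1 <= P * j) o.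

Lemma tracks_cat P fl1 fl2 o1 o2 t : tracks P fl1 o1 -> t <= P * size fl1 ->
  tracks P fl2 o2 -> tracks P (fl1 ++ fl2) (o1 ++ delay t o2).
Proof.
move=> h1 ht h2 j; rewrite take_cat count_cat; case: ltnP => hj.
  exact: leq_trans (h1 j) (leq_addr _ _).
rewrite count_cat; apply: leq_add.
  have := h1 (size fl1); rewrite take_size => /leq_trans; apply.
  apply: sub_count => p hp; apply: leq_trans hp _; by rewrite leq_mul2l hj orbT.
apply: leq_trans (h2 _) _; rewrite count_map; apply: sub_count => p /= hp.
by rewrite mulnBr in hp; have := leq_mul (leqnn P) hj; lia.
Qed.

(** A delay at the start is charged to the first visit: [P * j.+1 + d <= (P + d) * j.+1]. *)
Lemma tracks_delay P P' d fl o : tracks P fl o -> P + d <= P' -> tracks P' fl (delay d o).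
Proof.
move=> h hP [|j]; first by rewrite take0.
apply: leq_trans (h _) _; rewrite count_map; apply: sub_count => p /= hp.
have := leq_mul hP (leqnn j.+1); rewrite mulnDl; have := leq_pmulr d (ltn0Sn j); lia.
Qed.

(** * The main program and its costs *)

Definition pack : expr :=
  ECons (Var 0) (ECons (ECons (Var 1) (ETl (Var 2))) (Var 3)).

(** [pack] builds the argument of type [tS] for both calls. The assignment in the negative case
    changes nothing, as the flag is [Leaf] there. *)
Definition visit chit cstep : cmd :=
  Seq (Call 4 chit pack)
    (Seq (If (Var 4) (Output (EHd (EHd (Var 3)))) (Assign 4 ENil))
      (Call 3 cstep pack)).

(* Variables: 0 is the input, 1 the matching R, 2 a list whose tail is the level
   K, 3 the worklist, 4 a flag. *)
Definition sweep_level chit cstep : cmd :=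
  Seq (Assign 3 (ECons (ECons (Var 1) (ETl (Var 0))) ENil))
    (Seq (While (Var 3) (visit chit cstep)) (Assign 2 (ETl (Var 2)))).

(** The first assignment extends the store to five variables, which fixes its shape for the loops.
    The additional cell in front of [R] in variable 2 lets the outer loop run also for the empty
    level. *)
Definition main croot chit cstep : cmd :=
  Seq (Assign 4 ENil)
    (Seq (Call 1 croot (ECons (Var 0) ENil))
      (Seq (Assign 2 (ECons ENil (Var 1))) (While (Var 2) (sweep_level chit cstep)))).

(* Bounds for an instance with k vertices: the number of edges, the size of an
   encoded matching, branching and depth of the search tree, the size of an
   encoded worklist, and the size of the argument of a call. *)
Definition bE k := k * k.
Definition bM k := bE k * (4 * k + 4) + 1.
Definition bB k := bE k + bE k * (bE k * bE k).
Definition bH k := bE k + bE k * (bE k + 1).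
Definition bW k := (bB k * bH k + 1) * (2 * bM k + 2) + 1.
Definition bI k := 2 * k + 1 + bM k + 1 + 2 * bM k + bW k + 3.

Lemma map_delay t o : [seq p.2 | p <- delay t o] = [seq p.2 | p <- o].
Proof. by rewrite -map_comp. Qed.

Lemma exec_visit O chit cstep i r l k a d q v b y T1 S1 T2 S2 :
  runs O chit (Node i (Node (Node r k) (Node (Node a d) q))) (enc_bool v) T1 S1 ->
  runs O cstep (Node i (Node (Node r k) (Node (Node a d) q))) y T2 S2 ->
  tsize b <= 3 ->
  exists t m o,
    [/\ exec O (visit chit cstep) [:: i; r; Node l k; Node (Node a d) q; b]
          [:: i; r; Node l k; y; enc_bool v] t m o,
        t <= T1 + T2 + tsize a + 40,
        m <= 2 * (tsize i + tsize r + tsize (Node l k) + tsize (Node (Node a d) q)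
               + tsize y) + S1 + S2 + 20,
        [seq p.2 | p <- o] = nseq v a
      & all (fun p => p.1 <= t) o].
Proof.
move=> [s1 [t1 [m1 [e1 v1 b1 d1]]]] [s2 [t2 [m2 [e2 v2 b2 d2]]]] zb.
have [t3 [m3 [o3 [e3 b3 d3 w3 c3]]]] : exists t m o,
    [/\ exec O (If (Var 4) (Output (EHd (EHd (Var 3)))) (Assign 4 ENil))
          [:: i; r; Node l k; Node (Node a d) q; enc_bool v]
          [:: i; r; Node l k; Node (Node a d) q; enc_bool v] t m o,
        t <= tsize a + 10,
        m <= tsize i + tsize r + tsize (Node l k) + 2 * tsize (Node (Node a d) q) + 10,
        [seq p.2 | p <- o] = nseq v a
      & all (fun p => p.1 <= t) o].
  case: v {e1 v1} => /=.
    do 3 eexists; split.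
    - by apply: ExecIfTrue; [|exact: ExecOutput].
    - rewrite /=; lia.
    - rewrite /espace /ssize /= !tsizeN; change (tsize Leaf) with 1; lia.
    - by [].
    - by rewrite /= leqnn.
  do 3 eexists; split.
  - apply: ExecIfFalse; first by [].
    exact: ExecAssign.
  - rewrite /=; lia.
  - rewrite /espace /ssize /= !tsizeN; change (tsize Leaf) with 1; lia.
  - by [].
  - by [].
have zv : tsize (enc_bool v) <= 3 by case: (v).
do 3 eexists; split.
- apply: ExecSeq.
    by apply: exec_call0; [exact: e1|exact: v1].
  apply: ExecSeq; first exact: e3.
  by apply: exec_call0; [exact: e2|exact: v2].
- rewrite /=; lia.
- move: d3; rewrite /espace /ssize /set_var /= !tsizeN; lia.
- by rewrite cats0 -w3 -map_comp.
- rewrite cats0 /= all_map; apply: sub_all c3 => p /=; lia.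
Qed.

Lemma size_pair_cons a b c k z : a <= z -> b <= z -> c <= k * (2 * z + 2) + 1 ->
  ((a + b).+1 + c).+1 <= k.+1 * (2 * z + 2) + 1.
Proof. by rewrite (mulSn k); lia. Qed.

Lemma inner_time t t0 a z : t <= t0 + t0 + a + 40 -> a <= z -> t + 2 <= 2 * t0 + z + 50.
Proof. by lia. Qed.

Lemma inner_steps t u T k : t + 2 <= T -> u <= T * k + 2 -> 2 + (t + u) <= T * k.+1 + 2.
Proof. by rewrite mulnS; lia. Qed.

(** Here [z] bounds an encoded matching, [zw] an encoded worklist and [s0] the space of a call;
    [i + 2 * z + zw + 3] is the later [zI]. *)
Lemma inner_space i r kl x x' b m1 m2 s0 z zw : r <= z ->
  m1 <= 2 * (i + r + kl + x + x') + s0 + s0 + 20 ->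
  m2 <= 2 * (i + 2 * z + zw + 3 + kl + zw) + 2 * s0 + 20 ->
  x <= zw -> x' <= zw -> b <= 3 ->
  maxn (i + (r + (kl + (x + (b + 0)))) + x) (maxn m1 m2) <=
  2 * (i + 2 * z + zw + 3 + kl + zw) + 2 * s0 + 20.
Proof. by lia. Qed.

(** Each level visits at least the root, so its fixed overhead is absorbed by raising the cost of a
    visit. *)
Lemma level_steps T k t : 0 < k -> t <= T * k + 2 -> 7 + (t + 3) + 2 <= (T + 20) * k.
Proof. by rewrite mulnDl; lia. Qed.

Lemma level_space i r l k x b b' m z zw zl s0 : r <= z -> (l + k).+1 <= zl ->
  x <= zw -> b <= 3 -> b' <= 3 ->
  m <= 2 * (i + 2 * z + zw + 3 + (l + k).+1 + zw) + 2 * s0 + 20 ->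
  maxn (maxn (i + (r + ((l + k).+1 + (1 + (b + 0)))) + x) (i + (r + ((l + k).+1 + (x + (b + 0))))))
    (maxn m (maxn (i + (r + ((l + k).+1 + (1 + (b' + 0)))) + k) (i + (r + (k + (1 + (b' + 0))))))) <=
  2 * (i + 2 * z + zw + 3 + zl + zw) + 2 * s0 + 20 + 2 * (i + 2 * z + zw + 3 + zl + zw) + 20.
Proof. by lia. Qed.

Lemma sweep_space i r l k b x m z zw zl s0 : r <= z -> (l + k).+1 <= zl -> b <= 3 ->
  let S := 2 * (i + 2 * z + zw + 3 + zl + zw) + 2 * s0 + 20 + 2 * (i + 2 * z + zw + 3 + zl + zw) + 20 in
  m <= S -> x <= S ->
  maxn (i + (r + ((l + k).+1 + (1 + (b + 0)))) + (l + k).+1) (maxn m x) <= S.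
Proof. by rewrite /=; lia. Qed.

Lemma sweep_space_end i r b z zw zl s0 : r <= z -> b <= 3 ->
  i + (r + (1 + (1 + (b + 0)))) + 1 <=
  2 * (i + 2 * z + zw + 3 + zl + zw) + 2 * s0 + 20 + 2 * (i + 2 * z + zw + 3 + zl + zw) + 20.
Proof. by lia. Qed.

Lemma main_space i r z zl zw s0 m0 m1 : r <= z -> 1 + r < zl -> m0 <= s0 ->
  let S := 2 * (i + 2 * z + zw + 3 + zl + zw) + 2 * s0 + 20 + 2 * (i + 2 * z + zw + 3 + zl + zw) + 20 in
  m1 <= S ->
  maxn (maxn (i + 0 + 1) (i + (1 + (1 + (1 + (1 + 0))))))
    (maxn (maxn (i + (1 + (1 + (1 + (1 + 0)))) + m0) (i + (r + (1 + (1 + (1 + 0))))))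
      (maxn (maxn (i + (r + (1 + (1 + (1 + 0)))) + (1 + r).+1)
        (i + (r + ((1 + r).+1 + (1 + (1 + 0)))))) m1)) <= S.
Proof. by rewrite /=; lia. Qed.

Section Run.
Variable C : instance -> Prop.
Variable w : world C.
Local Notation n := (gsize w).
Local Notation Es := (wedges w).
Local Notation E := ('I_n * 'I_n)%type.
Variable solve : seq 'I_n -> seq E -> seq E.
Hypothesis hsolve : forall X H, exists2 N,
  maximum_matching (contract (indep (mat w)) [set x in X]) [set edge_of e | e in avoid Es X H] N
  & lists_edges (solve X H) N.
Local Notation ind := (indl (mat w)).
Local Notation R := (Rt Es solve).
Local Notation validK K := (valid (mat w) Es solve K).
Local Notation heightE := (height Es solve).
Local Notation nodes K W := (flatten [seq preW (mat w) Es solve K y | y <- W]).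
Local Notation hEs := (wedgesP w).

Local Notation nE := (bE n).
Local Notation zM := (bM n).
Local Notation bB := (bB n).
Local Notation bH := (bH n).
Local Notation zW := (bW n).
(** Bounds the argument of the two calls: the instance, [R], [K] and the worklist; the 3 counts the
    nodes that join them. *)
Definition zI := tsize (inp w) + 2 * zM + zW + 3.

Lemma size_Es : size Es <= nE.
Proof.
rewrite -(card_uniqP (Es_uniq hEs)); apply: leq_trans (max_card _) _.
by rewrite card_prod card_ord.
Qed.

Lemma tsize_matching (M : seq E) : size M <= nE -> tsize (enc (M : El w tM)) <= zM.
Proof.
move=> h; apply: leq_trans (tsize_enc_edges _) _.
by rewrite leq_add2r leq_mul2r h orbT.
Qed.

Lemma size_R : size R <= nE.
Proof. by have [cR _ _] := Rt_spec hEs hsolve; exact: leq_trans (size_canon hEs cR) size_Es. Qed.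

Lemma valid_size K x : validK K x -> size x.1 <= nE /\ size x.2 <= nE.
Proof.
case/and3P=> /andP[cx _] _ v; split; first exact: leq_trans (size_canon hEs cx) size_Es.
case: ifP v => [_ /andP[u /allP s]|_ /eqP -> //]; exact: leq_trans (uniq_leq_size u s) size_Es.
Qed.

Lemma valid_height K x : validK K x -> heightE x <= bH.
Proof.
move=> vx; have [h1 h2] := valid_size vx; have /and3P[/andP[cx _] _ v] := vx.
have hE : (size Es).+1 <= nE + 1 by rewrite addn1 ltnS size_Es.
apply: leq_add => //; case: ifP v => [_ _|fx _]; first exact: leq_mul.
move: fx; rewrite /full /rank => /negbT; rewrite -ltnNge => lt.
apply: leq_trans (leq_mul size_R hE); apply: ltnW; rewrite -[X in _ < X]addn0.
by apply: lex_lt (size_common_le hEs solve cx) _; rewrite lt.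
Qed.

Lemma tsize_worklist K (W : seq (seq E * seq E)) :
  (forall x, x \in W -> validK K x) -> size W <= bB * bH + 1 ->
  tsize (enc (W : El w (tL tN))) <= zW.
Proof.
move=> vW sW; suff : tsize (enc (W : El w (tL tN))) <= size W * (2 * zM + 2) + 1.
  by move/leq_trans; apply; rewrite leq_add2r leq_mul2r sW orbT.
elim: W vW {sW} => [|x W IH] vW; first by [].
rewrite (@tsize_enc_cons C w tN).
have {}IH := IH (fun y yW => vW y (mem_behead (s := x :: W) yW)).
have [h1 h2] := valid_size (vW x (mem_head _ _)).
exact: size_pair_cons (tsize_matching h1) (tsize_matching h2) IH.
Qed.

Variables (chit cstep : cmd) (T0 S0 : nat).
Hypothesis hit_runs : forall g : El w tS, tsize (ein g) <= zI ->
  runs (orc w) chit (ein g) (enc_bool (hit g.1.2 g.2)) T0 S0.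
Hypothesis step_runs : forall g : El w tS, tsize (ein g) <= zI ->
  runs (orc w) cstep (ein g) (enc (step Es ind solve g.1.1 g.1.2 g.2 : El w (tL tN))) T0 S0.

Definition T1 := 2 * T0 + zM + 50.
Definition S1 zl := 2 * (zI + zl + zW) + 2 * S0 + 20.

(** Induction on the number of nodes still to be visited. Replacing the front node by its children
    removes exactly this node from the preorder, and [winv] keeps the worklist, hence the arguments
    of the calls, polynomial. *)
Lemma exec_inner (K : seq E) l (W : seq (seq E * seq E)) b :
  size K <= nE -> tsize b <= 3 ->
  (forall x, x \in W -> validK K x) -> winv Es solve bB bH W ->
  exists b' t m o,
    [/\ exec (orc w) (While (Var 3) (visit chit cstep))
          [:: inp w; enc (R : El w tM); Node l (enc (K : El w tM)); enc (W : El w (tL tN)); b]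
          [:: inp w; enc (R : El w tM); Node l (enc (K : El w tM)); Leaf; b'] t m o,
        tsize b' <= 3, t <= T1 * size (nodes K W) + 2,
        m <= S1 (tsize (Node l (enc (K : El w tM))))
      & [seq p.2 | p <- o] = [seq enc_edges x.1 | x <- nodes K W & size x.1 == size K] /\
        tracks T1 [seq size x.1 == size K | x <- nodes K W] o].
Proof.
move=> KE; set kl := Node l _; move: {2}(size (nodes K W)) (leqnn (size (nodes K W))) => N.
elim: N W b => [|N IH] W b hN zb vW iW.
all: have zW' := tsize_worklist vW (winv_size iW).
all: case: W hN vW iW zW' => [|x W'] hN vW iW zW'.
1,3: exists b, 2, (ssize [:: inp w; enc (R : El w tM); kl; Leaf; b] + 1), [::]; split=> //;
  [exact: ExecWhileFalse|by rewrite muln0|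
   by have := tsize_matching size_R; rewrite /S1 /zI /ssize /=; change (tsize Leaf) with 1; lia].
- by move: hN; rewrite /= (preWE hEs hsolve (vW x (mem_head _ _))).
have vx := vW x (mem_head _ _).
pose g : El w tS := ((R, K), x :: W').
have zg : tsize (ein g) <= zI.
  have := tsize_matching size_R; have := tsize_matching KE.
  have -> : tsize (ein g) = (tsize (inp w) + ((tsize (enc (R : El w tM)) +
    tsize (enc (K : El w tM))).+1 + tsize (enc (x :: W' : El w (tL tN)))).+1).+1 by [].
  by rewrite /zI; move: zW'; clear; lia.
pose W1 := children Es ind solve R K x ++ W'.
have vW1 y : y \in W1 -> validK K y.
  rewrite mem_cat => /orP[/(children_valid hEs hsolve vx) [] //|yW'].
  by apply: vW; rewrite inE yW' orbT.
have iW1 : winv Es solve bB bH W1.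
  have leB : size Es + size Es * (size Es * size Es) <= bB.
    by apply: leq_add; rewrite ?leq_mul ?size_Es.
  have lt : {in children Es ind solve R K x, forall y, heightE y < heightE x}.
    by move=> y /(children_valid hEs hsolve vx) [].
  exact: (winv_cat hEs (valid_height vx) (leq_trans (size_children vx) leB) lt iW).
have eN : nodes K (x :: W') = x :: nodes K W1.
  rewrite /W1 (map_cat _ (children Es ind solve R K x)) flatten_cat.
  by rewrite -cat_cons -(preWE hEs hsolve vx).
have r1 := hit_runs zg; have r2 := step_runs zg.
have hx : hit K (x :: W') = (size x.1 == size K) by rewrite /hit eqn_leq andbC.
have [t1 [m1 [o1 [e1 b1 d1 w1 c1]]]] := @exec_visit _ _ _ _ _ l _ (enc (x.1 : El w tM))
  (enc (x.2 : El w tM)) (enc (W' : El w (tL tN))) _ _ _ _ _ _ _ r1 r2 zb.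
have hN1 : size (nodes K W1) <= N by move: hN; rewrite eN.
have zv : tsize (enc_bool (hit K (x :: W'))) <= 3 by case: hit.
have [b' [t2 [m2 [o2 [e2 zb' b2 d2 [w2 c2]]]]]] := IH W1 _ hN1 zv vW1 iW1.
have z1 := tsize_worklist vW1 (winv_size iW1).
have ht : t1 + 2 <= T1.
  have [h1 _] := valid_size vx; exact: (inner_time b1 (tsize_matching h1)).
do 4 eexists; split.
- by apply: ExecWhileTrue e1 e2.
- exact: zb'.
- rewrite eN; exact: (inner_steps ht b2).
- apply: inner_space (tsize_matching size_R) d1 d2 zW' z1 zb.
- split; first by rewrite map_delay map_cat map_delay w1 w2 eN hx /=; case: eqP.
  have -> : delay (etime (Var 3)).+1 (o1 ++ delay t1 o2) = delay 2 o1 ++ delay (2 + t1) o2.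
    by rewrite /delay map_cat -map_comp; congr (_ ++ _); apply: eq_map => p /=; rewrite addnA.
  rewrite eN [map _ (_ :: _)]/= -cat1s; apply: tracks_cat c2; last by rewrite muln1; lia.
  case=> [|j]; first by rewrite take0.
  have -> : count id (take j.+1 [:: size x.1 == size K]) = count (fun p => p.1 <= t1) o1.
    have /eqP -> : count (fun p => p.1 <= t1) o1 == size o1 by rewrite -all_count.
    by have := congr1 size w1; rewrite size_map size_nseq hx => -> /=; rewrite addn0.
  rewrite count_map; apply: sub_count => p /= hp.
  by have := leq_pmulr T1 (ltn0Sn j); move: hp ht; clear; lia.
Qed.

Local Notation levelsK := (outs (mat w) Es solve).
Local Notation flagsK := (flags (mat w) Es solve).

Definition S2 zl := S1 zl + 2 * (zI + zl + zW) + 20.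

Lemma exec_level (K : seq E) l b zl : size K <= size R -> tsize b <= 3 ->
  tsize (Node l (enc (K : El w tM))) <= zl ->
  exists b' t m o,
    [/\ exec (orc w) (sweep_level chit cstep)
          [:: inp w; enc (R : El w tM); Node l (enc (K : El w tM)); Leaf; b]
          [:: inp w; enc (R : El w tM); enc (K : El w tM); Leaf; b'] t m o,
        tsize b' <= 3, t + 2 <= (T1 + 20) * size (level (mat w) Es solve K),
        m <= S2 zl
      & [seq p.2 | p <- o] =
          [seq enc_edges Z | Z <- level (mat w) Es solve K & size Z == size K] /\
        tracks (T1 + 20) [seq size Z == size K | Z <- level (mat w) Es solve K] (delay 2 o)].
Proof.
move=> KR zb hzl.
have KE : size K <= nE by exact: leq_trans KR size_R.
have vR : validK K (root Es solve) by exact: (root_valid hEs hsolve KR).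
have iW : winv Es solve bB bH [:: root Es solve] by [].
have vW x : x \in [:: root Es solve] -> validK K x by rewrite inE => /eqP->.
have [b' [t1 [m1 [o1 [e1 zb' h1 d1 [w1 c1]]]]]] := exec_inner l KE zb vW iW.
have zR := tsize_matching size_R.
have zWR := tsize_worklist vW (winv_size iW).
rewrite [flatten _]/= cats0 in h1 w1 c1.
have N0 : 0 < size (preW (mat w) Es solve K (root Es solve)) by rewrite (preWE hEs hsolve vR).
do 4 eexists; split.
- apply: ExecSeq; first exact: ExecAssign.
  apply: ExecSeq; first exact: e1.
  exact: ExecAssign.
- exact: zb'.
- rewrite size_map; exact: level_steps N0 h1.
- exact: level_space zR hzl zWR zb zb' d1.
rewrite /= cats0; split; first by rewrite map_delay w1 filter_map -map_comp.
rewrite /delay -map_comp.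
have -> : [seq size Z == size K | Z <- level (mat w) Es solve K] =
  [seq size x.1 == size K | x <- preW (mat w) Es solve K (root Es solve)] by rewrite -map_comp.
have -> : [seq (2 + ((7 + p.1, p.2) : nat * tree).1, ((7 + p.1, p.2) : nat * tree).2) | p <- o1] =
   delay 9 o1 by apply: eq_map => p /=; rewrite addnA.
by apply: tracks_delay c1 _; lia.
Qed.

(** The head [l] of the counter is arbitrary because it is [Leaf] at the start and the code of an
    edge afterwards; only the tail matters. *)
Lemma exec_sweep (K : seq E) l b zl : size K <= size R -> tsize b <= 3 ->
  tsize (Node l (enc (K : El w tM))) <= zl ->
  exists s t m o,
    [/\ exec (orc w) (While (Var 2) (sweep_level chit cstep))
          [:: inp w; enc (R : El w tM); Node l (enc (K : El w tM)); Leaf; b] s t m o,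
        m <= S2 zl,
        [seq p.2 | p <- o] = [seq enc_edges Z | Z <- levelsK K]
      & tracks (T1 + 20) (flagsK K) o].
Proof.
elim: K l b => [|e K IH] l b KR zb hzl.
all: have [b' [t1 [m1 [o1 [e1 zb' h1 d1 [w1 c1]]]]]] := exec_level KR zb hzl.
- do 4 eexists; split.
  - by apply: ExecWhileTrue e1 _; [|exact: ExecWhileFalse].
  - apply: (sweep_space (tsize_matching size_R) hzl zb d1).
    exact: sweep_space_end (tsize_matching size_R) zb'.
  - by rewrite map_delay map_cat w1 /= !cats0.
  - by rewrite /= !cats0.
have [|s [t2 [m2 [o2 [e2 d2 w2 c2]]]]] := IH (enc (e : El w tE)) b' (ltnW KR) zb'.
  by apply: leq_trans hzl; rewrite [in X in _ <= X]tsizeN ltnW // ltnS leq_addl.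
do 4 eexists; split; first by apply: ExecWhileTrue e1 e2.
- exact: (sweep_space (tsize_matching size_R) hzl zb d1 d2).
- by rewrite map_delay map_cat map_delay w1 w2 /= map_cat.
rewrite -[flagsK _]/([seq size Z == size (e :: K) | Z <- level (mat w) Es solve (e :: K)] ++ flagsK K).
have -> : delay (etime (Var 2)).+1 (o1 ++ delay t1 o2) = delay 2 o1 ++ delay (t1 + 2) o2.
  by rewrite /delay map_cat -map_comp; congr (_ ++ _); apply: eq_map => p /=; rewrite addnA (addnC 2).
by apply: tracks_cat c2 => //; rewrite size_map.
Qed.

Variable croot : cmd.
Hypothesis root_runs : runs (orc w) croot (Node (inp w) Leaf) (enc (R : El w tM)) T0 S0.

Lemma exec_main : exists s t m o,
  [/\ exec (orc w) (main croot chit cstep) [:: inp w] s t m o,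
      m <= S2 (zM + 3),
      [seq p.2 | p <- o] = [seq enc_edges Z | Z <- levelsK R]
    & tracks (T1 + T0 + 40) (flagsK R) o].
Proof.
have [s0 [t0 [m0 [e0 v0 b0 d0]]]] := root_runs.
have zR := tsize_matching size_R.
have zl : tsize (Node Leaf (enc (R : El w tM))) <= zM + 3.
  by rewrite tsizeN; change (tsize Leaf) with 1; lia.
have [s [t [m [o [e1 d1 w1 c1]]]]] := exec_sweep (leqnn (size R)) (isT : tsize Leaf <= 3) zl.
do 4 eexists; split.
- apply: ExecSeq; first exact: ExecAssign.
  apply: ExecSeq; first by apply: exec_call0; [exact: e0|exact: v0].
  apply: ExecSeq; first exact: ExecAssign.
  exact: e1.
- exact: (main_space zR zl d0 d1).
- by rewrite /= !map_delay w1.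
rewrite /= /delay -!map_comp.
set f := (_ \o _); have -> : map f o = delay (2 + (4 + t0 + 4)) o.
  by apply: eq_map => p; rewrite /f /= !addnA.
by apply: tracks_delay c1 _; move: b0; clear; lia.
Qed.

End Run.

(** * From canonical lists to sets of edges, and the final bounds *)

Lemma outs_in_order (C : instance -> Prop) (w : world C) solve (o : trace) :
  (forall X H, exists2 N,
    maximum_matching (contract (indep (mat w)) [set x in X])
      [set edge_of e | e in avoid (wedges w) X H] N & lists_edges (solve X H) N) ->
  [seq p.2 | p <- o] =
    [seq enc_edges Z | Z <- outs (mat w) (wedges w) solve (Rt (wedges w) solve)] ->
  outputs_solutions_in_order w o /\
  #|solutions w| = size (outs (mat w) (wedges w) solve (Rt (wedges w) solve)).
Proof.
move=> hsolve ho; set L := outs _ _ _ _ in ho *.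
have hE := wedgesP w.
have memL Z : (Z \in L) = sol (mat w) (wedges w) Z.
  rewrite (outs_mem hE hsolve Z (leqnn _)); case sZ : (sol _ _ _) => //=.
  exact: (sol_le hE hsolve sZ).
have canL Z : Z \in L -> canon (wedges w) Z by rewrite memL => /andP[].
have szL Z : Z \in L -> #|Mset Z| = size Z.
  by move/canL => cZ; apply: (size_Mset hE); [exact: canon_sub|exact: (canon_uniq hE)].
have uL : uniq [seq Mset Z | Z <- L].
  rewrite map_inj_in_uniq ?(outs_uniq hE hsolve (leqnn _)) // => Z Z' /canL cZ /canL cZ' eZ.
  apply: (canon_eq cZ cZ') => x xE.
  by rewrite -(mem_Mset hE (canon_sub cZ) xE) eZ (mem_Mset hE (canon_sub cZ') xE).
have memS : [seq Mset Z | Z <- L] =i solutions w.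
  move=> M; rewrite inE; apply/mapP/idP => [[Z]|mM].
    by rewrite memL => /andP[cZ mZ] ->; rewrite -(mxl_maximal (mat w) hE (canon_sub cZ)).
  have /andP[/and3P[sM _ _] _] := mM.
  pose Z := [seq x <- wedges w | edge_of x \in M].
  have cZ : canon (wedges w) Z := canon_filter _ _.
  have eM : M = Mset Z.
    apply/setP=> X; apply/idP/imsetP => [XM|[e + ->]]; last by rewrite mem_filter => /andP[].
    have [e eE Xe] := edge_Es hE (subsetP sM X XM).
    by exists e => //; rewrite mem_filter -Xe XM.
  by exists Z => //; rewrite memL /sol cZ (mxl_maximal (mat w) hE (canon_sub cZ)) -eM.
split; last by rewrite -(size_map (@Mset _)) -(card_uniqP uL); apply: eq_card => M; rewrite -memS.
exists [seq Mset Z | Z <- L], L; split=> //.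
- apply: pairwise_sorted; rewrite pairwise_map.
  have := outs_pairwise hE hsolve (leqnn (size (Rt (wedges w) solve))).
  apply: (sub_in_pairwise (P := mem L)); last exact/allP.
  by move=> Z Z' ZL ZL'; rewrite /= !szL.
- rewrite all2E size_map eqxx /=; apply/allP=> p; rewrite -[X in zip X _]map_id zip_map.
  case/mapP=> Z /canL cZ -> /=; rewrite /lists_edges map_inj_in_uniq ?(canon_uniq hE cZ) /=.
    by apply/eqP/setP=> X; rewrite inE; apply/mapP/imsetP.
  by move=> e f /(canon_sub cZ) eE /(canon_sub cZ) fE; exact: (edge_of_inj hE).
Qed.

Theorem theorem7 (C : instance -> Prop) (C_tractable : tractable C) :
  exists (c : cmd) (tp sp : {poly nat}),
  forall (J : instance), C J ->
  forall Es : seq ('I_(gsize J) * 'I_(gsize J)),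
    lists_edges Es (edges (gra J)) ->
  exists (s : store) (t m : nat) (o : trace),
    [/\ exec (orc J) c [:: Node (enc_nat (gsize J)) (enc_edges Es)] s t m o,
        outputs_solutions_in_order J o,
        linear_incremental o #|solutions J| (peval tp (nQtime J))
      & m <= peval sp (nQspace J)].
Proof.
case: C_tractable => _ _ /solver_exists[solve [hsolve comp_solve]].
have [chit [Ph [hPh hh]]] := @comp_hit C.
have [cstep [Ps [hPs hst]]] := comp_step comp_solve.
have [croot [Pr [hPr hr]]] := comp_root comp_solve.
have pI : polyb bI by rewrite /bI /bM /bW /bB /bH /bE /bM /bE; polyb.
(* The argument of a call has size at most [bI] of the number of vertices; adding the oracle cost
   keeps it below [bI k + k], where [k] is the sum of that number and the cost. *)
pose Tc k := Ph (bI k + k) + Ps (bI k + k) + Pr (bI k + k).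
have pT : polyb Tc.
  have c f : polyb f -> polyb (fun k => f (bI k + k)).
    by move=> pf; apply: (polyb_comp pf); polyb.
  exact: (polyb_add (polyb_add (c _ hPh) (c _ hPs)) (c _ hPr)).
(* The cost charged to one visit, times [bE k + 1], which bounds the number of levels. *)
pose tf k := (2 * Tc k + bM k + 50 + Tc k + 40) * (bE k + 1).
pose sf k := 2 * (bI k + (bM k + 3) + bW k) + 2 * Tc k + 20 + 2 * (bI k + (bM k + 3) + bW k) + 20.
have pM : polyb bM by rewrite /bM /bE; polyb.
have pE : polyb bE by rewrite /bE; polyb.
have pW : polyb bW by rewrite /bW /bM /bB /bH /bE; polyb.
have [tp htp] : exists p : {poly nat}, forall k, tf k <= peval p k.
  by apply: polyb_poly; rewrite /tf; polyb.
have [sp hsp] : exists p : {poly nat}, forall k, sf k <= peval p k.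
  by apply: polyb_poly; rewrite /sf; polyb.
exists (main croot chit cstep), tp, sp => J CJ Es hEs.
pose w : world C := World CJ hEs.
have zIn : zI w <= bI (gsize J).
  rewrite /zI /bI /inp tsizeN tsize_enc_nat.
  have : tsize (enc_edges Es) <= bM (gsize J).
    apply: leq_trans (tsize_enc_edges _) _.
    by rewrite leq_add2r leq_mul2r (size_Es w) orbT.
  by rewrite /=; lia.
have zIQ z Q : z <= zI w -> z + Q <= bI (gsize J + Q) + (gsize J + Q).
  move=> hz; apply: leq_add (leq_addl _ _); apply: leq_trans hz _.
  by apply: leq_trans zIn (polyb_le pI (leq_addr _ _)).
have [|||s [t [m [o [e1 d1 w1 c1]]]]] := @exec_main C w (solve w) (hsolve w) chit cstep
  (Tc (nQtime J)) (Tc (nQspace J)) _ _ croot _.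
- move=> g hz; have [r _] := hh w g; apply: runs_le r _ _.
    have := polyb_le hPh (zIQ _ (otime (orc J)) hz); rewrite /Tc /nQtime /=; lia.
  have := polyb_le hPh (zIQ _ (ospace (orc J)) hz); rewrite /Tc /nQspace /=; lia.
- move=> g hz; have [r _] := hst w g; apply: runs_le r _ _.
    have := polyb_le hPs (zIQ _ (otime (orc J)) hz); rewrite /Tc /nQtime /=; lia.
  have := polyb_le hPs (zIQ _ (ospace (orc J)) hz); rewrite /Tc /nQspace /=; lia.
- have [r _] := hr w false; have hz : tsize (@ein C w tB false) <= zI w.
    by rewrite tsize_ein /zI /=; change (tsize Leaf) with 1; lia.
  apply: runs_le r _ _.
    have := polyb_le hPr (zIQ _ (otime (orc J)) hz); rewrite /Tc /nQtime /=; lia.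
  have := polyb_le hPr (zIQ _ (ospace (orc J)) hz); rewrite /Tc /nQspace /=; lia.
have [ho hN] := outs_in_order (hsolve w) w1.
exists s, t, m, o; split=> //; last first.
  apply: leq_trans (leq_trans d1 _) (hsp _).
  have nQ : gsize J <= nQspace J := leq_addr _ _.
  have := polyb_le pI nQ; have := polyb_le pM nQ; have := polyb_le pW nQ.
  by rewrite /S2 /S1 /sf /=; lia.
move=> i; rewrite hN => hi.
have := @flags_count _ _ _ _ (wedgesP w) (solve w) (hsolve w) (Rt (wedges w) (solve w)) [::] i (leqnn _).
rewrite subn0 add0n => /(_ _ (leq0n i) hi) h.
have {}h : i <= count id (take (i * (size (Rt (wedges w) (solve w))).+1)
    (flags (mat w) (wedges w) (solve w) (Rt (wedges w) (solve w)))).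
  by apply: h => Z sZ; rewrite ltnNge (sol_le (wedgesP w) (hsolve w) sZ).
apply: leq_trans h (leq_trans (c1 _) _); apply: sub_count => p /leq_trans; apply.
rewrite mulnC -mulnA leq_mul2l; apply/orP; right.
apply: leq_trans (htp _); rewrite mulnC /tf.
have nQ : gsize J <= nQtime J := leq_addr _ _.
apply: leq_mul; first by have := polyb_le pM nQ; rewrite /T1 /=; lia.
rewrite -addn1 leq_add2r; apply: leq_trans (size_R (hsolve w)) _.
exact: (polyb_le pE nQ).
Qed.
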